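(* Assume the model and Assumption (A) of the context. Let $\widehat\beta^{\mathrm{init}}_n$ be an initial estimator satisfying $$\|\widehat\beta^{\mathrm{init}}_n-\beta^*\|_2\le C_{\mathrm{init}}\sqrt s\Big(\frac{\log p}{n}\Big)^{1/2},\qquad \|\widehat\beta^{\mathrm{init}}_n-\beta^*\|_1\le C_{\mathrm{init}}\,s\Big(\frac{\log p}{n}\Big)^{1/2},\qquad C_{\mathrm{init}}\ge1,$$ and put $\overline S=\big\{k\in\{1,\dots,p\}:|\widehat\beta^{\mathrm{init}}_{n,k}|>C_{\mathrm{init}}(\log p/n)^{1/2}\big\}$. (1) Suppose that $\big\|\big((\mathbb E[\mathbf X_1\mathbf X_1^\top])_{SS}\big)^{-1}\big\|_{\mathrm M,\infty}\le C_{S,X}$ for a positive constant $C_{S,X}$. Then there exist positive constants $a_1\le a_2$, $\ell_1\le\ell_2$, $K_1,K_2,K_3,c_1,c_2,c_3$, not depending on $n,p,s$, such that if $a_1(\log p/n)^{1/2}\le\alpha_n\le a_2(\log p/n)^{1/2}$, $\ \ell_1|\overline S|^{1/2}\log(p)/n\le\lambda_n\le\ell_2|\overline S|^{1/2}\log(p)/n$, and $$n\ge K_1s^2\log p,\qquad\beta^*_{\min}\ge K_2\,s\Big(\frac{\log p}{n}\Big)^{1/2},$$ then with probability at least $1-c_1\exp(-c_2n)-c_3/p^2$ the adaptive LASSO pseudo Huber estimator $\widehat\beta^{\mathrm{AL}}_n$ satisfies $$\operatorname{sign}(\widehat\beta^{\mathrm{AL}}_n)=\operatorname{sign}(\beta^*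 )\qquad\text{and}\qquad\|\widehat\beta^{\mathrm{AL}}_n-\beta^*\|_\infty\le K_3\Big(\frac{\log p}{n}\Big)^{1/2}.$$ (2) If the assumption on $\big\|\big((\mathbb E[\mathbf X_1\mathbf X_1^\top])_{SS}\big)^{-1}\big\|_{\mathrm M,\infty}$ is dropped but instead $s\le\log p$, then (with such constants, not depending on $n,p,s$, and with all other hypotheses of (1)) with probability at least $1-c_1\exp(-c_2n)-c_3/p^2$ $$\operatorname{sign}(\widehat\beta^{\mathrm{AL}}_n)=\operatorname{sign}(\beta^* )\qquad\text{and}\qquad\|\widehat\beta^{\mathrm{AL}}_n-\beta^*\|_\infty\le K_3\sqrt s\Big(\frac{\log p}{n}\Big)^{1/2}.$$
   Context: Model: $(\mathbf X_j,\varepsilon_j)$, $j=1,\dots,n$, are i.i.d., $\mathbf X_j\in\mathbb R^p$, $\varepsilon_j\in\mathbb R$ (possibly dependent on $\mathbf X_j$), $\mathbb E[\varepsilon_j\mid\mathbf X_j]=0$, and $Y_j=\mathbf X_j^\top\beta^*+\varepsilon_j$ with $\beta^*\in\mathbb R^p$. $S=\{k:\beta^*_k\neq0\}$, $s=|S|$, $\beta^*_{\min}=\min_{k\in S}|\beta^*_k|$. Assumption (A): (i) for $m=2$ or $m=3$ and some $q>1$, $\mathbb E\big[\mathbb E[|\varepsilon_1|^m\mid\mathbf X_1]^q\big]\le C_\epsilon<\infty$; (ii) $0<c_l\le\lambda_{\min}(\mathbb E[\mathbf X_1\mathbf X_1^\top])\le\lambda_{\max}(\mathbb E[\mathbf X_1\mathbf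 X_1^\top])\le c_u<\infty$; (iii) for all $v\in\mathbb R^p\setminus\{0\}$ and $t\ge0$, $\mathbb P(|v^\top\mathbf X_1|\ge t)\le2\exp(-t^2/(2c_{\mathrm{sub}}^2\|v\|_2^2))$, with $c_{\mathrm{sub}}>0$. Pseudo Huber loss: $l_\alpha(x)=2\alpha^{-2}(\sqrt{1+\alpha^2x^2}-1)$ and $\mathcal L_{n,\alpha}(\beta)=\frac1n\sum_{i=1}^n l_\alpha(Y_i-\mathbf X_i^\top\beta)$. The adaptive LASSO pseudo Huber estimator $\widehat\beta_n^{\mathrm{AL}}$ is a solution of $\min_{\beta\in\mathbb R^p}\big(\mathcal L_{n,\alpha_n}(\beta)+\lambda_n\sum_{k=1}^pw_k|\beta_k|\big)$ with weights $w_k=\max\{1/|\widehat\beta^{\mathrm{init}}_{n,k}|,1\}$; if $\widehat\beta^{\mathrm{init}}_{n,k}=0$ (so formally $w_k=\infty$) one requires $\beta_k=0$. $M_{SS}$ is the submatrix with rows and columns in $S$; $\|M\|_{\mathrm M,\infty}=\max_i\sum_j|M_{ij}|$. $\operatorname{sign}$ acts coordinatewise with $\operatorname{sign}(0)=0$. All constants whose existence is claimed may depend on $m,q,C_\epsilon,c_l,c_u,c_{\mathrm{sub}},C_{\mathrm{init}}$, in part (1) on $C_{S,X}$, and on a fixed bound $C_\beta\ge\max(1/8,2\|\beta^*\|_2)$, but not on $n,p,s$. *)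

(* Defs.v *)
From HB Require Import structures.
From mathcomp Require Import all_boot all_order all_algebra.
From mathcomp Require Import all_classical all_reals all_analysis.
Import Order.TTheory GRing.Theory Num.Theory.
Import numFieldNormedType.Exports.

Set Implicit Arguments.
Unset Strict Implicit.
Unset Printing Implicit Defensive.

Local Open Scope classical_set_scope.
Local Open Scope ring_scope.

Section probability.
Context d d' (T : measurableType d) (T' : measurableType d') (R : realType).
Variable P : probability T R.

(* Taking some of the [B j] equal to [setT] gives the product rule for every
   subfamily. *)
Definition mutually_independent n (Z : 'I_n -> T -> T') : Prop :=
  forall B : 'I_n -> set T', (forall j, measurable (B j)) ->
    P (\bigcap_(j in [set: 'I_n]) (Z j @^-1` B j)) =
    (\prod_(j < n) P (Z j @^-1` B j))%E.

Definition identically_distributed n (Z : 'I_n -> T -> T') : Prop :=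
  forall (i j : 'I_n) (B : set T'), measurable B ->
    P (Z i @^-1` B) = P (Z j @^-1` B).

(* [h] is a version of the conditional expectation E[f | X], that is, of
   E[f | sigma(X)]. *)
Definition is_cond_expectation (X : T -> T') (f h : T -> R) : Prop :=
  [/\ P.-integrable [set: T] (EFin \o f),
      P.-integrable [set: T] (EFin \o h),
      measurable_fun [set: g_sigma_algebra_preimageType X]
        (h : g_sigma_algebra_preimageType X -> R) &
      forall A : set T, g_sigma_algebra_preimage X A ->
        (\int[P]_(w in A) (h w)%:E = \int[P]_(w in A) (f w)%:E)%E].

(* [E] need not be measurable: the bound is on its inner probability. *)
Definition with_probability_at_least (r : R) (E : set T) : Prop :=
  exists A : set T, [/\ measurable A, A `<=` E & (r%:E <= P A)%E].

End probability.

Section vectors.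
Context (R : realType) (p : nat).

(* Covariates are [p.-tuple R], which carries the product sigma-algebra, while
   coefficients are ['rV[R]_p]. *)
Definition dot (x : p.-tuple R) (b : 'rV[R]_p) : R :=
  \sum_(k < p) tnth x k * b 0 k.

Definition l1norm (b : 'rV[R]_p) : R := \sum_(k < p) `|b 0 k|.
Definition l2norm (b : 'rV[R]_p) : R := Num.sqrt (\sum_(k < p) b 0 k ^+ 2).
Definition linfnorm (b : 'rV[R]_p) : R := \big[Num.max/0]_(k < p) `|b 0 k|.

Definition sign_vec (b : 'rV[R]_p) : 'rV[R]_p := map_mx Num.sg b.

Definition supp (b : 'rV[R]_p) : {set 'I_p} := [set k | b 0 k != 0]%SET.

(* Extended-real valued, so that the minimum over an empty support is +oo. *)
Definition beta_min (b : 'rV[R]_p) : \bar R :=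
  \big[Order.min/+oo%E]_(k in supp b) `|b 0 k|%:E.

End vectors.

Section matrices.
Context (R : realType) (p : nat).

(* Only used for real symmetric matrices with p >= 1, whose set of (real)
   eigenvalues is finite and nonempty. *)
Definition lambda_min (M : 'M[R]_p) : R := inf [set a : R | eigenvalue M a].
Definition lambda_max (M : 'M[R]_p) : R := sup [set a : R | eigenvalue M a].

Definition principal_submx (S : {set 'I_p}) (M : 'M[R]_p) : 'M[R]_#|S| :=
  mxsub enum_val enum_val M.

Definition norm_M_infty (M : 'M[R]_p) : R :=
  \big[Num.max/0]_(i < p) \sum_(j < p) `|M i j|.

End matrices.

Section model.
Context d (T : measurableType d) (R : realType) (P : probability T R).

Definition second_moment p (X : {RV P >-> p.-tuple R}) : 'M[R]_p :=
  \matrix_(k, l) fine 'E_P[fun w => (tnth (X w) k * tnth (X w) l)%R]%E.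

Definition regression_model n p (X : 'I_n -> {RV P >-> p.-tuple R})
    (eps : 'I_n -> {RV P >-> R}) : Prop :=
  let Z j w := (X j w, eps j w) in
  [/\ mutually_independent P Z,
      identically_distributed P Z &
      forall j, is_cond_expectation P (X j) (eps j) (cst 0)].

Definition response n p (X : 'I_n -> {RV P >-> p.-tuple R})
    (eps : 'I_n -> {RV P >-> R}) (bstar : 'rV[R]_p) (w : T) (j : 'I_n) : R :=
  dot (X j w) bstar + eps j w.

(* Versions of the conditional moment agree almost surely, so the choice of [h]
   is immaterial; integrability of |eps|^m, part of [is_cond_expectation],
   follows from finiteness of the q-th moment, q > 1. *)
Definition cond_moment_bound p (m : nat) (q Ceps : R)
    (X : {RV P >-> p.-tuple R}) (eps : {RV P >-> R}) : Prop :=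
  exists2 h : T -> R,
    is_cond_expectation P X (fun w => `|eps w| ^+ m) h &
    ('E_P[fun w => (h w `^ q)%R] <= Ceps%:E)%E.

Definition subgaussian p (csub : R) (X : {RV P >-> p.-tuple R}) : Prop :=
  forall (v : 'rV[R]_p) (t : R), v != 0 -> 0 <= t ->
    (P [set w | (t <= `|dot (X w) v|)%R] <=
      (2 * expR (- (t ^+ 2 / (2 * csub ^+ 2 * l2norm v ^+ 2))))%:E)%E.

Definition assumption_A p (m : nat) (q Ceps cl cu csub : R)
    (X : {RV P >-> p.-tuple R}) (eps : {RV P >-> R}) : Prop :=
  [/\ [/\ m = 2%N \/ m = 3%N, 1 < q & cond_moment_bound m q Ceps X eps],
      [/\ 0 < cl, cl <= lambda_min (second_moment X)
        & lambda_max (second_moment X) <= cu] &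
      0 < csub /\ subgaussian csub X].

End model.

Section estimator.
Context (R : realType).

Definition pseudo_huber (alpha x : R) : R :=
  2 * alpha ^- 2 * (Num.sqrt (1 + alpha ^+ 2 * x ^+ 2) - 1).

Definition empirical_loss n p (alpha : R) (X : 'I_n -> p.-tuple R)
    (Y : 'I_n -> R) (b : 'rV[R]_p) : R :=
  n%:R^-1 * \sum_(i < n) pseudo_huber alpha (Y i - dot (X i) b).

(* Where [init 0 k = 0] the value below is a dummy: the weight is formally
   infinite and [al_feasible] forces the coordinate to vanish. *)
Definition al_weight p (init : 'rV[R]_p) (k : 'I_p) : R :=
  Num.max (`|init 0 k|^-1) 1.

Definition al_feasible p (init b : 'rV[R]_p) : Prop :=
  forall k, init 0 k = 0 -> b 0 k = 0.

Definition al_objective n p (alpha lambda : R) (init : 'rV[R]_p)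
    (X : 'I_n -> p.-tuple R) (Y : 'I_n -> R) (b : 'rV[R]_p) : R :=
  empirical_loss alpha X Y b
    + lambda * \sum_(k < p) al_weight init k * `|b 0 k|.

Definition is_adaptive_lasso n p (alpha lambda : R) (init : 'rV[R]_p)
    (X : 'I_n -> p.-tuple R) (Y : 'I_n -> R) (bhat : 'rV[R]_p) : Prop :=
  al_feasible init bhat /\
  forall b, al_feasible init b ->
    al_objective alpha lambda init X Y bhat <=
    al_objective alpha lambda init X Y b.

Definition rate (n p : nat) : R := Num.sqrt (ln p%:R / n%:R).

Definition init_bounds n p (Cinit : R) (bstar init : 'rV[R]_p) : Prop :=
  l2norm (init - bstar) <= Cinit * Num.sqrt #|supp bstar|%:R * rate n p /\
  l1norm (init - bstar) <= Cinit * #|supp bstar|%:R * rate n p.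

Definition Sbar (n : nat) p (Cinit : R) (init : 'rV[R]_p) : {set 'I_p} :=
  [set k | Cinit * rate n p < `|init 0 k|]%SET.

End estimator.

Arguments rate {R} n p.

(* Main.v *)
Require Import Defs.
From HB Require Import structures.
From mathcomp Require Import all_boot all_order all_algebra.
From mathcomp Require Import finmap.
From mathcomp Require Import all_classical all_reals all_analysis.
From mathcomp Require Import measurable_realfun.
From mathcomp Require Import ring lra.
Import Order.TTheory GRing.Theory Num.Theory.
Import numFieldNormedType.Exports.

Set Implicit Arguments.
Unset Strict Implicit.
Unset Printing Implicit Defensive.

Local Open Scope classical_set_scope.
Local Open Scope ring_scope.

(** Write [t] for [rate n p], [S] for the support of [bstar] and [Sigma] for the
    second moment matrix of the covariates; all constants take [alpha = t] and
    [lambda = l * sqrt #|Sbar| * t ^ 2].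

    The estimator is compared with a witness: a minimiser of the same objective
    among the vectors supported in [S]. Everything rests on how the empirical
    score [w |-> mean (psi (eps_i - X_i . D) * (X_i . w))], with
    [psi x = 2 * x / sqrt (1 + t ^ 2 * x ^ 2)], reacts to a displacement [D]
    supported in [S].

    Noise. Since [t * psi] is bounded and the bias of [psi] is of order [t]
    under a second moment of the noise, [t * psi(eps) * (X . w)] has an
    exponential moment [1 + O(t ^ 2)]. As [n * t ^ 2 = ln p], the bound of
    Chernoff makes the score at [D = 0] of order [t] in a fixed direction, up to
    probability [p ^ -5] ([huber_noise_mgf], [deviation_probability]). The
    noise enters through [E(eps ^ 2 * G X)] alone, which conditioning and the
    inequality of Young bound ([dominated_noise_moment]).

    Linearization. The score changes by [2 * (w Sigma D)] up to an error that is
    a small multiple of [t], uniformly over [D] of Euclidean norm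
    [O (sqrt #|S| * t)] ([score_corr_linearization]). The uniformity is
    elementary: after expanding [X_i . D] in coordinates, the error is the l1
    norm of [D], hence [O (#|S| * t)], times [p ^ 3] averages that do not depend
    on [D], and [#|S| * t] is small because [n >= K1 * #|S| ^ 2 * ln p].

    Directions. Both facts are used along [p] fixed directions: the unit vectors
    [e_k] for [k] in [S], and for the other [k] the residuals [e_k - theta_k] of
    the best linear prediction of [X_k] by the coordinates in [S]
    ([projection_coefficients]). The latter are [Sigma]-orthogonal to [S], so
    that the score along them does not feel [D] at first order.

    Weights. The initial bounds and the lower bound on the signal give
    [lambda * w_k <= t / sqrt #|S|] on [S], and [lambda * w_k >= l / Cinit * t]
    off [S] ([weight_on_support], [weight_off_support]).

    Conclusion ([primal_dual_witness]). Along [S] the linearization gives strong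
    convexity, so the witness is at distance [O (sqrt #|S| * t)] of [bstar]. Off
    [S] its score is the score along the residual direction, of order [t], plus
    [theta_k] paired with the score on [S], which the stationarity conditions
    bound by the penalty there. This is below the penalty level off [S], so by
    convexity every minimiser vanishes off [S]. The sign equality follows from
    the signal strength, and the sup norm bound of order [t] from applying the
    inverse of [Sigma_SS] to [Sigma D = O(t)]. *)

(** * The pseudo Huber loss and its score *)
Section pseudo_huber_loss.
Context (R : realType).
Implicit Types a x y e u : R.

Definition huber_root a x : R := Num.sqrt (1 + a ^+ 2 * x ^+ 2).

Definition huber_score a x : R := 2 * x / huber_root a x.

Lemma huber_root_sqr a x : huber_root a x ^+ 2 = 1 + a ^+ 2 * x ^+ 2.
Proof. by rewrite sqr_sqrtr // addr_ge0 // mulr_ge0 ?sqr_ge0. Qed.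

Lemma huber_root_ge1 a x : 1 <= huber_root a x.
Proof. by rewrite -[leLHS]sqrtr1 ler_wsqrtr // lerDl mulr_ge0 ?sqr_ge0. Qed.

Lemma huber_root_ge a x : `|a * x| <= huber_root a x.
Proof. by rewrite -sqrtr_sqr ler_wsqrtr // exprMn lerDr. Qed.

Lemma huber_score_bound a x : 0 < a -> a * `|huber_score a x| <= 2.
Proof.
move=> a0; have A1 := huber_root_ge1 a x; have Aax := huber_root_ge a x.
have A0 : 0 < huber_root a x by lra.
rewrite /huber_score normrM (ger0_norm (x:=(huber_root a x)^-1)); last by rewrite invr_ge0 ltW.
rewrite mulrA ler_pdivrMr // normrM (ger0_norm (x:=2)) //.
by rewrite normrM (gtr0_norm a0) in Aax; lra.
Qed.

Lemma huber_score_le a x : `|huber_score a x| <= 2 * `|x|.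
Proof.
have A1 := huber_root_ge1 a x; have A0 : 0 < huber_root a x by lra.
rewrite /huber_score normrM (ger0_norm (x:=(huber_root a x)^-1)); last by rewrite invr_ge0 ltW.
rewrite ler_pdivrMr // normrM (ger0_norm (x:=2)) //.
by rewrite ler_peMr // mulr_ge0.
Qed.

(** The exact remainder of the tangent line. Convexity and smoothness of the loss
    both come from the factor [A * B - 1 - a ^ 2 * x * y], where [A], [B] are the
    two roots: it is nonnegative by Cauchy-Schwarz applied to [(1, a * x)] and
    [(1, a * y)], and at most [(a * (y - x)) ^ 2 / 2] by the inequality of the
    means. *)
Lemma huber_expansion a x y : 0 < a ->
  pseudo_huber a y - pseudo_huber a x - huber_score a x * (y - x) =
  2 * a ^- 2 * (huber_root a x * huber_root a y - 1 - a ^+ 2 * x * y)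
    / huber_root a x.
Proof.
move=> a0; rewrite /pseudo_huber /huber_score -!/(huber_root a _).
have A1 := huber_root_ge1 a x; have AA := huber_root_sqr a x.
have A0 : huber_root a x != 0 by apply/eqP; lra.
have a00 : a != 0 by rewrite gt_eqF.
move: A0 AA; move: (huber_root a x) (huber_root a y) => A B A0 AA.
have -> : 1 = A ^+ 2 - a ^+ 2 * x ^+ 2 by rewrite AA; ring.
by field; apply/andP.
Qed.

Lemma huber_above_tangent a x y : 0 < a ->
  pseudo_huber a x + huber_score a x * (y - x) <= pseudo_huber a y.
Proof.
move=> a0; rewrite -subr_ge0 opprD addrA huber_expansion //.
have A1 := huber_root_ge1 a x; have AA := huber_root_sqr a x.
have B1 := huber_root_ge1 a y; have BB := huber_root_sqr a y.
apply: divr_ge0; last by lra.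
apply: mulr_ge0; first by rewrite mulr_ge0 // invr_ge0 sqr_ge0.
move: A1 AA B1 BB; move: (huber_root a x) (huber_root a y) => A B A1 AA B1 BB.
suff : 1 + a ^+ 2 * x * y <= A * B by lra.
apply: le_trans (ler_norm _) _.
rewrite -[leRHS]ger0_norm; last by apply: mulr_ge0; lra.
rewrite -ler_sqr ?nnegrE // -!normrX !ger0_norm ?sqr_ge0 // exprMn AA BB.
rewrite -subr_ge0.
have -> : (1 + a ^+ 2 * x ^+ 2) * (1 + a ^+ 2 * y ^+ 2) - (1 + a ^+ 2 * x * y) ^+ 2
  = (a * (x - y)) ^+ 2 by ring.
exact: sqr_ge0.
Qed.

Lemma huber_below_parabola a x y : 0 < a ->
  pseudo_huber a y <= pseudo_huber a x + huber_score a x * (y - x) + (y - x) ^+ 2.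
Proof.
move=> a0; rewrite -lerBlDl opprD addrA huber_expansion //.
have A1 := huber_root_ge1 a x; have AA := huber_root_sqr a x.
have BB := huber_root_sqr a y.
rewrite ler_pdivrMr; last by lra.
rewrite mulrAC ler_pdivrMr ?exprn_gt0 //.
move: A1 AA BB; move: (huber_root a x) (huber_root a y) => A B A1 AA BB.
have AB := sqr_ge0 (A - B).
have h : 0 <= (y - x) ^+ 2 * a ^+ 2 by rewrite mulr_ge0 ?sqr_ge0.
have h' := ler_wpM2l h A1.
by nra.
Qed.

(** The score differs from the linear map [2 * u] only where it clips, at [e] or
    at [e - u]. The two truncated squares measure the clipping; being bounded,
    they keep exponential moments when the noise has only two moments. *)
Lemma huber_score_incr_linear a e u : 0 < a ->
  `|huber_score a e - huber_score a (e - u) - 2 * u| <=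
  6 * `|u| * (Num.min 1 (a ^+ 2 * e ^+ 2) + Num.min 1 (a ^+ 2 * u ^+ 2)).
Proof.
move=> a0; set y := e - u.
have A1 := huber_root_ge1 a e; have AA := huber_root_sqr a e.
have B1 := huber_root_ge1 a y; have BB := huber_root_sqr a y.
have Be := huber_root_ge a y; have Ae := huber_root_ge a e.
rewrite /huber_score.
move: A1 AA B1 BB Be Ae; move: (huber_root a e) (huber_root a y) => A B A1 AA B1 BB Be Ae.
have A0 : 0 < A by lra.
have B0 : 0 < B by lra.
have AB0 : 0 < A * B * (A + B) by rewrite !mulr_gt0 // addr_gt0.
(* [c1] comes from the slope at [e], [c2] from the change of the root. *)
pose c1 := 1 - A^-1.
pose c2 := y * a ^+ 2 * (e + y) / (A * B * (A + B)).
have hAB : A^-1 - B^-1 = - (a ^+ 2 * u * (e + y) / (A * B * (A + B))).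
  have -> : a ^+ 2 * u * (e + y) = A ^+ 2 - B ^+ 2 by rewrite AA BB /y; ring.
  by field; rewrite !gt_eqF //= addr_gt0.
have -> : 2 * e / A - 2 * y / B - 2 * u = - (2 * u * (c1 + c2)).
  have -> : 2 * e / A - 2 * y / B - 2 * u = 2 * u * (A^-1 - 1) + 2 * y * (A^-1 - B^-1).
    by rewrite /y; ring.
  by rewrite hAB /c1 /c2; ring.
rewrite normrN normrM (normrM 2) ger0_norm //.
have c1_ge0 : 0 <= c1 by rewrite subr_ge0 invf_le1.
have c1_le1 : c1 <= 1 by rewrite gerBl invr_ge0 ltW.
have c1_le : c1 <= a ^+ 2 * e ^+ 2.
  rewrite (_ : c1 = (A - 1) / A); last by rewrite /c1; field; rewrite gt_eqF.
  by rewrite ler_pdivrMr //; nra.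
have ny : 0 <= `|y| by []. 
have ney : 0 <= `|e + y| by [].
have c2E : `|c2| = `|y| * a ^+ 2 * `|e + y| / (A * B * (A + B)).
  by rewrite /c2 normrM normfV (gtr0_norm AB0) !normrM -expr2 real_normK ?num_real.
have c2_le1 : `|c2| <= 1.
  rewrite c2E ler_pdivrMr // mul1r.
  have h1 : a * `|y| <= B by rewrite normrM (gtr0_norm a0) in Be.
  have h2 : a * `|e + y| <= A + B.
    rewrite -(gtr0_norm a0) -normrM mulrDr; apply: le_trans (ler_normD _ _) _.
    exact: lerD.
  have -> : `|y| * a ^+ 2 * `|e + y| = (a * `|y|) * (a * `|e + y|) by ring.
  rewrite -[leRHS]mulrA.
  apply: le_trans (_ : B * (A + B) <= _).
    by apply: ler_pM; [rewrite mulr_ge0 // ltW|rewrite mulr_ge0 // ltW|exact: h1|exact: h2].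
  by rewrite ler_peMl // mulr_ge0 //; lra.
have c2_le : `|c2| <= a ^+ 2 * (2 * e ^+ 2 + 3 / 2 * u ^+ 2).
  rewrite c2E ler_pdivrMr //.
  have AB2 : 2 <= A * B * (A + B) by nra.
  have h : `|y| * `|e + y| <= 4 * e ^+ 2 + 3 * u ^+ 2.
    have hp := sqr_ge0 (e + u); have hm := sqr_ge0 (e - u).
    have he := sqr_ge0 e; have hu := sqr_ge0 u.
    by rewrite -normrM /y ler_norml; apply/andP; split; lra.
  have h0 : 0 <= a ^+ 2 * (2 * e ^+ 2 + 3 / 2 * u ^+ 2).
    by apply: mulr_ge0; [exact: sqr_ge0|have := sqr_ge0 e; have := sqr_ge0 u; lra].
  have := ler_wpM2l h0 AB2; have := ler_wpM2l (sqr_ge0 a) h; lra.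
have c_le2 : `|c1 + c2| <= 2.
  apply: le_trans (ler_normD _ _) _; rewrite (ger0_norm c1_ge0); lra.
have c_le : `|c1 + c2| <= 3 * (a ^+ 2 * e ^+ 2 + a ^+ 2 * u ^+ 2).
  apply: le_trans (ler_normD _ _) _; rewrite (ger0_norm c1_ge0).
  have h : 0 <= a ^+ 2 * u ^+ 2 by rewrite mulr_ge0 ?sqr_ge0.
  have h' : 0 <= a ^+ 2 * e ^+ 2 by rewrite mulr_ge0 ?sqr_ge0.
  lra.
have -> : 6 * `|u| = 2 * `|u| * 3 by ring.
rewrite -[leRHS]mulrA; apply: ler_wpM2l; first by rewrite mulr_ge0.
have me : 0 <= a ^+ 2 * e ^+ 2 by rewrite mulr_ge0 ?sqr_ge0.
have mu : 0 <= a ^+ 2 * u ^+ 2 by rewrite mulr_ge0 ?sqr_ge0.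
by case: (leP 1 (a ^+ 2 * e ^+ 2)) => h1; case: (leP 1 (a ^+ 2 * u ^+ 2)) => h2; lra.
Qed.

Lemma huber_score_mono a x y : 0 < a ->
  0 <= (huber_score a x - huber_score a y) * (x - y).
Proof.
move=> a0; have h1 := huber_above_tangent x y a0.
by have h2 := huber_above_tangent y x a0; nra.
Qed.

End pseudo_huber_loss.

(** Clipping costs a bias linear in [a] as soon as a second moment exists: for
    [a] equal to the rate, this is the size of the stochastic error. *)
Lemma huber_score_bias (R : realType) (a x : R) : 0 < a ->
  `|huber_score a x - 2 * x| <= 2 * a * x ^+ 2.
Proof.
move=> a0; have A1 := huber_root_ge1 a x; have AA := huber_root_sqr a x.
have A0 : 0 < huber_root a x by lra.
rewrite /huber_score; move: A0 A1 AA; move: (huber_root a x) => A A0 A1 AA.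
have Aax : A <= 1 + a * `|x|.
  have ax : 0 <= a * `|x| by rewrite mulr_ge0 // ltW.
  rewrite -ler_sqr ?nnegrE; [|exact: ltW|by lra].
  by rewrite AA -[x ^+ 2]real_normK ?num_real //; lra.
have -> : 2 * x / A - 2 * x = - (2 * x * ((A - 1) / A)) by field; rewrite gt_eqF.
have h0 : 0 <= (A - 1) / A by rewrite divr_ge0 //; lra.
rewrite normrN normrM (ger0_norm h0) normrM (ger0_norm (x:=2)) //.
have h1 : (A - 1) / A <= a * `|x|.
  by rewrite ler_pdivrMr //; have := mulr_ge0 (ltW a0) (normr_ge0 x); nra.
have := ler_wpM2l (normr_ge0 x) h1.
rewrite -[x ^+ 2]real_normK ?num_real //; lra.
Qed.

(** * Norms, supports and compact sets of row vectors *)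
Section row_vectors.
Context (R : realType) (p : nat).
Implicit Types (u v w : 'rV[R]_p) (M : 'M[R]_p) (S : {set 'I_p})
  (x : p.-tuple R).

Lemma cauchy_schwarz_sum (I : finType) (a b : I -> R) :
  (\sum_i a i * b i) ^+ 2 <= (\sum_i a i ^+ 2) * (\sum_i b i ^+ 2).
Proof.
set A := \sum_i a i ^+ 2; set B := \sum_i b i ^+ 2; set C := \sum_i a i * b i.
have B0 : 0 <= B by apply: sumr_ge0 => i _; exact: sqr_ge0.
have [B00|Bn0] := eqVneq B 0.
  have b0 i : b i = 0.
    apply/eqP; rewrite -sqrf_eq0; move/eqP: B00.
    rewrite psumr_eq0 => [/allP/(_ i)|j _]; last exact: sqr_ge0.
    by rewrite mem_index_enum => /(_ isT).
  by rewrite /C big1 ?expr0n /= ?mulr_ge0 // ?sumr_ge0 // => i _; rewrite ?sqr_ge0 // b0 mulr0.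
have Bp : 0 < B by rewrite lt_neqAle eq_sym Bn0.
rewrite -subr_ge0 -(pmulr_rge0 _ Bp).
have -> : B * (A * B - C ^+ 2) = \sum_i (B * a i - C * b i) ^+ 2.
  rewrite (eq_bigr (fun i => B ^+ 2 * a i ^+ 2 - (2 * B * C) * (a i * b i)
      + C ^+ 2 * b i ^+ 2)); last by move=> i _; ring.
  by rewrite !big_split /= sumrN -!mulr_sumr -/A -/B -/C; ring.
by apply: sumr_ge0 => i _; exact: sqr_ge0.
Qed.

Lemma sumsqr_ge0 u : 0 <= \sum_k u 0 k ^+ 2.
Proof. by apply: sumr_ge0 => k _; exact: sqr_ge0. Qed.

Lemma l2norm_ge0 u : 0 <= l2norm u.
Proof. exact: sqrtr_ge0. Qed.

Lemma l2norm_sqr u : l2norm u ^+ 2 = \sum_k u 0 k ^+ 2.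
Proof. by rewrite sqr_sqrtr // sumsqr_ge0. Qed.

Lemma coord_le_l2norm u k : `|u 0 k| <= l2norm u.
Proof.
rewrite -sqrtr_sqr ler_wsqrtr // (bigD1 k) //= lerDl.
by apply: sumr_ge0 => i _; exact: sqr_ge0.
Qed.

Lemma l2normZ t u : l2norm (t *: u) = `|t| * l2norm u.
Proof.
rewrite /l2norm -sqrtr_sqr -sqrtrM ?sqr_ge0 // mulr_sumr.
by congr Num.sqrt; apply: eq_bigr => k _; rewrite mxE exprMn.
Qed.

Lemma l2normN u : l2norm (- u) = l2norm u.
Proof. by rewrite -scaleN1r l2normZ normrN1 mul1r. Qed.

Lemma ler_l2normD u v : l2norm (u + v) <= l2norm u + l2norm v.
Proof.
rewrite -ler_sqr ?nnegrE ?addr_ge0 ?l2norm_ge0 //.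
rewrite sqrrD !l2norm_sqr.
have -> : \sum_k (u + v) 0 k ^+ 2 = \sum_k u 0 k ^+ 2 + (\sum_k u 0 k * v 0 k) *+ 2 + \sum_k v 0 k ^+ 2.
  by rewrite -sumrMnl -!big_split /=; apply: eq_bigr => k _; rewrite mxE sqrrD.
rewrite lerD2r lerD2l lerMn2r /=.
apply: le_trans (ler_norm _) _; rewrite -sqrtr_sqr -sqrtrM ?sumsqr_ge0 //.
by rewrite ler_wsqrtr // cauchy_schwarz_sum.
Qed.

Lemma l2norm_eq0 u : l2norm u = 0 -> u = 0.
Proof.
move=> u0; apply/rowP => k; rewrite mxE; apply/eqP; rewrite -normr_le0 -u0.
exact: coord_le_l2norm.
Qed.

Lemma l2norm_delta k : l2norm (delta_mx 0 k : 'rV[R]_p) = 1.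
Proof.
rewrite /l2norm (bigD1 k) //= big1 => [|i ik]; last by rewrite mxE (negPf ik) andbF expr0n.
by rewrite mxE !eqxx addr0 expr1n sqrtr1.
Qed.

Definition supported S u := forall k, k \notin S -> u 0 k = 0.

Lemma supportedD S u v : supported S u -> supported S v -> supported S (u + v).
Proof. by move=> hu hv k kS; rewrite mxE hu // hv // addr0. Qed.

Lemma supportedZ S t u : supported S u -> supported S (t *: u).
Proof. by move=> hu k kS; rewrite mxE hu // mulr0. Qed.

Lemma supportedB S u v : supported S u -> supported S v -> supported S (u - v).
Proof. by move=> hu hv k kS; rewrite !mxE hu // hv // subrr. Qed.

Lemma sum_supported S u (f : 'I_p -> R -> R) : supported S u ->
  (forall k, f k 0 = 0) -> \sum_k f k (u 0 k) = \sum_(k in S) f k (u 0 k).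
Proof.
move=> uS f0; rewrite [RHS]big_mkcond; apply: eq_bigr => k _.
by case: ifPn => // /uS ->.
Qed.

Lemma l1norm_le_l2norm S u : supported S u ->
  l1norm u <= Num.sqrt #|S|%:R * l2norm u.
Proof.
move=> uS; rewrite /l2norm -sqrtrM ?ler0n //.
apply: le_trans (ler_norm _) _; rewrite -sqrtr_sqr ler_wsqrtr //.
rewrite /l1norm (sum_supported (f:=fun _ (y : R) => `|y|) uS) => [|_]; last exact: normr0.
have := cauchy_schwarz_sum (fun k => (k \in S)%:R) (fun k => `|u 0 k|).
have -> : \sum_k (k \in S)%:R * `|u 0 k| = \sum_(k in S) `|u 0 k|.
  rewrite [RHS]big_mkcond; apply: eq_bigr => k _.
  by case: (k \in S); rewrite ?mul1r ?mul0r.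
have -> : \sum_k (k \in S)%:R ^+ 2 = #|S|%:R :> R.
  rewrite -sum1_card natr_sum [RHS]big_mkcond; apply: eq_bigr => k _.
  by case: (k \in S); rewrite ?expr1n ?expr0n.
have -> // : \sum_k `|u 0 k| ^+ 2 = \sum_k u 0 k ^+ 2.
by apply: eq_bigr => k _; rewrite real_normK ?num_real.
Qed.

Lemma l1norm_ge0 u : 0 <= l1norm u.
Proof. by apply: sumr_ge0. Qed.

Lemma linfnorm_le u (c : R) : 0 <= c -> (forall k, `|u 0 k| <= c) -> linfnorm u <= c.
Proof. by move=> c0 uc; apply/bigmax_leP; split. Qed.

Lemma dotD x u v : dot x (u + v) = dot x u + dot x v.
Proof. by rewrite /dot -big_split /=; apply: eq_bigr => k _; rewrite mxE mulrDr. Qed.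

Lemma dotZ x t u : dot x (t *: u) = t * dot x u.
Proof. by rewrite /dot mulr_sumr; apply: eq_bigr => k _; rewrite mxE mulrCA. Qed.

Lemma dotN x u : dot x (- u) = - dot x u.
Proof. by rewrite -scaleN1r dotZ mulN1r. Qed.

Lemma dotB x u v : dot x (u - v) = dot x u - dot x v.
Proof. by rewrite dotD dotN. Qed.

Lemma dot_delta x k : dot x (delta_mx 0 k) = tnth x k.
Proof.
rewrite /dot (bigD1 k) //= big1 => [|i ik]; last by rewrite mxE (negPf ik) andbF mulr0.
by rewrite mxE !eqxx mulr1 addr0.
Qed.

Lemma dot_sqr_le S x u : supported S u ->
  dot x u ^+ 2 <= l2norm u ^+ 2 * \sum_(k in S) tnth x k ^+ 2.
Proof.
move=> uS; rewrite l2norm_sqr mulrC.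
have -> : dot x u = \sum_k (if k \in S then tnth x k else 0) * u 0 k.
  by apply: eq_bigr => k _; case: ifPn => // /uS ->; rewrite !mulr0.
apply: le_trans (cauchy_schwarz_sum _ _) _.
rewrite ler_wpM2r ?sumsqr_ge0 // [leRHS]big_mkcond /=.
by apply: ler_sum => k _; case: ifP; rewrite ?expr0n.
Qed.

Lemma continuous_sum_ord (T : topologicalType) (I : finType) (f : I -> T -> R) :
  (forall i, continuous (f i)) -> continuous (fun t => \sum_i f i t).
Proof.
move=> fc; apply: (@continuous_big _ _ +%R) => [[x y]|i _]; last exact: fc.
exact: add_continuous.
Qed.

Lemma continuous_sumsqr : continuous (fun u => \sum_k u 0 k ^+ 2).
Proof.
apply: continuous_sum_ord => k u.
have -> : (fun v : 'rV[R]_p => v 0 k ^+ 2) = (fun v => v 0 k * v 0 k).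
  by apply/funext => v; rewrite expr2.
by apply: continuousM; exact: coord_continuous.
Qed.

Lemma bounded_coord (A : set 'rV[R]_p) (c : R) :
  0 <= c -> (forall u, A u -> forall k, `|u 0 k| <= c) -> bounded_set A.
Proof.
move=> c0 Ac; exists c; split; first exact: num_real.
move=> x cx u /Ac uc; apply: ltW; apply: le_lt_trans cx.
rewrite [leLHS]/Num.norm /= mx_normrE; apply/bigmax_leP; split => // -[i j] _ /=.
by rewrite (ord1 i).
Qed.

Lemma compact_ball S (r : R) : 0 <= r ->
  compact [set u | supported S u /\ l2norm u <= r].
Proof.
move=> r0; apply: bounded_closed_compact.
  by apply: (bounded_coord r0) => u [_ ur] k; apply: le_trans ur; exact: coord_le_l2norm.
have -> : [set u | supported S u /\ l2norm u <= r] =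
    (\bigcap_(k in [set k | k \notin S]) [set u : 'rV[R]_p | u 0 k = 0])
    `&` [set u | \sum_k u 0 k ^+ 2 <= r ^+ 2].
  rewrite eqEsubset; split => u [h1 h2]; split => //=.
    by rewrite -l2norm_sqr ler_sqr ?nnegrE ?l2norm_ge0.
  by move: h2; rewrite /= -l2norm_sqr ler_sqr ?nnegrE ?l2norm_ge0.
apply: closedI.
  apply: closed_bigI => k _.
  apply: (@preimage_closed _ _ (fun u : 'rV[R]_p => u 0 k) [set y : R | y = 0]).
    by move=> u _; exact: coord_continuous.
  exact: closed_eq.
apply: (@preimage_closed _ _ (fun u : 'rV[R]_p => \sum_k u 0 k ^+ 2) [set y : R | y <= r ^+ 2]).
  by move=> u _; exact: continuous_sumsqr.
exact: closed_le.
Qed.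

Lemma compact_sphere : compact [set u : 'rV[R]_p | l2norm u = 1].
Proof.
apply: bounded_closed_compact.
  apply: (@bounded_coord _ 1) => // u u1 k.
  by apply: le_trans (coord_le_l2norm _ _) _; rewrite u1.
have -> : [set u : 'rV[R]_p | l2norm u = 1] = [set u | \sum_k u 0 k ^+ 2 = 1].
  rewrite eqEsubset; split => u /=.
    by rewrite -l2norm_sqr => ->; rewrite expr1n.
  by rewrite /l2norm => ->; rewrite sqrtr1.
apply: (@preimage_closed _ _ (fun u : 'rV[R]_p => \sum_k u 0 k ^+ 2) [set y : R | y = 1]).
  by move=> u _; exact: continuous_sumsqr.
exact: closed_eq.
Qed.

End row_vectors.

(** * Quadratic forms and best linear predictors *)
Section quadratic_forms.
Context (R : realType) (p : nat).
Implicit Types (u v w : 'rV[R]_p) (M : 'M[R]_p) (S : {set 'I_p}).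

Definition bilin M u v : R := \sum_k (u *m M) 0 k * v 0 k.

Lemma bilinDl M u v w : bilin M (u + v) w = bilin M u w + bilin M v w.
Proof.
rewrite /bilin -big_split /=; apply: eq_bigr => k _.
by rewrite mulmxDl mxE mulrDl.
Qed.

Lemma bilinZl M t u w : bilin M (t *: u) w = t * bilin M u w.
Proof.
rewrite /bilin mulr_sumr; apply: eq_bigr => k _.
by rewrite -scalemxAl mxE mulrA.
Qed.

Lemma bilinC M u v : M^T = M -> bilin M u v = bilin M v u.
Proof.
move=> MT; rewrite /bilin.
under eq_bigr do rewrite mxE mulr_suml.
under [RHS]eq_bigr do rewrite mxE mulr_suml.
rewrite exchange_big /=; apply: eq_bigr => i _; apply: eq_bigr => j _.
by rewrite -[in LHS]MT mxE; ring.
Qed.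

Lemma bilinDr M u v w : M^T = M -> bilin M w (u + v) = bilin M w u + bilin M w v.
Proof. by move=> MT; rewrite bilinC // bilinDl !(bilinC _ w). Qed.

Lemma bilinZr M t u w : M^T = M -> bilin M w (t *: u) = t * bilin M w u.
Proof. by move=> MT; rewrite bilinC // bilinZl bilinC. Qed.

Lemma bilinBl M u v w : bilin M (u - v) w = bilin M u w - bilin M v w.
Proof. by rewrite -scaleN1r bilinDl bilinZl mulN1r. Qed.

Lemma bilinBr M u v w : M^T = M -> bilin M w (u - v) = bilin M w u - bilin M w v.
Proof. by move=> MT; rewrite bilinC // bilinBl !(bilinC _ w). Qed.

Lemma bilin_delta M u k : bilin M u (delta_mx 0 k) = (u *m M) 0 k.
Proof.
rewrite /bilin (bigD1 k) //= big1 => [|i ik]; last by rewrite [delta_mx _ _ _ _]mxE (negPf ik) andbF mulr0.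
by rewrite [delta_mx _ _ _ _]mxE !eqxx mulr1 addr0.
Qed.

Lemma continuous_bilin M : continuous (fun u => bilin M u u).
Proof.
apply: continuous_sum_ord => k u.
apply: continuousM; last exact: coord_continuous.
have -> : (fun v : 'rV[R]_p => (v *m M) 0 k) = (fun v => \sum_i v 0 i * M i k).
  by apply/funext => v; rewrite mxE.
apply: continuous_sum_ord => i v.
apply: continuousM; first exact: coord_continuous.
exact: cst_continuous.
Qed.

(** The minimum of the quadratic form on the unit sphere is an eigenvalue: at a
    minimiser [v0] with value [a] the form [M - a] is nonnegative and vanishes,
    so its polar form vanishes there in every direction. *)
Lemma lambda_min_le_form M (c : R) u : M^T = M -> 0 < c -> c <= lambda_min M ->
  c * l2norm u ^+ 2 <= bilin M u u.
Proof.
move=> MT c0 cM.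
have [->|u0] := eqVneq u 0.
  by rewrite /bilin l2norm_sqr !big1 ?mulr0 // => k _; rewrite [(0 : 'rV_p) _ _]mxE ?mulr0 ?expr0n.
have nu0 : l2norm u != 0 by apply: contra_neq u0; exact: l2norm_eq0.
pose e := (l2norm u)^-1 *: u.
have e1 : l2norm e = 1.
  by rewrite l2normZ ger0_norm ?mulVf // invr_ge0 l2norm_ge0.
have [|||v0 v01 v0min] := @EVT_min_rV R p (fun v => bilin M v v) [set v | l2norm v = 1].
- by exists e.
- exact: compact_sphere.
- exact/continuous_subspaceT/continuous_bilin.
rewrite inE /= in v01.
set a := bilin M v0 v0 in v0min.
have form_ge v : a * l2norm v ^+ 2 <= bilin M v v.
  have [->|vn0] := eqVneq v 0.
    by rewrite /bilin l2norm_sqr !big1 ?mulr0 // => k _; rewrite [(0 : 'rV_p) _ _]mxE ?mulr0 ?expr0n.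
  have nv0 : l2norm v != 0 by apply: contra_neq vn0; exact: l2norm_eq0.
  have := v0min ((l2norm v)^-1 *: v).
  rewrite inE /= l2normZ ger0_norm ?invr_ge0 ?l2norm_ge0 // mulVf // => /(_ erefl).
  rewrite bilinZl bilinZr // mulrA -expr2 exprVn mulrC ler_pdivlMr //.
  by rewrite exprn_gt0 // lt_neqAle eq_sym nv0 l2norm_ge0.
have polar0 w : bilin M v0 w = a * \sum_k v0 0 k * w 0 k.
  set b := \sum_k _; apply/eqP; rewrite -subr_eq0; apply/eqP.
  set z := _ - _.
  have h t : 0 <= 2 * t * z + t ^+ 2 * (bilin M w w - a * l2norm w ^+ 2).
    have := form_ge (v0 + t *: w).
    rewrite bilinDl !bilinDr // !bilinZl !bilinZr // (bilinC w v0) // -/a.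
    have -> : l2norm (v0 + t *: w) ^+ 2 = l2norm v0 ^+ 2 + 2 * t * b + t ^+ 2 * l2norm w ^+ 2.
      rewrite !l2norm_sqr /b !mulr_sumr -!big_split /=; apply: eq_bigr => k _.
      by rewrite !mxE; ring.
    by rewrite v01 /z; lra.
  set g := bilin M w w - _ in h.
  have [g0|g0] := leP g 0.
    by have := h 1; have := h (-1); lra.
  have := h (- (z / g)).
  have -> : 2 * - (z / g) * z + (- (z / g)) ^+ 2 * g = - (z ^+ 2 / g) by field; rewrite gt_eqF.
  rewrite oppr_ge0 pmulr_lle0 ?invr_gt0 // => z2.
  by apply/eqP; rewrite -sqrf_eq0 eq_le z2 sqr_ge0.
have av : eigenvalue M a.
  apply/eigenvalueP; exists v0.
    apply/rowP => k; rewrite -bilin_delta polar0 mxE (bigD1 k) //= big1.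
      by rewrite mxE !eqxx mulr1 addr0.
    by move=> i ik; rewrite mxE (negPf ik) andbF mulr0.
  apply/negP => /eqP v00; move: v01; rewrite v00 /l2norm big1 ?sqrtr0.
    by move/eqP; rewrite eq_sym oner_eq0.
  by move=> k _; rewrite mxE expr0n.
(* An infimum that does not exist is [0] by convention, which [0 < c] excludes. *)
have hi : has_inf [set a : R | eigenvalue M a].
  apply: contrapT => /inf_out h; move: cM; rewrite /lambda_min h.
  by rewrite leNgt c0.
apply: le_trans (form_ge u); rewrite ler_wpM2r ?sqr_ge0 //.
by apply: le_trans cM _; apply: ge_inf => //; case: hi.
Qed.


Definition restrict S u : 'rV[R]_#|S| := \row_i u 0 (enum_val i).

Definition extend S (z : 'rV[R]_#|S|) : 'rV[R]_p :=
  \row_k \sum_(i < #|S|) z 0 i *+ (enum_val i == k).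

Lemma extend_supported S (z : 'rV[R]_#|S|) : supported S (extend z).
Proof.
move=> k kS; rewrite mxE big1 // => i _; case: eqP => // ik.
by move: kS; rewrite -ik enum_valP.
Qed.

Lemma extend_enum_val S (z : 'rV[R]_#|S|) i : extend z 0 (enum_val i) = z 0 i.
Proof.
rewrite mxE (bigD1 i) //= eqxx big1 ?addr0 // => j ji.
by rewrite (inj_eq enum_val_inj) (negPf ji).
Qed.

Lemma restrict_extend S (z : 'rV[R]_#|S|) : restrict S (extend z) = z.
Proof. by apply/rowP => i; rewrite mxE extend_enum_val. Qed.

Lemma restrict_mulmx S M u i : supported S u ->
  (restrict S u *m principal_submx S M) 0 i = (u *m M) 0 (enum_val i).
Proof.
move=> uS; rewrite !mxE.
rewrite (sum_supported (f:=fun j x => x * M j (enum_val i)) uS) => [|k]; last exact: mul0r.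
by rewrite [RHS]big_enum_val /=; apply: eq_bigr => j _; rewrite !mxE.
Qed.

Lemma principal_submx_unit S M c : 0 < c ->
  (forall u, c * l2norm u ^+ 2 <= bilin M u u) -> principal_submx S M \in unitmx.
Proof.
move=> c0 Mc; rewrite -row_free_unit -kermx_eq0; apply/rowV0P => z /sub_kermxP zA.
pose u := extend z.
have uS : supported S u := extend_supported z.
have uMu : bilin M u u = 0.
  rewrite /bilin (sum_supported (f:=fun j x => (u *m M) 0 j * x) uS) => [|k]; last exact: mulr0.
  rewrite big_enum_val /= big1 // => i _.
  by rewrite -restrict_mulmx // restrict_extend zA mxE mul0r.
have u0 : u = 0.
  apply: l2norm_eq0; apply/eqP; rewrite -sqrf_eq0 eq_le sqr_ge0 andbT.
  by rewrite -(pmulr_rle0 _ c0) -uMu.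
by rewrite -(restrict_extend z) -/u u0; apply/rowP => i; rewrite !mxE.
Qed.

(** The coefficients of the best linear predictor of the coordinate [k] by the
    coordinates in [S]; Pythagoras bounds its length. *)
Lemma projection_coefficients S M c k : M^T = M -> 0 < c ->
  (forall u, c * l2norm u ^+ 2 <= bilin M u u) ->
  exists theta, [/\ supported S theta,
    forall j, j \in S -> ((delta_mx 0 k - theta) *m M) 0 j = 0 &
    c * l2norm theta ^+ 2 <= M k k].
Proof.
move=> MT c0 Mc; have Au := principal_submx_unit S c0 Mc.
pose z : 'rV_#|S| := \row_i M k (enum_val i) *m invmx (principal_submx S M).
pose th := extend z.
have thS : supported S th := extend_supported z.
have delta_row j : (delta_mx 0 k *m M) 0 j = M k j.
  rewrite mxE (bigD1 k) //= big1 => [|i ik]; last by rewrite mxE (negPf ik) andbF mul0r.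
  by rewrite mxE !eqxx mul1r addr0.
have orth j : j \in S -> ((delta_mx 0 k - th) *m M) 0 j = 0.
  move=> jS; rewrite -[j](enum_rankK_in jS jS) mulmxBl mxE delta_row mxE.
  by rewrite -(restrict_mulmx _ _ thS) restrict_extend mulmxKV // mxE subrr.
exists th; split=> //.
have pyth : bilin M (delta_mx 0 k - th) th = 0.
  rewrite /bilin big1 // => j _; have [jS|/thS ->] := boolP (j \in S).
    by rewrite orth // mul0r.
  by rewrite mulr0.
have pos : 0 <= bilin M (delta_mx 0 k - th) (delta_mx 0 k - th).
  by apply: le_trans (Mc _); rewrite mulr_ge0 ?sqr_ge0 // ltW.
apply: le_trans (Mc th) _.
have Mkk : bilin M (delta_mx 0 k) (delta_mx 0 k) = M k k by rewrite bilin_delta delta_row.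
move: pos pyth; rewrite !bilinBl !bilinBr // (bilinC th (delta_mx 0 k)) // Mkk; lra.
Qed.

(** [u] is recovered from [u *m M] on [S] by the inverse of the principal
    submatrix. Acting on a row, the inverse enters by its columns; by symmetry
    these are the rows that the norm measures. *)
Lemma linf_le_inverse_norm S M c (C e : R) u : M^T = M -> 0 < c -> 0 <= e ->
  (forall u, c * l2norm u ^+ 2 <= bilin M u u) ->
  norm_M_infty (invmx (principal_submx S M)) <= C ->
  supported S u -> (forall k, k \in S -> `|(u *m M) 0 k| <= e) ->
  forall k, `|u 0 k| <= C * e.
Proof.
move=> MT c0 e0 Mc BC uS uMe k; have Au := principal_submx_unit S c0 Mc.
set A := principal_submx S M in Au BC; set B := invmx A in BC.
have C0 : 0 <= C by apply: le_trans BC; exact: bigmax_ge_id.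
have [kS|/uS ->] := boolP (k \in S); last by rewrite normr0 mulr_ge0.
have BT : B^T = B.
  rewrite /B trmx_inv; congr invmx; apply/matrixP => i j.
  by rewrite !mxE -[in LHS]MT mxE.
have -> : u 0 k = (restrict S u *m A *m B) 0 (enum_rank_in kS k).
  by rewrite mulmxK // mxE enum_rankK_in.
set i := enum_rank_in kS k.
rewrite mxE; apply: le_trans (ler_norm_sum _ _ _) _.
apply: (@le_trans _ _ (\sum_(j < #|S|) `|B i j| * e)).
  apply: ler_sum => j _; rewrite normrM mulrC -[in leLHS]BT [B^T _ _]mxE ler_wpM2l //.
  by rewrite restrict_mulmx // uMe // enum_valP.
rewrite -mulr_suml ler_wpM2r //; apply: le_trans BC.
by apply: (@le_bigmax _ _ _ 0 (fun i => \sum_(j < #|S|) `|B i j|) i).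
Qed.

End quadratic_forms.

(** * The empirical score and its linearization *)
Section score_correlation.
Context (R : realType) (n p : nat) (X : 'I_n -> p.-tuple R) (e : 'I_n -> R).
Implicit Types (D w : 'rV[R]_p) (S : {set 'I_p}) (a : R) (M : 'M[R]_p).

Definition average (f : 'I_n -> R) : R := n%:R^-1 * \sum_i f i.

Lemma averageD f g : average (fun i => f i + g i) = average f + average g.
Proof. by rewrite /average big_split mulrDr. Qed.

Lemma averageZ t f : average (fun i => t * f i) = t * average f.
Proof. by rewrite /average -mulr_sumr mulrCA. Qed.

Lemma averageB f g : average (fun i => f i - g i) = average f - average g.
Proof.
rewrite averageD; congr (_ + _).
by rewrite -[RHS]mulN1r -averageZ; congr average; apply/funext => i; rewrite mulN1r.
Qed.

Lemma average_sum (I : finType) (P : pred I) (f : I -> 'I_n -> R) :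
  average (fun i => \sum_(k | P k) f k i) = \sum_(k | P k) average (f k).
Proof. by rewrite /average exchange_big mulr_sumr. Qed.

Lemma ler_average f g : (forall i, f i <= g i) -> average f <= average g.
Proof. by move=> fg; rewrite ler_wpM2l ?invr_ge0 ?ler0n // ler_sum. Qed.

Lemma ler_norm_average f : `|average f| <= average (fun i => `|f i|).
Proof.
rewrite normrM ger0_norm ?invr_ge0 ?ler0n // ler_wpM2l ?invr_ge0 ?ler0n //.
exact: ler_norm_sum.
Qed.

(** Minus the derivative of the empirical loss in the direction [w], at the
    coefficients displaced by [D] from the true ones: the residuals there are
    [e i - dot (X i) D]. *)
Definition score_corr a D w : R :=
  average (fun i => huber_score a (e i - dot (X i) D) * dot (X i) w).

Lemma score_corrD a D u w : score_corr a D (u + w) = score_corr a D u + score_corr a D w.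
Proof.
by rewrite -averageD; congr average; apply/funext => i; rewrite dotD mulrDr.
Qed.

Lemma score_corrZ a D t w : score_corr a D (t *: w) = t * score_corr a D w.
Proof.
by rewrite -averageZ; congr average; apply/funext => i; rewrite dotZ mulrCA.
Qed.

Lemma score_corrN a D w : score_corr a D (- w) = - score_corr a D w.
Proof. by rewrite -scaleN1r score_corrZ mulN1r. Qed.

Lemma score_corr_sum a D w :
  score_corr a D w = \sum_k w 0 k * score_corr a D (delta_mx 0 k).
Proof.
under eq_bigr => k _ do rewrite -averageZ.
rewrite -average_sum; congr average; apply/funext => i.
rewrite {2}/dot mulr_sumr; apply: eq_bigr => k _.
by rewrite dot_delta; ring.
Qed.

Lemma score_corr0 a w : score_corr a 0 w = average (fun i => huber_score a (e i) * dot (X i) w).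
Proof.
congr average; apply/funext => i; rewrite {1}/dot big1 ?subr0 // => k _.
by rewrite mxE mulr0.
Qed.

Lemma min1_sum_le (I : finType) (P : pred I) (f : I -> R) : (forall i, 0 <= f i) ->
  Num.min 1 (\sum_(i | P i) f i) <= \sum_(i | P i) Num.min 1 (f i).
Proof.
move=> f0; have m0 i : 0 <= Num.min 1 (f i) by rewrite le_min ler01 f0.
have [[k Pk k1]|h] := pselect (exists2 k, P k & 1 <= f k).
  rewrite (bigD1 k) //= (bigD1 k (P:=P)) //=.
  apply: (@le_trans _ _ 1); first by rewrite ge_min lexx.
  by rewrite (min_idPl k1) lerDl sumr_ge0.
rewrite ge_min; apply/orP; right; apply: ler_sum => k Pk.
by rewrite le_min lexx andbT leNgt; apply/negP => /ltW k1; apply: h; exists k.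
Qed.

(** Uniformity in [D] costs only the l1 norm: after the linear part is split off
    by [huber_score_incr_linear], each occurrence of [dot (X i) D] is expanded in
    coordinates, and the truncated square of [dot (X i) D] is at most the sum
    over [S] of the truncated squares of the coordinates. *)
Lemma score_corr_linearization a S D w M (d2 d3 : R) : 0 < a -> supported S D ->
  l2norm D <= 1 ->
  (forall k, `|average (fun i => dot (X i) w * tnth (X i) k) - (w *m M) 0 k| <= d2) ->
  (forall k, average (fun i => `|dot (X i) w| * `|tnth (X i) k| *
     Num.min 1 (a ^+ 2 * e i ^+ 2)) <= d3) ->
  (forall k l, average (fun i => `|dot (X i) w| * `|tnth (X i) k| *
     Num.min 1 (a ^+ 2 * tnth (X i) l ^+ 2)) <= d3) ->
  `|score_corr a 0 w - score_corr a D w - 2 * bilin M w D| <=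
    l1norm D * (2 * d2 + 6 * d3 + 6 * #|S|%:R * d3).
Proof.
move=> a0 DS D1 h2 h3 h4.
pose u i := dot (X i) D; pose V i := dot (X i) w.
pose T i := (huber_score a (e i) - huber_score a (e i - u i) - 2 * u i) * V i.
have -> : score_corr a 0 w - score_corr a D w - 2 * bilin M w D =
   average T + 2 * (average (fun i => V i * u i) - bilin M w D).
  have -> : average T = score_corr a 0 w - score_corr a D w - 2 * average (fun i => V i * u i).
    rewrite score_corr0 -averageB -averageZ -averageB; congr average.
    by apply/funext => i; rewrite /T /V /u; ring.
  by ring.
have lin : `|average (fun i => V i * u i) - bilin M w D| <= l1norm D * d2.
  have -> : average (fun i => V i * u i) = \sum_k D 0 k * average (fun i => V i * tnth (X i) k).
    under eq_bigr => k _ do rewrite -averageZ.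
    rewrite -average_sum; congr average; apply/funext => i.
    by rewrite /u /dot mulr_sumr; apply: eq_bigr => k _; ring.
  rewrite /bilin -sumrB mulr_suml; apply: le_trans (ler_norm_sum _ _ _) _.
  apply: ler_sum => k _; rewrite [(w *m M) 0 k * _]mulrC -mulrBr normrM.
  by rewrite ler_wpM2l.
pose me i := Num.min 1 (a ^+ 2 * e i ^+ 2).
pose mX i l := Num.min 1 (a ^+ 2 * tnth (X i) l ^+ 2).
have a2 x : 0 <= a ^+ 2 * x ^+ 2 by rewrite mulr_ge0 ?sqr_ge0.
have me0 i : 0 <= me i by rewrite le_min ler01 a2.
have mX0 i l : 0 <= mX i l by rewrite le_min ler01 a2.
have quad : `|average T| <= l1norm D * (6 * d3 + 6 * #|S|%:R * d3).
  apply: le_trans (ler_norm_average _) _.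
  pose U i := \sum_k `|D 0 k| * (6 * (`|V i| * `|tnth (X i) k| * me i)
     + \sum_(l in S) 6 * (`|V i| * `|tnth (X i) k| * mX i l)).
  apply: (@le_trans _ _ (average U)).
    apply: ler_average => i; rewrite /T normrM.
    have mu : Num.min 1 (a ^+ 2 * u i ^+ 2) <= \sum_(l in S) mX i l.
      apply: le_trans (min1_sum_le _ _); last by move=> l; exact: a2.
      rewrite le_min ge_min lexx /= ge_min; apply/orP; right.
      rewrite -mulr_sumr ler_wpM2l ?sqr_ge0 //.
      apply: le_trans (dot_sqr_le _ DS) _; rewrite ler_piMl ?sumr_ge0 //.
        by move=> l _; exact: sqr_ge0.
      by rewrite expr_le1 ?l2norm_ge0.
    have un : `|u i| <= \sum_k `|D 0 k| * `|tnth (X i) k|.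
      apply: le_trans (ler_norm_sum _ _ _) _.
      by apply: ler_sum => k _; rewrite normrM mulrC.
    apply: (@le_trans _ _ (6 * `|u i| * (me i + \sum_(l in S) mX i l) * `|V i|)).
      rewrite ler_wpM2r //; apply: le_trans (huber_score_incr_linear _ _ a0) _.
      by rewrite ler_wpM2l ?mulr_ge0 // lerD2l.
    have -> : U i = 6 * (\sum_k `|D 0 k| * `|tnth (X i) k|) * (me i + \sum_(l in S) mX i l) * `|V i|.
      rewrite /U mulr_sumr !mulr_suml; apply: eq_bigr => k _.
      by rewrite -mulr_sumr -mulr_sumr; ring.
    rewrite ler_wpM2r // ler_wpM2r ?addr_ge0 ?sumr_ge0 //.
    by rewrite ler_wpM2l.
  rewrite /U average_sum /l1norm mulr_suml; apply: ler_sum => k _.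
  rewrite averageZ ler_wpM2l // averageD; apply: lerD.
    by rewrite averageZ ler_wpM2l //; exact: h3.
  rewrite average_sum; under eq_bigr => l _ do rewrite averageZ.
  rewrite -mulr_sumr -mulrA ler_wpM2l //.
  apply: (@le_trans _ _ (\sum_(l in S) d3)); first by apply: ler_sum => l _; exact: h4.
  by rewrite sumr_const mulr_natl.
apply: le_trans (ler_normD _ _) _; rewrite (normrM 2) (ger0_norm (x:=2)) //.
by lra.
Qed.

End score_correlation.

(** * First order conditions for the penalised objective *)
Section oracle.
Context (R : realType) (n p : nat) (X : 'I_n -> p.-tuple R) (e : 'I_n -> R).
Context (bstar : 'rV[R]_p) (a : R) (mu : 'I_p -> R).
Hypotheses (a0 : 0 < a) (mu0 : forall k, 0 <= mu k).
Implicit Types (D W : 'rV[R]_p) (S : {set 'I_p}) (M : 'M[R]_p).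

(** The penalty and the objective as functions of the displacement [D] from
    [bstar]. *)
Definition penalty D : R := \sum_k mu k * `|bstar 0 k + D 0 k|.

Definition shifted_objective D : R :=
  average (fun i => pseudo_huber a (e i - dot (X i) D)) + penalty D.

Lemma average_sqr_ge0 (f : 'I_n -> R) : 0 <= average (fun i => f i ^+ 2).
Proof.
rewrite mulr_ge0 ?invr_ge0 ?ler0n // sumr_ge0 // => i _; exact: sqr_ge0.
Qed.

Lemma penalty_convex t D W : 0 <= t <= 1 ->
  penalty (D + t *: W) <= penalty D + t * (penalty (D + W) - penalty D).
Proof.
move=> /andP[t0 t1]; rewrite /penalty -sumrB mulr_sumr -big_split /=.
apply: ler_sum => k _; rewrite -mulrBr mulrCA -mulrDr ler_wpM2l // !mxE.
have -> : bstar 0 k + (D 0 k + t * W 0 k) =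
  (1 - t) * (bstar 0 k + D 0 k) + t * (bstar 0 k + (D 0 k + W 0 k)) by ring.
apply: le_trans (ler_normD _ _) _; rewrite !normrM (ger0_norm t0).
by rewrite (ger0_norm (x:=1 - t)) ?subr_ge0 //; lra.
Qed.

Lemma convex_lower_bound D W :
  shifted_objective D - score_corr X e a D W + (penalty (D + W) - penalty D)
    <= shifted_objective (D + W).
Proof.
rewrite /shifted_objective.
suff : average (fun i => pseudo_huber a (e i - dot (X i) D)) - score_corr X e a D W
   <= average (fun i => pseudo_huber a (e i - dot (X i) (D + W))) by lra.
rewrite -averageB; apply: ler_average => i.
apply: le_trans (huber_above_tangent (e i - dot (X i) D) _ a0); rewrite dotD; lra.
Qed.

(** The first order condition without derivatives: the loss lies below a parabola
    and the penalty is convex, so the comparison along the segment reads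
    [0 <= t * z + t ^ 2 * B], and small [t] forces [0 <= z]. *)
Lemma variational_inequality (t0 : R) D W : 0 < t0 ->
  (forall t, 0 < t <= t0 -> shifted_objective D <= shifted_objective (D + t *: W)) ->
  0 <= - score_corr X e a D W + (penalty (D + W) - penalty D).
Proof.
move=> t0p Dmin; set z := (X in 0 <= X).
pose B := average (fun i => dot (X i) W ^+ 2).
have B0 : 0 <= B := average_sqr_ge0 _.
have h t : 0 < t -> t <= t0 -> t <= 1 -> 0 <= t * z + t ^+ 2 * B.
  move=> tp tt0 t1; have := Dmin t; rewrite tp tt0 => /(_ isT).
  rewrite /shifted_objective.
  have := @penalty_convex t D W; rewrite (ltW tp) t1 => /(_ isT).
  have : average (fun i => pseudo_huber a (e i - dot (X i) (D + t *: W))) <=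
    average (fun i => pseudo_huber a (e i - dot (X i) D)) - t * score_corr X e a D W + t ^+ 2 * B.
    rewrite /B -!averageZ -averageB -averageD; apply: ler_average => i.
    apply: le_trans (huber_below_parabola (e i - dot (X i) D) _ a0) _.
    by rewrite dotD dotZ; lra.
  by rewrite /z; lra.
rewrite leNgt; apply/negP => z0.
pose t := Num.min t0 (Num.min 1 (- z / (B + 1))).
have B1 : 0 < B + 1 by lra.
have tp : 0 < t by rewrite !lt_min t0p ltr01 divr_gt0 // oppr_gt0.
have tz : t * (B + 1) <= - z.
  by rewrite -ler_pdivlMr // /t ge_min; apply/orP; right; rewrite ge_min lexx orbT.
have := h t tp; rewrite /t ge_min lexx => /(_ isT).
rewrite ge_min ge_min lexx orbT -/t => /(_ isT).
by nra.
Qed.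

(** Monotonicity of the score: the first order condition of a minimiser that may
    be far away passes to the points between it and [bstar]. *)
Lemma score_corr_mono D t : 0 <= t <= 1 ->
  score_corr X e a D D <= score_corr X e a (t *: D) D.
Proof.
move=> /andP[t0 t1]; apply: ler_average => i; rewrite dotZ.
have [->|tn1] := eqVneq t 1; first by rewrite mul1r.
have := huber_score_mono (e i - t * dot (X i) D) (e i - dot (X i) D) a0.
set x := dot (X i) D; set s1 := huber_score _ _; set s2 := huber_score _ _.
have -> : e i - t * x - (e i - x) = (1 - t) * x by ring.
rewrite mulrCA pmulr_rge0; last by rewrite subr_gt0 lt_neqAle tn1.
by rewrite mulrBl subr_ge0.
Qed.

Lemma continuous_dot x : continuous (fun D => dot x D).
Proof.
apply: (@continuous_sum_ord _ _ _ (fun k (u : 'rV[R]_p) => tnth x k * u 0 k)) => k D.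
by apply: (@continuousM R 'rV[R]_p (fun=> tnth x k) (fun u => u 0 k)); [exact: cst_continuous|exact: coord_continuous].
Qed.

Lemma continuous_pseudo_huber : continuous (pseudo_huber a).
Proof.
move=> x.
apply: (@continuousM R R (fun=> 2 * a ^- 2)
  (fun y => Num.sqrt (1 + a ^+ 2 * y ^+ 2) - 1)); first exact: cst_continuous.
apply: (@continuousB R R R (fun y => Num.sqrt (1 + a ^+ 2 * y ^+ 2)) (fun=> 1));
  last exact: cst_continuous.
apply: (@continuous_comp R R R (fun y => 1 + a ^+ 2 * y ^+ 2) (@Num.sqrt R)); last exact: sqrt_continuous.
apply: (@continuousD R R R (fun=> 1) (fun y => a ^+ 2 * y ^+ 2)); first exact: cst_continuous.
apply: (@continuousM R R (fun=> a ^+ 2) (fun y => y ^+ 2)); first exact: cst_continuous.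
exact: exprn_continuous.
Qed.

Lemma continuous_shifted_objective : continuous shifted_objective.
Proof.
move=> D0.
apply: (@continuousD R R 'rV[R]_p
  (fun D => average (fun i => pseudo_huber a (e i - dot (X i) D))) penalty).
  apply: (@continuousM R 'rV[R]_p (fun=> n%:R^-1)
    (fun D => \sum_i pseudo_huber a (e i - dot (X i) D))); first exact: cst_continuous.
  apply: (@continuous_sum_ord _ _ _
    (fun i (D : 'rV[R]_p) => pseudo_huber a (e i - dot (X i) D))) => i {}D0.
  apply: (@continuous_comp _ _ _ (fun D => e i - dot (X i) D) (pseudo_huber a)).
    by apply: (@continuousB R R 'rV[R]_p (fun=> e i) (fun D => dot (X i) D));
      [exact: cst_continuous|exact: continuous_dot].
  exact: continuous_pseudo_huber.
apply: (@continuous_sum_ord _ _ _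
  (fun k (D : 'rV[R]_p) => mu k * `|bstar 0 k + D 0 k|)) => k {}D0.
apply: (@continuousM R 'rV[R]_p (fun=> mu k) (fun D => `|bstar 0 k + D 0 k|));
  first exact: cst_continuous.
apply: (@continuous_comp _ _ _ (fun D : 'rV[R]_p => bstar 0 k + D 0 k) (@Num.norm R R)).
  by apply: (@continuousD R R 'rV[R]_p (fun=> bstar 0 k) (fun D => D 0 k));
    [exact: cst_continuous|exact: coord_continuous].
exact: norm_continuous.
Qed.

Lemma ball_minimizer S (r : R) : 0 <= r -> exists D, [/\ supported S D, l2norm D <= r &
  forall W, supported S W -> l2norm W <= r -> shifted_objective D <= shifted_objective W].
Proof.
move=> r0.
have [||| D DA Dmin] := @EVT_min_rV R p shifted_objective [set u | supported S u /\ l2norm u <= r].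
- exists 0; split; first by move=> k _; rewrite mxE.
  by rewrite -(scale0r 0) l2normZ normr0 mul0r.
- exact: compact_ball.
- exact/continuous_subspaceT/continuous_shifted_objective.
move: DA; rewrite inE => -[DS Dr]; exists D; split => // W WS Wr.
by apply: Dmin; rewrite inE.
Qed.

End oracle.

(** * The primal-dual witness *)
Section primal_dual_witness.
Context (R : realType) (n p : nat) (X : 'I_n -> p.-tuple R) (e : 'I_n -> R).
Context (bstar : 'rV[R]_p) (a : R) (mu : 'I_p -> R) (M : 'M[R]_p).
Context (v : 'I_p -> 'rV[R]_p) (cl rt CA CT : R).
Let S := supp bstar.
Let s : R := #|S|%:R.
Let r := Num.sqrt s * rt * ((2 + CA) / cl).
Let G := score_corr X e a.
Hypotheses (a0 : 0 < a) (mu0 : forall k, 0 <= mu k) (MT : M^T = M) (cl0 : 0 < cl).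
Hypothesis form : forall u, cl * l2norm u ^+ 2 <= bilin M u u.
Hypotheses (rt0 : 0 < rt) (s_gt0 : (0 < #|S|)%N) (CA0 : 0 <= CA).
Hypothesis vS : forall k, k \in S -> v k = delta_mx 0 k.
Hypothesis vC : forall k, k \notin S -> exists theta,
  [/\ supported S theta, v k = delta_mx 0 k - theta,
      forall j, j \in S -> (v k *m M) 0 j = 0 & l2norm theta <= CT].
Hypothesis noise : forall k, `|G 0 (v k)| <= CA * rt.
Hypothesis linearization : forall k D, supported S D -> l2norm D <= r ->
  `|G 0 (v k) - G D (v k) - 2 * bilin M (v k) D| <= rt.
Hypothesis muS : forall k, k \in S -> mu k <= rt / Num.sqrt s.
Implicit Types (D W : 'rV[R]_p).

Let s1 : 1 <= s. Proof. by rewrite /s ler1n. Qed.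
Let ss0 : 0 < Num.sqrt s. Proof. by rewrite sqrtr_gt0 ltr0n. Qed.
Let ss1 : 1 <= Num.sqrt s. Proof. by rewrite -[leLHS]sqrtr1 ler_wsqrtr. Qed.
Let r0 : 0 < r.
Proof. by rewrite /r !mulr_gt0 ?invr_gt0 // ltr_wpDr. Qed.

Lemma penalty_increment_le D :
  penalty bstar mu 0 - penalty bstar mu D <= \sum_k mu k * `|D 0 k|.
Proof.
rewrite /penalty -sumrB; apply: ler_sum => k _.
rewrite -mulrBr ler_wpM2l // mxE addr0 lerBlDr.
by have := ler_normB (bstar 0 k + D 0 k) (D 0 k); rewrite addrK addrC.
Qed.

(** Strong convexity is inherited from [M] through the linearization, while noise,
    linearization error and penalty cost [O(rt)] per coordinate. Comparing
    [2 * cl * l2norm D ^ 2] with [l1norm D * ((2 + CA) * rt)] leaves half of the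
    radius, so that a minimiser over the ball is interior. *)
Lemma error_bound D : supported S D -> l2norm D <= r ->
  0 <= G D D + \sum_k mu k * `|D 0 k| -> l2norm D <= r / 2.
Proof.
move=> DS Dr h.
have l1le := l1norm_le_l2norm DS.
have pen : \sum_k mu k * `|D 0 k| <= l1norm D * rt.
  rewrite /l1norm mulr_suml; apply: ler_sum => k _; rewrite mulrC.
  have [kS|/DS ->] := boolP (k \in S); last by rewrite normr0 !mul0r.
  rewrite ler_wpM2l //; apply: le_trans (muS kS) _.
  by rewrite ler_pdivrMr // ler_peMr // ltW.
have GDD : G D D <= l1norm D * ((1 + CA) * rt) - 2 * bilin M D D.
  have -> : G D D = \sum_k D 0 k * G D (delta_mx 0 k) by exact: score_corr_sum.
  have -> : bilin M D D = \sum_k D 0 k * bilin M (delta_mx 0 k) D.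
    rewrite {1}/bilin; apply: eq_bigr => k _.
    by rewrite bilinC // bilin_delta mulrC.
  rewrite lerBrDr mulr_sumr -big_split /l1norm mulr_suml; apply: ler_sum => k _ /=.
  have [kS|/DS ->] := boolP (k \in S); last by rewrite normr0 !mul0r mulr0 addr0.
  have := linearization k DS Dr; have := noise k; rewrite vS //.
  set g0 := G 0 _; set g := G D _; set b := bilin M _ _ => h1 h2.
  have h3 : `|g + 2 * b| <= (1 + CA) * rt.
    have -> : g + 2 * b = g0 - (g0 - g - 2 * b) by ring.
    by apply: le_trans (ler_normB _ _) _; lra.
  rewrite [_ + _](_ : _ = D 0 k * (g + 2 * b)); last by ring.
  by apply: le_trans (ler_norm _) _; rewrite normrM ler_wpM2l.
have quad : 2 * (cl * l2norm D ^+ 2) <= l1norm D * ((2 + CA) * rt).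
  by have := form D; lra.
have [->|Dn0] := eqVneq (l2norm D) 0; first by rewrite divr_ge0 // ltW.
have D0 : 0 < l2norm D by rewrite lt_neqAle eq_sym Dn0 l2norm_ge0.
have rt' : 0 <= (2 + CA) * rt by rewrite mulr_ge0 ?addr_ge0 // ltW.
have : l2norm D * (2 * cl * l2norm D) <= l2norm D * (Num.sqrt s * ((2 + CA) * rt)).
  by have := le_trans quad (ler_wpM2r rt' l1le); rewrite -/s; lra.
rewrite ler_pM2l // => h'.
rewrite -(ler_pM2l (mulr_gt0 (ltr0n R 2) cl0)); apply: le_trans h' _.
suff -> : Num.sqrt s * ((2 + CA) * rt) = 2 * cl * (r / 2) by [].
by rewrite /r; field; rewrite gt_eqF.
Qed.

(** The stationarity condition tested along plus and minus a coordinate vector. *)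
Lemma dual_bound D k : k \in S ->
  (forall W, supported S W ->
     0 <= - G D W + (penalty bstar mu (D + W) - penalty bstar mu D)) ->
  `|G D (delta_mx 0 k)| <= mu k.
Proof.
move=> kS VI.
have h c : `|c| = 1 -> c * G D (delta_mx 0 k) <= mu k.
  move=> c1; pose W : 'rV[R]_p := c *: delta_mx 0 k.
  have WS : supported S W.
    move=> j jS; rewrite !mxE; have [jk|_] := eqVneq j k; last by rewrite andbF mulr0.
    by rewrite jk kS in jS.
  have := VI W WS; rewrite /G score_corrZ -/G.
  suff : penalty bstar mu (D + W) - penalty bstar mu D <= mu k by lra.
  rewrite /penalty -sumrB (bigD1 k) //= big1 => [|j jk].
    rewrite addr0 -mulrBr -[leRHS]mulr1 ler_wpM2l // !mxE !eqxx mulr1 lerBlDr addrA addrC.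
    by apply: le_trans (ler_normD _ _) _; rewrite c1 addrC.
  by rewrite !mxE (negPf jk) andbF mulr0 addr0 subrr.
have h1 := h 1 (normr1 _); have hN1 := h (-1) (normrN1 _).
by rewrite ler_norml; apply/andP; split; lra.
Qed.

(** The minimiser [D] over the vectors supported in [S] has small dual variables
    off [S], because there the score is, up to noise, the combination with
    coefficients [theta] of its values on [S], which stationarity bounds by [mu].
    By convexity the strict inequality with [mu] forces every minimiser to vanish
    off [S]; the coordinates in [forb] are constrained to vanish anyway. Once
    [Dhat] is supported in [S], the error bound applies to it, after shrinking
    it into the ball if necessary. *)
Lemma primal_dual_witness (forb : pred 'I_p) (Dhat : 'rV[R]_p) :
  (forall k, k \in S -> ~~ forb k) ->
  (forall k, k \notin S -> ~~ forb k -> (CA + 1 + CT) * rt < mu k) ->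
  (forall k, forb k -> Dhat 0 k = 0) ->
  (forall W, (forall k, forb k -> W 0 k = 0) ->
     shifted_objective X e bstar a mu Dhat <= shifted_objective X e bstar a mu W) ->
  [/\ supported S Dhat, l2norm Dhat <= r / 2 &
      forall k, k \in S -> `|(Dhat *m M) 0 k| <= (2 + CA) / 2 * rt].
Proof.
move=> Sforb muC Dforb Dmin.
pose F := shifted_objective X e bstar a mu.
have pen_nonneg D : penalty bstar mu 0 - penalty bstar mu D <= \sum_k mu k * `|D 0 k|
  := penalty_increment_le D.
have supp_feas W : supported S W -> forall k, forb k -> W 0 k = 0.
  by move=> WS k fk; apply: WS; apply: contraL fk; exact: Sforb.
have [D [DS Dr DW]] := @ball_minimizer R n p X e bstar a mu S r (ltW r0).
have Dr2 : l2norm D <= r / 2.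
  apply: error_bound => //.
  have := @variational_inequality R n p X e bstar a mu a0 mu0 1 D (- D) ltr01.
  rewrite subrr score_corrN opprK -/G => h; have := pen_nonneg D.
  suff : 0 <= G D D + (penalty bstar mu 0 - penalty bstar mu D) by lra.
  apply: h => t /andP[tp t1].
  have -> : D + t *: - D = (1 - t) *: D by rewrite scalerN scalerBl scale1r.
  apply: DW; first exact: supportedZ.
  rewrite l2normZ ger0_norm ?subr_ge0 //; apply: le_trans Dr.
  by rewrite ler_piMl ?l2norm_ge0 // gerBl ltW.
(* [D] uses at most half of the radius, so it may be moved in all directions. *)
have Dint W : supported S W -> exists2 t0, 0 < t0 &
    forall t, 0 < t <= t0 -> F D <= F (D + t *: W).
  move=> WS; exists (r / 2 / (l2norm W + 1)).
    by rewrite !divr_gt0 // ltr_wpDl ?l2norm_ge0.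
  move=> t /andP[tp tr]; apply: DW; first by apply: supportedD => //; exact: supportedZ.
  apply: le_trans (ler_l2normD _ _) _; rewrite l2normZ gtr0_norm //.
  have : t * (l2norm W + 1) <= r / 2 by rewrite -ler_pdivlMr // ltr_wpDl ?l2norm_ge0.
  by have := l2norm_ge0 W; lra.
have VI W : supported S W -> 0 <= - G D W + (penalty bstar mu (D + W) - penalty bstar mu D).
  move=> WS; have [t0 t00 h] := Dint W WS.
  exact: (variational_inequality a0 mu0 t00 h).
have GS k : k \in S -> `|G D (delta_mx 0 k)| <= mu k by move=> kS; exact: dual_bound.
have GC k : k \notin S -> `|G D (delta_mx 0 k)| <= (CA + 1 + CT) * rt.
  move=> kS; have [th [thS vk orth thT]] := vC kS.
  have -> : delta_mx 0 k = v k + th by rewrite vk subrK.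
  rewrite /G score_corrD -/G; apply: le_trans (ler_normD _ _) _.
  have b0 : bilin M (v k) D = 0.
    rewrite /bilin big1 // => j _; have [jS|/DS ->] := boolP (j \in S).
      by rewrite orth // mul0r.
    by rewrite mulr0.
  have h1 : `|G D (v k)| <= (CA + 1) * rt.
    have := linearization k DS Dr; rewrite b0 mulr0 subr0; have := noise k => h1 h2.
    have -> : G D (v k) = G 0 (v k) - (G 0 (v k) - G D (v k)) by ring.
    by apply: le_trans (ler_normB _ _) _; lra.
  suff h2 : `|G D th| <= CT * rt by lra.
  rewrite /G score_corr_sum -/G; apply: le_trans (ler_norm_sum _ _ _) _.
  apply: (@le_trans _ _ (l1norm th * (rt / Num.sqrt s))).
    rewrite /l1norm mulr_suml; apply: ler_sum => j _; rewrite normrM.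
    have [jS|/thS ->] := boolP (j \in S); last by rewrite normr0 !mul0r.
    by rewrite ler_wpM2l //; apply: le_trans (GS j jS) (muS jS).
  apply: le_trans (ler_wpM2r _ (l1norm_le_l2norm thS)) _.
    by rewrite divr_ge0 // ltW.
  rewrite -/s [leLHS](_ : _ = l2norm th * rt); last by field; rewrite gt_eqF.
  by rewrite ler_wpM2r // ltW.
have bC k : k \notin S -> bstar 0 k = 0 by rewrite inE negbK => /eqP.
pose DhS : 'rV[R]_p := \row_k (if k \in S then Dhat 0 k else 0).
have DhSS : supported S DhS by move=> k kS; rewrite mxE (negPf kS).
pose W' := Dhat - DhS.
have W'E k : W' 0 k = if k \in S then 0 else Dhat 0 k.
  by rewrite !mxE; case: ifP => _; rewrite ?subrr ?subr0.
have FD : F Dhat <= F D by apply: Dmin; exact: supp_feas.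
have lower := @convex_lower_bound R n p X e bstar a mu a0 D (Dhat - D).
have DK (W : 'rV[R]_p) : D + (W - D) = W by rewrite addrC subrK.
rewrite DK -/(F D) -/(F Dhat) -/G in lower.
have := VI (DhS - D) (supportedB DhSS DS); rewrite DK => VIhat.
have GW : G D (Dhat - D) = G D (DhS - D) + G D W'.
  have -> : Dhat - D = (DhS - D) + W' by rewrite /W' [RHS]addrC addrA subrK.
  exact: score_corrD.
have penW : penalty bstar mu Dhat = penalty bstar mu DhS + \sum_k mu k * `|W' 0 k|.
  rewrite /penalty -big_split /=; apply: eq_bigr => k _; rewrite W'E mxE.
  by case: ifPn => [_|/bC ->]; [rewrite normr0 mulr0 addr0 | rewrite !add0r normr0 mulr0 add0r].
have GW' : G D W' = \sum_k W' 0 k * G D (delta_mx 0 k) by exact: score_corr_sum.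
have term k : 0 <= mu k * `|W' 0 k| - W' 0 k * G D (delta_mx 0 k) /\
    (k \notin S -> mu k * `|W' 0 k| - W' 0 k * G D (delta_mx 0 k) <= 0 -> W' 0 k = 0).
  rewrite W'E; case: ifPn => [_|kS]; first by rewrite normr0 mulr0 mul0r subrr.
  have [fk|fk] := boolP (forb k); first by rewrite Dforb // normr0 mulr0 mul0r subrr.
  have lt := le_lt_trans (GC k kS) (muC k kS fk).
  have le : Dhat 0 k * G D (delta_mx 0 k) <= `|Dhat 0 k| * `|G D (delta_mx 0 k)|.
    by rewrite -normrM ler_norm.
  split; first by have := normr_ge0 (Dhat 0 k); nra.
  move=> _ h; apply/eqP; rewrite -normr_le0 leNgt; apply/negP => h0.
  have : 0 < `|Dhat 0 k| * (mu k - `|G D (delta_mx 0 k)|) by rewrite mulr_gt0 // subr_gt0.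
  by lra.
have sum0 : \sum_k (mu k * `|W' 0 k| - W' 0 k * G D (delta_mx 0 k)) <= 0.
  by rewrite sumrB -GW'; lra.
have DhatS : supported S Dhat.
  move=> k kS; have := W'E k; rewrite (negPf kS) => <-; apply: (term k).2 => //.
  apply: le_trans sum0; rewrite (bigD1 k) //= lerDl sumr_ge0 // => j _.
  exact: (term j).1.
have VIh W : supported S W ->
    0 <= - G Dhat W + (penalty bstar mu (Dhat + W) - penalty bstar mu Dhat).
  move=> WS; apply: (variational_inequality a0 mu0 ltr01) => t _.
  by apply: Dmin; apply: supp_feas; apply: supportedD => //; exact: supportedZ.
have first_order : 0 <= G Dhat Dhat + \sum_k mu k * `|Dhat 0 k|.
  have NS : supported S (- Dhat) by rewrite -scaleN1r; exact: supportedZ.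
  have := VIh _ NS; rewrite subrr /G score_corrN opprK -/G.
  by have := pen_nonneg Dhat; lra.
(* Otherwise the point of the segment at distance [r] contradicts [error_bound]. *)
have Dhatr : l2norm Dhat <= r.
  rewrite leNgt; apply/negP => rD.
  have D0 : 0 < l2norm Dhat by apply: lt_trans rD.
  pose t := r / l2norm Dhat.
  have t0 : 0 < t by rewrite divr_gt0.
  have t1 : t <= 1 by rewrite ler_pdivrMr // mul1r ltW.
  have tD : l2norm (t *: Dhat) = r by rewrite l2normZ gtr0_norm // divfK // gt_eqF.
  suff : l2norm (t *: Dhat) <= r / 2 by rewrite tD; have := r0; lra.
  apply: error_bound; [exact: supportedZ|by rewrite tD|].
  have -> : \sum_k mu k * `|(t *: Dhat) 0 k| = t * \sum_k mu k * `|Dhat 0 k|.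
    by rewrite mulr_sumr; apply: eq_bigr => k _; rewrite mxE normrM (gtr0_norm t0) mulrCA.
  rewrite /G score_corrZ -mulrDr mulr_ge0 //; first exact: ltW.
  apply: le_trans first_order _; rewrite lerD2r.
  by apply: score_corr_mono => //; rewrite t1 ltW.
split => //; first exact: error_bound.
move=> k kS; have := dual_bound kS VIh; have := linearization k DhatS Dhatr; have := noise k.
rewrite vS // bilinC // bilin_delta.
have := muS kS; have : rt / Num.sqrt s <= rt by rewrite ler_pdivrMr // ler_peMr // ltW.
set g0 := G 0 _; set g := G _ _; set b := (Dhat *m M) 0 k => h1 h2 h3 h4 h5.
suff : `|2 * b| <= (2 + CA) * rt by rewrite normrM ger0_norm //; lra.
have -> : 2 * b = g0 - (g0 - g - 2 * b) - g by ring.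
apply: le_trans (ler_normB _ _) _.
by have := ler_normB g0 (g0 - g - 2 * b); lra.
Qed.

End primal_dual_witness.

(** * Comparison of integrals of nonnegative functions *)
Section nonneg_integrals.
Context d (T : measurableType d) (R : realType) (P : {measure set T -> \bar R}).
Implicit Types f g : T -> R.

Lemma ge0_integral_le f g : measurable_fun setT f -> measurable_fun setT g ->
  (forall w, 0 <= f w) -> (forall w, f w <= g w) ->
  (\int[P]_w (f w)%:E <= \int[P]_w (g w)%:E)%E.
Proof.
move=> mf mg f0 fg; apply: ge0_le_integral => //.
- by move=> w _; rewrite lee_fin.
- exact/measurable_EFinP.
- exact/measurable_EFinP.
- by move=> w _; rewrite lee_fin.
Qed.

Lemma ge0_integral_add f g : measurable_fun setT f -> measurable_fun setT g ->
  (forall w, 0 <= f w) -> (forall w, 0 <= g w) ->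
  (\int[P]_w (f w + g w)%:E = \int[P]_w (f w)%:E + \int[P]_w (g w)%:E)%E.
Proof.
move=> mf mg f0 g0; under eq_integral do rewrite EFinD.
by apply: ge0_integralD => //; try (by move=> w _; rewrite lee_fin); exact/measurable_EFinP.
Qed.

Lemma ge0_integral_scale (c : R) f : measurable_fun setT f -> 0 <= c ->
  (forall w, 0 <= f w) ->
  (\int[P]_w (c * f w)%:E = c%:E * \int[P]_w (f w)%:E)%E.
Proof.
move=> mf c0 f0; under eq_integral do rewrite EFinM.
apply: ge0_integralZl => //; first exact/measurable_EFinP.
by move=> w _; rewrite lee_fin.
Qed.

Lemma integral_set_indic (A : set T) f :
  (\int[P]_(w in A) (f w)%:E = \int[P]_w (f w * \1_A w)%:E)%E.
Proof.
by rewrite integral_mkcond -[fun x => (f x)%:E]/(EFin \o f) restrict_EFin patch_indic.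
Qed.

End nonneg_integrals.

Section transfer.
Context d d1 (T : measurableType d) (T' : measurableType d1) (R : realType).
Variable P : {measure set T -> \bar R}.
Import HBNNSimple.

(** Weighted laws: if [f1] weighs every event of [Z1] at most as much as [f2]
    weighs the same event of [Z2], the inequality passes to all nonnegative
    functions, by simple functions and monotone convergence. *)
Lemma integral_transfer (f1 f2 : T -> R) (Z1 Z2 : T -> T') (g : T' -> R) :
  measurable_fun setT f1 -> measurable_fun setT f2 ->
  measurable_fun setT Z1 -> measurable_fun setT Z2 -> measurable_fun setT g ->
  (forall w, 0 <= f1 w) -> (forall w, 0 <= f2 w) -> (forall x, 0 <= g x) ->
  (forall B, measurable B -> (\int[P]_(w in Z1 @^-1` B) (f1 w)%:E <=
     \int[P]_(w in Z2 @^-1` B) (f2 w)%:E)%E) ->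
  (\int[P]_w (f1 w * g (Z1 w))%:E <= \int[P]_w (f2 w * g (Z2 w))%:E)%E.
Proof.
move=> mf1 mf2 mZ1 mZ2 mg f10 f20 g0 f12.
have mgE : measurable_fun setT (EFin \o g) by exact/measurable_EFinP.
pose gn := nnsfun_approx measurableT mgE.
have gn_cvg x : (gn^~ x @ \oo --> g x)%R.
  have gE0 y : setT y -> (0 <= (EFin \o g) y)%E by move=> _; rewrite lee_fin.
  by have /fine_cvgP[] := cvg_nnsfun_approx measurableT mgE gE0 (I : setT x).
have simple (h : {nnsfun T' >-> R}) :
    (\int[P]_w (f1 w * h (Z1 w))%:E <= \int[P]_w (f2 w * h (Z2 w))%:E)%E.
  pose s := fset_set (range h).
  have hE (f : T -> R) (Z : T -> T') : measurable_fun setT f -> measurable_fun setT Z -> (forall w, 0 <= f w) ->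
     (\int[P]_w (f w * h (Z w))%:E = \sum_(i < #|` s|)
       (s`_i)%:E * \int[P]_(w in Z @^-1` (h @^-1` [set s`_i])) (f w)%:E)%E.
    move=> mf mZ f0.
    transitivity (\int[P]_w (\sum_(i < #|` s|)
        ((s`_i) * (f w * \1_(Z @^-1` (h @^-1` [set s`_i])) w))%:E))%E.
      apply: eq_integral => w _; rewrite fimfunEord mulr_sumr sumEFin; congr EFin.
      by apply: eq_bigr => i _; rewrite mulrCA !indicE.
    have s0 i : 0 <= s`_i.
      have [ilt|ige] := ltnP i (size s); last by rewrite nth_default.
      have : s`_i \in s by exact: mem_nth.
      rewrite in_fset_set; last exact: fimfunP.
      by move=> /set_mem[x _ <-]; exact: fun_ge0.
    have mA i : measurable (Z @^-1` (h @^-1` [set s`_i])).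
      by rewrite -[_ @^-1` _]setTI; apply: mZ => //; exact: measurable_sfunP.
    have mI i : measurable_fun setT (fun w => f w * \1_(Z @^-1` (h @^-1` [set s`_i])) w).
      by apply: measurable_funM => //; exact: measurable_indic.
    rewrite ge0_integral_sum //.
    - apply: eq_bigr => i _; rewrite integral_set_indic ge0_integral_scale //.
      by move=> w; rewrite mulr_ge0 // indicE.
    - by move=> i; apply/measurable_EFinP; exact: measurable_funM.
    - by move=> i w _; rewrite lee_fin mulr_ge0 // mulr_ge0 // indicE.
  rewrite !hE //; apply: lee_sum => i _.
  have [ilt|ige] := ltnP i (size s); last by rewrite nth_default // !mul0e.
  apply: lee_wpmul2l; last by apply: f12; exact: measurable_sfunP.
  have : s`_i \in s by exact: mem_nth.
  rewrite in_fset_set; last exact: fimfunP.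
  by move=> /set_mem[x _ <-]; rewrite lee_fin; exact: fun_ge0.
have conv (f : T -> R) (Z : T -> T') : measurable_fun setT f -> measurable_fun setT Z -> (forall w, 0 <= f w) ->
   (\int[P]_w (f w * gn n (Z w))%:E @[n --> \oo] --> \int[P]_w (f w * g (Z w))%:E)%E.
  move=> mf mZ f0.
  have -> : (\int[P]_w (f w * g (Z w))%:E = \int[P]_w (limn (fun n => (f w * gn n (Z w))%:E)))%E.
    apply: eq_integral => w _; apply/esym/cvg_lim => //.
    by apply: cvg_EFin; [exact: nearW|apply: cvgMl_tmp; exact: gn_cvg].
  apply: cvg_monotone_convergence => //.
  - move=> n; apply/measurable_EFinP; apply: measurable_funM => //.
    exact: measurableT_comp.
  - by move=> n w _; rewrite lee_fin mulr_ge0.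
  - move=> w _ m n mn; rewrite lee_fin ler_wpM2l //.
    by have /lefP := nd_nnsfun_approx measurableT mgE mn; exact.
apply: (lee_cvg_to (conv f1 Z1 mf1 mZ1 f10) (conv f2 Z2 mf2 mZ2 f20)).
by apply: nearW => n; exact: simple.
Qed.

End transfer.

(** * Independent samples *)
Lemma measurable_gt_set d (T : measurableType d) (R : realType) (f : T -> R) (c : R) :
  measurable_fun setT f -> measurable [set w | c < f w].
Proof.
move=> mf; rewrite -[[set w | _]]setTI.
exact: (measurable_fun_ltr (measurable_cst c) mf measurableT (Y := [set true])).
Qed.

Section iid_products.
Context d d1 (T : measurableType d) (T' : measurableType d1) (R : realType).
Variable P : probability T R.
Context (n : nat) (Z : 'I_n -> T -> T').
Hypotheses (mZ : forall j, measurable_fun setT (Z j))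
  (indep : mutually_independent P Z) (ident : identically_distributed P Z).

Lemma measurable_preimage j (B : set T') : measurable B -> measurable (Z j @^-1` B).
Proof. by move=> mB; rewrite -[_ @^-1` _]setTI; exact: mZ. Qed.

Lemma integral_cst1_set (A : set T) : measurable A ->
  (\int[P]_(w in A) (1 : R)%:E = P A)%E.
Proof. by move=> mA; rewrite integral_cst // mul1e. Qed.

Lemma identical_integral (g : T' -> R) i j : measurable_fun setT g ->
  (forall x, 0 <= g x) ->
  (\int[P]_w (g (Z i w))%:E <= \int[P]_w (g (Z j w))%:E)%E.
Proof.
move=> mg g0.
have E k : (\int[P]_w (g (Z k w))%:E = \int[P]_w (cst 1 w * g (Z k w))%:E)%E.
  by apply: eq_integral => w _; rewrite mul1r.
rewrite !E; apply: integral_transfer => // B mB.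
rewrite !integral_cst1_set; try exact: measurable_preimage.
by rewrite (ident i j mB).
Qed.

Section product.
Context (g : T' -> R) (M : R) (j1 : 'I_n).
Hypotheses (mg : measurable_fun setT g) (g0 : forall x, 0 <= g x) (M0 : 0 <= M)
  (gM : (\int[P]_w (g (Z j1 w))%:E <= M%:E)%E).

(** The factors are replaced one at a time: [B j] stands for the events that
    have not been replaced yet. *)
Lemma mixed_product_le (k : nat) (B : 'I_n -> set T') : (k <= n)%N ->
  (forall j, measurable (B j)) ->
  (\int[P]_w (\prod_(j < n) (if (j < k)%N then g (Z j w) else \1_(Z j @^-1` B j) w))%:E
     <= (\prod_(j < n) (if (j < k)%N then M else fine (P (Z j @^-1` B j))))%:E)%E.
Proof.
elim: k B => [|k IH] B kn mB.
  have -> : (\int[P]_w (\prod_(j < n) \1_(Z j @^-1` B j) w)%:E =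
      P (\bigcap_(j in [set: 'I_n]) (Z j @^-1` B j)))%E.
    rewrite -[RHS]integral_cst1_set; last first.
      apply: fin_bigcap_measurable => // j _; exact: measurable_preimage.
    rewrite (integral_set_indic _ _ (cst 1)); apply: eq_integral => w _; congr EFin.
    rewrite mul1r; have [inB|/existsNP[j jB]] := pselect (forall j, B j (Z j w)).
      rewrite big1 => [|j _]; last by rewrite indicE mem_set //; exact: inB.
      by rewrite indicE mem_set // => j _; exact: inB.
    rewrite (bigD1 j) //= indicE memNset // mul0r indicE memNset //.
    by move=> /(_ j I).
  rewrite indep //= -prodEFin le_eqVlt; apply/orP; left; apply/eqP.
  apply: eq_bigr => j _; rewrite fineK // fin_num_measure //.
  exact: measurable_preimage.
pose kk := Ordinal kn.
have mF j (b : bool) : measurable_fun setT (fun w => if b then g (Z j w) else \1_(Z j @^-1` B j) w).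
  case: b; first exact: measurableT_comp.
  exact/measurable_indic/measurable_preimage.
pose F (j : 'I_n) w := if (j < k)%N then g (Z j w) else \1_(Z j @^-1` B j) w.
pose q (j : 'I_n) := if (j < k)%N then M else fine (P (Z j @^-1` B j)).
have kkE (j : 'I_n) : j != kk -> (j < k.+1)%N = (j < k)%N.
  move=> jk; rewrite ltnS leq_eqVlt; suff /negPf -> : (j != k :> nat) by [].
  by apply: contra jk => /eqP jk; apply/eqP/val_inj.
pose f1 w := \prod_(j < n | j != kk) F j w.
pose c := \prod_(j < n | j != kk) q j.
have c0 : 0 <= c.
  by apply: prodr_ge0 => j _; rewrite /q; case: ifP => // _; rewrite fine_ge0.
have -> : (\int[P]_w (\prod_(j < n) (if (j < k.+1)%N then g (Z j w)
    else \1_(Z j @^-1` B j) w))%:E = \int[P]_w (f1 w * g (Z kk w))%:E)%E.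
  apply: eq_integral => w _; congr EFin.
  rewrite (bigD1 kk) //= ltnSn mulrC; congr (_ * _); apply: eq_bigr => j jk.
  by rewrite (kkE j jk).
have -> : \prod_(j < n) (if (j < k.+1)%N then M else fine (P (Z j @^-1` B j))) = c * M.
  rewrite (bigD1 kk) //= ltnSn mulrC; congr (_ * _); apply: eq_bigr => j jk.
  by rewrite (kkE j jk).
have mf1 : measurable_fun setT f1.
  have -> : f1 = fun w => \prod_(j <- [seq j <- index_enum 'I_n | j != kk]) F j w.
    by apply/funext => w; rewrite big_filter.
  by apply: measurable_prod => j _; exact: mF.
have f10 w : 0 <= f1 w.
  by apply: prodr_ge0 => j _; rewrite /F; case: ifP => // _; rewrite indicE.
have step : (\int[P]_w (f1 w * g (Z kk w))%:E <= \int[P]_w (cst c w * g (Z kk w))%:E)%E.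
  apply: integral_transfer => // B0 mB0.
  rewrite integral_set_indic.
  have -> : (\int[P]_(w in Z kk @^-1` B0) (cst c w)%:E = c%:E * P (Z kk @^-1` B0))%E.
    exact: (integral_cst P (measurable_preimage kk mB0) c%:E).
  pose B' (j : 'I_n) := if j == kk then B0 else B j.
  have mB' j : measurable (B' j) by rewrite /B'; case: ifP.
  have := IH B' (ltnW kn) mB'.
  have -> : (\int[P]_w (\prod_(j < n) (if (j < k)%N then g (Z j w)
      else \1_(Z j @^-1` B' j) w))%:E = \int[P]_w (f1 w * \1_(Z kk @^-1` B0) w)%:E)%E.
    apply: eq_integral => w _; congr EFin.
    rewrite (bigD1 kk) //= ltnn /B' eqxx mulrC; congr (_ * _); apply: eq_bigr => j jk.
    by rewrite /F (negPf jk).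
  move=> /le_trans; apply.
  rewrite (bigD1 kk) //= ltnn /B' eqxx mulrC EFinM fineK; last first.
    by apply: fin_num_measure; exact: measurable_preimage.
  rewrite lee_wpmul2r // lee_fin le_eqVlt; apply/orP; left; apply/eqP.
  by apply: eq_bigr => j jk; rewrite /q (negPf jk).
apply: le_trans step _.
rewrite ge0_integral_scale //; last exact: measurableT_comp.
rewrite EFinM lee_wpmul2l ?lee_fin //.
by apply: le_trans gM; exact: identical_integral.
Qed.

Lemma iid_product_le : (\int[P]_w (\prod_(j < n) g (Z j w))%:E <= (M ^+ n)%:E)%E.
Proof.
have := @mixed_product_le n (fun=> setT) (leqnn n) (fun=> measurableT).
under eq_integral => w _ do under eq_bigr => j _ do rewrite ltn_ord.
under [X in (_ <= X%:E)%E -> _]eq_bigr => j _ do rewrite ltn_ord.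
by rewrite prodr_const card_ord.
Qed.

End product.

Lemma iid_chernoff (h : T' -> R) (t b x : R) (j1 : 'I_n) :
  measurable_fun setT h -> 0 < t ->
  (\int[P]_w (expR (t * h (Z j1 w)))%:E <= (expR b)%:E)%E ->
  (P [set w | (n%:R * x < \sum_(j < n) h (Z j w))%R] <= (expR (n%:R * (b - t * x)))%:E)%E.
Proof.
move=> mh t0 hb.
pose A := [set w | n%:R * x < \sum_(j < n) h (Z j w)].
have mhZ j : measurable_fun setT (fun w => h (Z j w)) by exact: measurableT_comp.
have msum : measurable_fun setT (fun w => \sum_(j < n) h (Z j w)) by exact: measurable_sum.
have mA : measurable A.
  exact: measurable_gt_set.
pose g (y : T') := expR (t * h y).
have mg : measurable_fun setT g.
  by apply: measurableT_comp => //; exact: measurable_funM.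
have := @iid_product_le g (expR b) j1 mg (fun _ => expR_ge0 _) (expR_ge0 _) hb.
rewrite -expRM_natl => prod_le.
have mpr : measurable_fun setT (fun w => \prod_(j < n) g (Z j w)).
  by apply: measurable_prod => j _; exact: measurableT_comp.
have : (\int[P]_w (expR (t * (n%:R * x)) * \1_A w)%:E <= \int[P]_w (\prod_(j < n) g (Z j w))%:E)%E.
  apply: ge0_integral_le => //.
    by apply: measurable_funM => //; exact: measurable_indic.
  move=> w; rewrite /g -expR_sum -mulr_sumr indicE.
  have [/set_mem wA|_] := boolP (w \in A); last by rewrite mulr0 expR_ge0.
  by rewrite mulr1 ler_expR ler_pM2l // ltW.
rewrite ge0_integral_scale; [|exact: measurable_indic|exact: expR_ge0|by move=> w; rewrite indicE].
rewrite integral_indic // setIT => h1.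
have : ((expR (t * (n%:R * x)))%:E * P A <= (expR (n%:R * b))%:E)%E by exact: le_trans h1 prod_le.
have PA : P A = (fine (P A))%:E by rewrite fineK // fin_num_measure.
rewrite -/A PA -EFinM !lee_fin.
rewrite mulrC -ler_pdivlMr ?expR_gt0 // -expRN -expRD.
by rewrite mulrBr [t * (_ * x)]mulrCA.
Qed.

End iid_products.

(** * Exponential moments of subgaussian covariates *)
Section exponential_bounds.
Context (R : realType).
Implicit Types x y z : R.

Lemma le_expR x : x <= expR x.
Proof. by apply: le_trans (expR_ge1Dx x); rewrite lerDr. Qed.

Lemma expR_le_1xexpR x : expR x <= 1 + x * expR x.
Proof.
have := ler_wpM2l (expR_ge0 x) (expR_ge1Dx (- x)).
by rewrite -expRD subrr expR0; lra.
Qed.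

Lemma expR_le_quadratic x : expR x <= 1 + x + x ^+ 2 * expR `|x|.
Proof.
have h := expR_le_1xexpR x.
have [x0|x0] := leP 0 x.
  by rewrite ger0_norm //; have := ler_wpM2l x0 h; lra.
have h1 : x * (expR x - 1) <= x * x.
  by apply: ler_wnM2l; [exact: ltW|have := expR_ge1Dx x; lra].
have h2 : x ^+ 2 <= x ^+ 2 * expR `|x|.
  by rewrite ler_peMr ?sqr_ge0 // -expR0 ler_expR.
by lra.
Qed.

Lemma le_scaled_expR c x : 0 < c -> x <= c^-1 * expR (c * x).
Proof. by move=> c0; rewrite mulrC ler_pdivlMr // mulrC le_expR. Qed.

Lemma sqr_le_scaled_expR c x : 0 < c -> 0 <= x -> x ^+ 2 <= 4 / c ^+ 2 * expR (c * x).
Proof.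
move=> c0 x0.
have c2 : 0 < c / 2 by rewrite divr_gt0.
have h := le_scaled_expR x c2.
have -> : 4 / c ^+ 2 * expR (c * x) = ((c / 2)^-1 * expR (c / 2 * x)) ^+ 2.
  rewrite exprMn -expRM_natl; congr (_ * _); first by field; rewrite gt_eqF.
  by congr expR; field.
by rewrite ler_sqr ?nnegrE // mulr_ge0 ?expR_ge0 // invr_ge0 ltW.
Qed.

Lemma expR_norm_le c x : 0 < c -> expR (2 * `|x|) <= expR (2 / c) * expR (c / 2 * x ^+ 2).
Proof.
move=> c0; rewrite -expRD ler_expR -[x ^+ 2]real_normK ?num_real //.
have h := sqr_ge0 (2 - c * `|x|).
rewrite -subr_ge0 (_ : _ - _ = (2 - c * `|x|) ^+ 2 / (2 * c)).
  by rewrite divr_ge0 // mulr_ge0 // ltW.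
by field; rewrite gt_eqF.
Qed.

Lemma expR_mean3 x y z : expR ((x + y + z) / 3) <= expR x + expR y + expR z.
Proof.
have ex := expR_ge0 x; have ey := expR_ge0 y; have ez := expR_ge0 z.
have [hxy|hxy] := leP x y; have [hyz|hyz] := leP y z; have [hxz|hxz] := leP x z;
 first [ have : expR ((x + y + z) / 3) <= expR z by rewrite ler_expR; lra
       | have : expR ((x + y + z) / 3) <= expR y by rewrite ler_expR; lra
       | have : expR ((x + y + z) / 3) <= expR x by rewrite ler_expR; lra ]; lra.
Qed.

Lemma young_powR x y q : 0 <= x -> 0 <= y -> 1 < q ->
  x * y <= x `^ q + y `^ (q / (q - 1)).
Proof.
move=> x0 y0 q1; have q0 : 0 < q by lra.
have q10 : 0 < q - 1 by lra.
apply: le_trans (@conjugate_powR _ _ _ q (q / (q - 1)) x0 y0 q0 _ _) _.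
- by rewrite divr_gt0.
- by rewrite invf_div; field; rewrite gt_eqF.
apply: lerD.
  by rewrite ler_pdivrMr // ler_peMr ?powR_ge0 // ltW.
rewrite ler_pdivrMr ?divr_gt0 // ler_peMr ?powR_ge0 //.
by rewrite ler_pdivlMr // mul1r; lra.
Qed.

End exponential_bounds.

Lemma nneseries_geometric_le (R : realType) (c r : R) : 0 <= c -> 0 <= r < 1 ->
  (\sum_(0 <= k <oo) (c * r ^+ k)%:E <= (c / (1 - r))%:E)%E.
Proof.
move=> c0 /andP[r0 r1]; apply: lime_le.
  by apply: is_cvg_nneseries => k _ _; rewrite lee_fin mulr_ge0 // exprn_ge0.
apply: nearW => n; rewrite sumEFin lee_fin.
have := @geometric_seriesE R c r (negbT (lt_eqF r1)) => /(congr1 (fun f => f n)).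
rewrite /series /geometric /= => ->.
apply: ler_wpM2r; first by rewrite invr_ge0 subr_ge0 ltW.
by rewrite ler_piMr // gerBl exprn_ge0.
Qed.

Section subgaussian_moments.
Context d (T : measurableType d) (R : realType) (P : probability T R) (p : nat).
Context (X : {RV P >-> p.-tuple R}) (csub L : R).
Hypotheses (csub0 : 0 < csub) (L0 : 0 < L) (sg : subgaussian csub X).
Implicit Types v : 'rV[R]_p.

Lemma measurable_dot v : measurable_fun setT (fun x : p.-tuple R => dot x v).
Proof.
apply: measurable_sum => k; apply: measurable_funM => //; exact: measurable_tnth.
Qed.

Lemma measurable_dot_RV v : measurable_fun setT (fun w => dot (X w) v).
Proof. exact: (measurableT_comp (measurable_dot v) (measurable_funPT X)). Qed.

(** The sum of the geometric series in [subgaussian_exp_square]. *)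
Definition exp_square_bound : R := 2 * expR 2^-1 / (1 - expR (- 2^-1)).

Lemma exp_square_bound_ge1 : 1 <= exp_square_bound.
Proof.
have h1 : 1 <= expR 2^-1 :> R by rewrite -expR0 ler_expR.
have h2 : expR (- 2^-1) < 1 :> R by rewrite -[ltRHS]expR0 ltr_expR oppr_lt0.
have h3 := expR_gt0 (- 2^-1 : R).
by rewrite /exp_square_bound ler_pdivlMr; lra.
Qed.

Let kappa := (4 * csub ^+ 2 * L ^+ 2)^-1.

(** Slicing at the integer levels [k] of [V ^ 2 / (2 * csub ^ 2 * L ^ 2)]: on each
    slice the exponential is at most [expR ((k + 1) / 2)], against a tail
    [2 * expR (- k)], so the sum is geometric. *)
Lemma subgaussian_exp_square v : l2norm v <= L ->
  (\int[P]_w (expR (kappa * dot (X w) v ^+ 2))%:E <= exp_square_bound%:E)%E.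
Proof.
move=> vL.
have [v0|vn0] := eqVneq v 0.
  have -> : (\int[P]_w (expR (kappa * dot (X w) v ^+ 2))%:E = 1 * P setT)%E.
    rewrite -integral_cst //; apply: eq_integral => w _; congr EFin.
    by rewrite v0 /dot big1 ?expr0n ?mulr0 ?expR0 // => k _; rewrite mxE mulr0.
  by rewrite probability_setT mul1e lee_fin exp_square_bound_ge1.
have nv0 : 0 < l2norm v.
  by rewrite lt_neqAle l2norm_ge0 andbT eq_sym; apply: contra_neq vn0; exact: l2norm_eq0.
pose U w := dot (X w) v ^+ 2 / (2 * csub ^+ 2 * L ^+ 2).
have den0 : 0 < 2 * csub ^+ 2 * L ^+ 2 by rewrite !mulr_gt0 // exprn_gt0.
have U0 w : 0 <= U w by rewrite divr_ge0 ?sqr_ge0 // ltW.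
have mU : measurable_fun setT U.
  by apply: measurable_funM => //; apply: measurable_funX; exact: measurable_dot_RV.
have mE k : measurable [set w | k%:R <= U w].
  rewrite -[[set w | _]]setTI.
  exact: (measurable_fun_ler (measurable_cst (k%:R : R)) mU measurableT (Y := [set true])).
have tail k : (P [set w | (k%:R <= U w)%R] <= (2 * expR (- k%:R))%:E)%E.
  have t0 : 0 <= Num.sqrt (k%:R * (2 * csub ^+ 2 * L ^+ 2)) by exact: sqrtr_ge0.
  have -> : [set w | (k%:R <= U w)%R] =
     [set w | (Num.sqrt (k%:R * (2 * csub ^+ 2 * L ^+ 2)) <= `|dot (X w) v|)%R].
    apply/seteqP; split => w /=; rewrite /U ler_pdivlMr // => h.
      by rewrite -sqrtr_sqr ler_wsqrtr.
    have h2 : Num.sqrt (k%:R * (2 * csub ^+ 2 * L ^+ 2)) ^+ 2 <= `|dot (X w) v| ^+ 2.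
      by rewrite ler_sqr ?nnegrE.
    by move: h2; rewrite real_normK ?num_real // sqr_sqrtr // mulr_ge0 // ltW.
  apply: le_trans (sg vn0 t0) _; rewrite lee_fin ler_wpM2l // ler_expR lerN2.
  rewrite sqr_sqrtr; last by rewrite mulr_ge0 // ltW.
  rewrite ler_pdivlMr; last by rewrite !mulr_gt0 // exprn_gt0.
  rewrite ler_wpM2l // ler_wpM2l ?mulr_ge0 ?(ltW csub0) //.
  by rewrite ler_sqr ?nnegrE ?l2norm_ge0 // ltW.
pose f k w : \bar R := (expR ((k.+1)%:R / 2) * \1_[set w | k%:R <= U w] w)%:E.
have f0 k w : (0 <= f k w)%E by rewrite lee_fin mulr_ge0 ?expR_ge0 // indicE.
have mf k : measurable_fun setT (f k).
  by apply/measurable_EFinP; apply: measurable_funM => //; exact: measurable_indic.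
apply: (@le_trans _ _ (\int[P]_w (\sum_(0 <= k <oo) f k w))%E).
  apply: ge0_le_integral => //.
  - apply/measurable_EFinP; apply: measurableT_comp => //.
    by apply: measurable_funM => //; apply: measurable_funX; exact: measurable_dot_RV.
  - by apply: ge0_emeasurable_sum => [k w _ _|k _]; [exact: f0|exact: mf].
  move=> w _; pose k := Num.truncn (U w).
  have /andP[kU Uk] : (k%:R <= U w < k.+1%:R)%R by exact: truncn_itv.
  apply: le_trans (nneseries_lim_ge k.+1 _); last by move=> *; exact: f0.
  rewrite big_nat_recr //=; apply: (@le_trans _ _ (f k w)).
    rewrite /f indicE mem_set // mulr1 lee_fin ler_expR.
    have -> : kappa * dot (X w) v ^+ 2 = U w / 2.
      by rewrite /kappa /U; field; rewrite !gt_eqF.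
    by rewrite ler_wpM2r ?invr_ge0 // ltW.
  by rewrite leeDr // sume_ge0.
rewrite integral_nneseries //.
apply: (@le_trans _ _ (\sum_(0 <= k <oo) (2 * expR 2^-1 * expR (- 2^-1) ^+ k)%:E)%E).
  apply: lee_nneseries => [k _ _|k _]; first exact: integral_ge0.
  rewrite /f ge0_integral_scale; [|exact: measurable_indic|exact: expR_ge0|by move=> w; rewrite indicE].
  rewrite integral_indic // setIT.
  apply: le_trans (lee_wpmul2l _ (tail k)) _; first by rewrite lee_fin expR_ge0.
  rewrite -EFinM lee_fin mulrCA -mulrA ler_wpM2l // -expRM_natl -!expRD ler_expR.
  by rewrite -natr1; lra.
apply: nneseries_geometric_le; first by rewrite mulr_ge0 ?expR_ge0.
by rewrite expR_ge0 -[ltRHS]expR0 ltr_expR oppr_lt0 invr_gt0 ltr0n.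
Qed.

End subgaussian_moments.

(** * Conditional moments of the noise *)
Lemma maxr0E (R : realType) (x : R) : Num.max x 0 = (`|x| + x) / 2.
Proof.
have [x0|x0] := leP x 0; first by rewrite ler0_norm // addNr mul0r.
by rewrite gtr0_norm //; field.
Qed.

Section conditional_moments.
Context d (T : measurableType d) (R : realType) (P : probability T R) (p : nat).
Context (X : {RV P >-> p.-tuple R}) (eps : {RV P >-> R}).
Implicit Types (G : p.-tuple R -> R) (f h : T -> R).

Lemma preimage_event (B : set (p.-tuple R)) : measurable B ->
  g_sigma_algebra_preimage X (X @^-1` B).
Proof. by move=> mB; exists B => //; rewrite setTI. Qed.

Lemma measurable_preimage_RV (B : set (p.-tuple R)) : measurable B ->
  measurable (X @^-1` B).
Proof. by move=> mB; rewrite -[_ @^-1` _]setTI; exact: (measurable_funPT X). Qed.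

Lemma measurable_max0 f : measurable_fun setT f ->
  measurable_fun setT (fun w => Num.max (f w) 0).
Proof. by move=> mf; apply: measurable_maxr. Qed.

Lemma integrable_measurable f : P.-integrable setT (EFin \o f) -> measurable_fun setT f.
Proof. by move=> /integrableP[/measurable_EFinP]. Qed.

Lemma integral_max0E f (A : set T) :
  (\int[P]_(w in A) (f w)%:E =
   \int[P]_(w in A) (Num.max (f w) 0)%:E - \int[P]_(w in A) (Num.max (- f w) 0)%:E)%E.
Proof.
rewrite integralE; congr (_ - _)%E; apply: eq_integral => w _.
  by rewrite funeposE EFin_max.
by rewrite funenegE EFin_max.
Qed.

Lemma integral_max0_fin f (A : set T) : measurable A -> P.-integrable setT (EFin \o f) ->
  (\int[P]_(w in A) (Num.max (f w) 0)%:E)%E \is a fin_num.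
Proof.
move=> mA intf; have mf := integrable_measurable intf.
have := integrable_fin_num mA (integrable_funepos mA (integrableS measurableT mA (@subsetT _ A) intf)).
by congr (_ \is a fin_num); apply: eq_integral => w _; rewrite funeposE EFin_max.
Qed.

(** The defining property of the conditional expectation on events of [X] extends
    to functions of [X] by transfer. The positive part stands for [h], which is
    nonnegative only almost surely. *)
Lemma cond_expectation_pairing f h G : is_cond_expectation P X f h ->
  (forall w, 0 <= f w) -> measurable_fun setT G -> (forall x, 0 <= G x) ->
  (\int[P]_w (f w * G (X w))%:E <= \int[P]_w (Num.max (h w) 0 * G (X w))%:E)%E.
Proof.
move=> [intf inth _ hf] f0 mG G0.
have mh := integrable_measurable inth.
apply: integral_transfer => //; [exact: integrable_measurable|exact: measurable_max0| |].
  by move=> w; rewrite le_max lexx orbT.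
move=> B mB; rewrite -hf; last exact: preimage_event.
have fin : (\int[P]_(w in X @^-1` B) (Num.max (- h w) 0)%:E)%E \is a fin_num.
  by apply: integral_max0_fin; [exact: measurable_preimage_RV|exact: (integrableN inth)].
rewrite integral_max0E leeBlDr // leeDl // integral_ge0 // => w _.
by rewrite lee_fin le_max lexx orbT.
Qed.

(** The positive and the negative part of [eps] give the same weight to every event
    of [X], hence to the positive and the negative part of [G X]. *)
Lemma cond_mean_zero G : is_cond_expectation P X eps (cst 0) ->
  measurable_fun setT G -> P.-integrable setT (EFin \o (fun w => eps w * G (X w))) ->
  (\int[P]_w (eps w * G (X w))%:E = 0)%E.
Proof.
move=> [inte _ _ e0] mG inteG.
have me := integrable_measurable inte.
have mX := measurable_funPT X.
have mN f : measurable_fun setT f -> measurable_fun setT (fun w => - f w).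
  by move=> mf; exact: measurableT_comp.
pose ep w := Num.max (eps w) 0; pose en w := Num.max (- eps w) 0.
pose Gp x := Num.max (G x) 0; pose Gn x := Num.max (- G x) 0.
have mep : measurable_fun setT ep by exact: measurable_max0.
have men : measurable_fun setT en by apply: measurable_max0; exact: mN.
have mGp : measurable_fun setT Gp by exact: measurable_maxr.
have mGn : measurable_fun setT Gn.
  by apply: measurable_maxr => //; exact: measurableT_comp.
have pos (x : R) : 0 <= Num.max x 0 by rewrite le_max lexx orbT.
have epn (B : set (p.-tuple R)) : measurable B ->
    (\int[P]_(w in X @^-1` B) (ep w)%:E = \int[P]_(w in X @^-1` B) (en w)%:E)%E.
  move=> mB; have := e0 _ (preimage_event mB); rewrite [RHS]integral_max0E.
  rewrite integral0 => /esym/eqP; rewrite sube_eq ?add0e; first by move/eqP.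
  - by apply: integral_max0_fin => //; exact: measurable_preimage_RV.
  - apply: fin_num_adde_defl; apply: integral_max0_fin; first exact: measurable_preimage_RV.
    exact: (integrableN inte).
have eqG (g : p.-tuple R -> R) : measurable_fun setT g -> (forall x, 0 <= g x) ->
    (\int[P]_w (ep w * g (X w))%:E = \int[P]_w (en w * g (X w))%:E)%E.
  move=> mg g0; apply/eqP; rewrite eq_le; apply/andP; split;
    by apply: integral_transfer => // [w|w|B mB]; rewrite ?pos // epn.
have mgX (g : p.-tuple R -> R) : measurable_fun setT g -> measurable_fun setT (fun w => g (X w)).
  by move=> mg; exact: measurableT_comp.
have split1 : (\int[P]_w (Num.max (eps w * G (X w)) 0)%:E =
   \int[P]_w (ep w * Gp (X w))%:E + \int[P]_w (en w * Gn (X w))%:E)%E.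
  rewrite -ge0_integral_add; [|by apply: measurable_funM => //; exact: mgX
    |by apply: measurable_funM => //; exact: mgX|by move=> w; rewrite mulr_ge0 ?pos
    |by move=> w; rewrite mulr_ge0 ?pos].
  apply: eq_integral => w _; congr EFin.
  by rewrite /ep /en /Gp /Gn !maxr0E !normrN normrM; field.
have split2 : (\int[P]_w (Num.max (- (eps w * G (X w))) 0)%:E =
   \int[P]_w (en w * Gp (X w))%:E + \int[P]_w (ep w * Gn (X w))%:E)%E.
  rewrite -ge0_integral_add; [|by apply: measurable_funM => //; exact: mgX
    |by apply: measurable_funM => //; exact: mgX|by move=> w; rewrite mulr_ge0 ?pos
    |by move=> w; rewrite mulr_ge0 ?pos].
  apply: eq_integral => w _; congr EFin.
  by rewrite /ep /en /Gp /Gn !maxr0E !normrN normrM; field.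
have eGp : (\int[P]_w (ep w * Gp (X w))%:E = \int[P]_w (en w * Gp (X w))%:E)%E.
  by apply: eqG => // x; exact: pos.
have eGn : (\int[P]_w (ep w * Gn (X w))%:E = \int[P]_w (en w * Gn (X w))%:E)%E.
  by apply: eqG => // x; exact: pos.
have fin := integral_max0_fin measurableT inteG.
rewrite (integral_max0E (fun w => eps w * G (X w))) split1 split2 -eGp -eGn subee //.
by rewrite eGn -split1.
Qed.

End conditional_moments.

Section moment_constants.
Context (R : realType) (q Ceps csub L : R).

Definition subgaussian_rate : R := (4 * csub ^+ 2 * L ^+ 2)^-1.

Definition dual_exponent : R := q / (q - 1).

(** A rate small enough that three subgaussian squares, raised to the dual
    exponent, still have an exponential moment. *)
Definition moment_rate : R := subgaussian_rate / (3 * dual_exponent).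

(** Dominates the prefactors that appear when polynomial factors are absorbed into
    the exponential. *)
Definition moment_scale : R :=
  4 / moment_rate ^+ 2 + moment_rate^-1 + moment_rate^-1 ^+ 2 +
  (2 / moment_rate + 1) * expR (2 / moment_rate).

(** The three terms bound [E(G X)], [E(h ^ q)] and [E((G X) ^ q')], where [h] is the
    conditional moment of the noise and [q'] the dual exponent. *)
Definition moment_bound : R :=
  3 * moment_scale * exp_square_bound R + `|Ceps| +
  3 * moment_scale `^ dual_exponent * exp_square_bound R.

Hypotheses (q1 : 1 < q) (csub0 : 0 < csub) (L0 : 0 < L).

Lemma dual_exponent_ge1 : 1 <= dual_exponent.
Proof. by rewrite /dual_exponent ler_pdivlMr ?subr_gt0 // mul1r gerBl. Qed.

Lemma subgaussian_rate_gt0 : 0 < subgaussian_rate.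
Proof. by rewrite invr_gt0 !mulr_gt0 // exprn_gt0. Qed.

Lemma moment_rate_gt0 : 0 < moment_rate.
Proof.
have h := lt_le_trans ltr01 dual_exponent_ge1.
by rewrite /moment_rate divr_gt0 ?subgaussian_rate_gt0 // mulr_gt0.
Qed.

Lemma moment_rate_le : moment_rate <= subgaussian_rate / 3.
Proof.
have h1 := subgaussian_rate_gt0; have h2 := dual_exponent_ge1.
have h3 := lt_le_trans ltr01 h2.
have h4 : 3 <= 3 * dual_exponent by lra.
rewrite /moment_rate; apply: ler_wpM2l; first exact: ltW.
have h5 : 0 < 3 * dual_exponent by lra.
by rewrite lef_pV2 ?posrE.
Qed.

Lemma moment_scale_ge : [/\ 0 < moment_scale, 4 / moment_rate ^+ 2 <= moment_scale,
  moment_rate^-1 <= moment_scale, moment_rate^-1 ^+ 2 <= moment_scale &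
  (2 / moment_rate + 1) * expR (2 / moment_rate) <= moment_scale].
Proof.
have c0 := moment_rate_gt0.
have h1 : 0 < 4 / moment_rate ^+ 2 by rewrite divr_gt0 // exprn_gt0.
have h2 : 0 < moment_rate^-1 by rewrite invr_gt0.
have h3 : 0 < moment_rate^-1 ^+ 2 by rewrite exprn_gt0.
have h4 : 0 < (2 / moment_rate + 1) * expR (2 / moment_rate).
  by rewrite mulr_gt0 ?expR_gt0 // addr_gt0 // divr_gt0.
by rewrite /moment_scale; split; lra.
Qed.

Lemma moment_bound_ge : 3 * moment_scale * exp_square_bound R <= moment_bound.
Proof.
have h := exp_square_bound_ge1 R.
rewrite /moment_bound -addrA lerDl addr_ge0 // mulr_ge0 //; last by lra.
by rewrite mulr_ge0 // powR_ge0.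
Qed.

Lemma moment_bound_gt0 : 0 < moment_bound.
Proof.
apply: lt_le_trans moment_bound_ge; have [h _ _ _ _] := moment_scale_ge.
by rewrite !mulr_gt0 //; have := exp_square_bound_ge1 R; lra.
Qed.

End moment_constants.

Section noise_moments.
Context d (T : measurableType d) (R : realType) (P : probability T R) (p : nat).
Context (X : {RV P >-> p.-tuple R}) (eps : {RV P >-> R}) (m : nat) (q Ceps csub L : R).
Hypotheses (csub0 : 0 < csub) (L0 : 0 < L) (q1 : 1 < q).
Hypotheses (sg : subgaussian csub X) (m23 : m = 2%N \/ m = 3%N).
Hypothesis moment : cond_moment_bound m q Ceps X eps.
Implicit Types (a b c : 'rV[R]_p) (G : p.-tuple R -> R).
Let c0 := moment_rate q csub L.
Let K := moment_scale q csub L.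
Let C := moment_bound q Ceps csub L.
Let C0 := exp_square_bound R.
Let kappa := subgaussian_rate csub L.
Let q' := dual_exponent q.

Definition gaussian_envelope (r : R) a b c (x : p.-tuple R) : R :=
  expR (r * (dot x a ^+ 2 + dot x b ^+ 2 + dot x c ^+ 2)).

Lemma measurable_envelope r a b c : measurable_fun setT (gaussian_envelope r a b c).
Proof.
apply: measurableT_comp => //; apply: measurable_funM => //.
by apply: measurable_funD; [apply: measurable_funD|];
  apply: measurable_funX; exact: measurable_dot.
Qed.

Lemma measurable_X G : measurable_fun setT G -> measurable_fun setT (fun w => G (X w)).
Proof. move=> mG; exact: (measurableT_comp mG (measurable_funPT X)). Qed.

Lemma measurable_envelope_X r a b c :
  measurable_fun setT (fun w => gaussian_envelope r a b c (X w)).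
Proof. exact: (measurable_X (measurable_envelope r a b c)). Qed.

Lemma envelope_moment r a b c : r <= kappa / 3 -> l2norm a <= L -> l2norm b <= L -> l2norm c <= L ->
  (\int[P]_w (gaussian_envelope r a b c (X w))%:E <= (3 * C0)%:E)%E.
Proof.
move=> rk aL bL cL.
pose E v w := expR (kappa * dot (X w) v ^+ 2).
have mE v : measurable_fun setT (E v).
  apply: measurableT_comp => //; apply: measurable_funM => //.
  by apply: measurable_funX; exact: measurable_dot_RV.
have E0 v w : 0 <= E v w := expR_ge0 _.
apply: (@le_trans _ _ (\int[P]_w (E a w + E b w + E c w)%:E)%E).
  apply: ge0_integral_le.
  - exact: measurable_envelope_X.
  - by apply: measurable_funD => //; exact: measurable_funD.
  - by move=> w; exact: expR_ge0.
  move=> w; apply: le_trans (expR_mean3 _ _ _); rewrite ler_expR.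
  have h : 0 <= dot (X w) a ^+ 2 + dot (X w) b ^+ 2 + dot (X w) c ^+ 2.
    by rewrite !addr_ge0 ?sqr_ge0.
  by have := ler_wpM2r h rk; lra.
rewrite ge0_integral_add //; [|exact: measurable_funD|by move=> w; rewrite addr_ge0].
rewrite ge0_integral_add // (_ : 3 * C0 = C0 + C0 + C0); last by ring.
by rewrite !EFinD !leeD // subgaussian_exp_square.
Qed.

Lemma dominated_moment a b c G : measurable_fun setT G -> (forall x, 0 <= G x) ->
  l2norm a <= L -> l2norm b <= L -> l2norm c <= L ->
  (forall x, G x <= K * gaussian_envelope c0 a b c x) ->
  (\int[P]_w (G (X w))%:E <= C%:E)%E.
Proof.
move=> mG G0 aL bL cL GK.
have [K0 _ _ _ _] := moment_scale_ge q1 csub0 L0; rewrite -/K in K0.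
have ck : c0 <= kappa / 3 by exact: moment_rate_le.
apply: (@le_trans _ _ (K * (3 * C0))%:E); last first.
  by rewrite lee_fin; have := moment_bound_ge q Ceps csub L; rewrite -/K -/C -/C0; lra.
apply: (@le_trans _ _ (\int[P]_w (K * gaussian_envelope c0 a b c (X w))%:E)%E).
  apply: ge0_integral_le => //; first exact: measurable_X.
  by apply: measurable_funM => //; exact: measurable_envelope_X.
rewrite ge0_integral_scale; [|exact: measurable_envelope_X|exact: ltW|
  by move=> w; exact: expR_ge0].
by rewrite EFinM lee_wpmul2l ?lee_fin ?(ltW K0) // envelope_moment.
Qed.

Lemma sqr_le_1_pow (x : R) : x ^+ 2 <= 1 + `|x| ^+ m.
Proof.
rewrite -[x ^+ 2]real_normK ?num_real //; have := normr_ge0 x.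
move: `|x| => y y0; case: m23 => ->; first by lra.
have y3 : 0 <= y ^+ 3 by rewrite exprn_ge0.
have [y1|y1] := leP y 1.
  by have h : y ^+ 2 <= 1 by [rewrite expr_le1]; lra.
by have h : y ^+ 2 <= y ^+ 3 by [rewrite ler_eXn2l // ltW]; lra.
Qed.

(** Conditioning turns [eps ^+ 2] into a function with a finite moment of order
    [q], and the inequality of Young separates it from the covariates. *)
Lemma dominated_noise_moment a b c G : measurable_fun setT G -> (forall x, 0 <= G x) ->
  l2norm a <= L -> l2norm b <= L -> l2norm c <= L ->
  (forall x, G x <= K * gaussian_envelope c0 a b c x) ->
  (\int[P]_w (eps w ^+ 2 * G (X w))%:E <= C%:E)%E.
Proof.
move=> mG G0 aL bL cL GK.
have [K0 _ _ _ _] := moment_scale_ge q1 csub0 L0; rewrite -/K in K0.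
have ck : c0 <= kappa / 3 by exact: moment_rate_le.
have q'1 : 1 <= q' by exact: dual_exponent_ge1.
case: moment => h hcond hq.
have me : measurable_fun setT eps by exact: measurable_funPT.
have mh : measurable_fun setT h by case: hcond => _ /integrable_measurable.
have mmax := measurable_max0 mh.
have max_ge0 w : 0 <= Num.max (h w) 0 by rewrite le_max lexx orbT.
have mGX := measurable_X mG.
have menv r := measurable_envelope_X r a b c.
have mabs : measurable_fun setT (fun w => `|eps w| ^+ m).
  by apply: measurable_funX; exact: measurableT_comp.
have mpow : measurable_fun setT (fun w => h w `^ q).
  exact: measurableT_comp (measurable_powR q) mh.
apply: (@le_trans _ _ (\int[P]_w (G (X w) + `|eps w| ^+ m * G (X w))%:E)%E).
  apply: ge0_integral_le.
  - by apply: measurable_funM => //; exact: measurable_funX.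
  - by apply: measurable_funD => //; exact: measurable_funM.
  - by move=> w; rewrite mulr_ge0 ?sqr_ge0.
  move=> w; have := ler_wpM2r (G0 (X w)) (sqr_le_1_pow (eps w)).
  by rewrite mulrDl mul1r.
rewrite ge0_integral_add //; [|exact: measurable_funM|by move=> w; rewrite mulr_ge0 // exprn_ge0].
have part1 : (\int[P]_w (G (X w))%:E <= (3 * K * C0)%:E)%E.
  apply: (@le_trans _ _ (\int[P]_w (K * gaussian_envelope c0 a b c (X w))%:E)%E).
    apply: ge0_integral_le => //.
    by apply: measurable_funM.
  rewrite ge0_integral_scale; [|exact: menv|exact: ltW|by move=> w; exact: expR_ge0].
  rewrite (_ : 3 * K * C0 = K * (3 * C0)); last by ring.
  by rewrite EFinM lee_wpmul2l ?lee_fin ?(ltW K0) // envelope_moment.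
have part2 : (\int[P]_w (`|eps w| ^+ m * G (X w))%:E <=
    `|Ceps|%:E + (3 * K `^ q' * C0)%:E)%E.
  apply: le_trans (cond_expectation_pairing hcond _ mG G0) _.
    by move=> w; rewrite exprn_ge0.
  pose E w := K `^ q' * gaussian_envelope (kappa / 3) a b c (X w).
  have mE : measurable_fun setT E by exact: measurable_funM.
  have E0 w : 0 <= E w by rewrite mulr_ge0 ?powR_ge0 ?expR_ge0.
  apply: (@le_trans _ _ (\int[P]_w (h w `^ q + E w)%:E)%E).
    apply: ge0_integral_le.
    - exact: measurable_funM.
    - exact: measurable_funD.
    - by move=> w; rewrite mulr_ge0.
    move=> w; apply: le_trans (young_powR (max_ge0 w) (G0 (X w)) q1) _.
    apply: lerD.
      have [h0|h0] := leP (h w) 0; last by [].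
      by rewrite powR0 ?powR_ge0 // gt_eqF // (lt_trans ltr01).
    apply: (@le_trans _ _ ((K * gaussian_envelope c0 a b c (X w)) `^ q')).
      have q'0 : 0 <= q' by apply: le_trans q'1.
      apply: (ge0_ler_powR q'0); rewrite ?nnegrE ?GK ?G0 //.
      by rewrite mulr_ge0 ?expR_ge0 // ltW.
    rewrite powRM ?expR_ge0 ?(ltW K0) // /E ler_wpM2l ?powR_ge0 //.
    rewrite /gaussian_envelope -expRM ler_expR mulrAC ler_wpM2r //.
      by rewrite !addr_ge0 ?sqr_ge0.
    rewrite /c0 /moment_rate -/kappa -/q' le_eqVlt; apply/orP; left; apply/eqP.
    by field; rewrite gt_eqF //; lra.
  rewrite ge0_integral_add //; last by move=> w; exact: powR_ge0.
  apply: leeD.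
    apply: (@le_trans _ _ Ceps%:E); last by rewrite lee_fin ler_norm.
    by move: hq; rewrite unlock.
  rewrite /E ge0_integral_scale; [|exact: menv|exact: powR_ge0|by move=> w; exact: expR_ge0].
  rewrite (_ : 3 * _ * C0 = K `^ q' * (3 * C0)); last by ring.
  by rewrite EFinM lee_wpmul2l ?lee_fin ?powR_ge0 // envelope_moment.
apply: le_trans (leeD part1 part2) _.
by rewrite -!EFinD lee_fin /C /moment_bound -/K -/q' -/C0 addrA.
Qed.

End noise_moments.

(** * Moment generating functions of the score and of products *)
Section moment_generating_functions.
Context d (T : measurableType d) (R : realType) (P : probability T R).
Implicit Types f Y Z : T -> R.

(** Expansions of an exponential have a signed first order term [Y], known only
    through its integral, and a nonnegative remainder [Z]. *)
Lemma signed_integral_le f Y Z (y z : R) :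
  measurable_fun setT f -> measurable_fun setT Z ->
  (forall w, 0 <= f w) -> (forall w, 0 <= Z w) ->
  P.-integrable setT (EFin \o Y) -> (\int[P]_w (Y w)%:E = y%:E)%E ->
  (\int[P]_w (Z w)%:E <= z%:E)%E -> (forall w, f w <= 1 + Y w + Z w) ->
  (\int[P]_w (f w)%:E <= (1 + y + z)%:E)%E.
Proof.
move=> mf mZ f0 Z0 intY Yy Zz fYZ.
have mY := integrable_measurable intY.
have int1 : P.-integrable setT (EFin \o (cst 1 : T -> R)).
  exact: finite_measure_integrable_cst.
have intZ : P.-integrable setT (EFin \o Z).
  apply/integrableP; split; first exact/measurable_EFinP.
  apply: le_lt_trans (_ : (z%:E < +oo)%E); last exact: ltry.
  apply: le_trans Zz; rewrite le_eqVlt; apply/orP; left; apply/eqP.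
  by apply: eq_integral => w _ /=; rewrite ger0_norm.
apply: (@le_trans _ _ (\int[P]_w (1 + Y w + Z w)%:E)%E).
  apply: ge0_integral_le => //.
  by apply: measurable_funD => //; exact: measurable_funD.
have -> : (\int[P]_w (1 + Y w + Z w)%:E =
   \int[P]_w (cst 1 w)%:E + \int[P]_w (Y w)%:E + \int[P]_w (Z w)%:E)%E.
  have int1Y : P.-integrable setT (fun w => (1 + Y w)%:E).
    by have := integrableD measurableT int1 intY.
  transitivity (\int[P]_w ((1 + Y w)%:E + (Z w)%:E))%E; first by [].
  rewrite integralD //; congr (_ + _)%E.
  transitivity (\int[P]_w ((cst 1 w)%:E + (Y w)%:E))%E; first by [].
  by rewrite integralD.
have -> : (\int[P]_w (cst 1 w)%:E = 1%:E :> \bar R)%E.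
  have := integral_cst P measurableT 1%:E; rewrite mul1e => ->.
  exact: probability_setT.
by rewrite Yy EFinD leeD2l.
Qed.

Lemma exp_moment_nonneg Y (t r : R) : measurable_fun setT Y ->
  (forall w, 0 <= Y w) -> 0 < t ->
  (\int[P]_w (Y w * expR (t * Y w))%:E <= r%:E)%E ->
  (\int[P]_w (expR (t * Y w))%:E <= (expR (t * r))%:E)%E.
Proof.
move=> mY Y0 t0 h.
have mE : measurable_fun setT (fun w => expR (t * Y w)).
  by apply: measurableT_comp => //; exact: measurable_funM.
have mYE : measurable_fun setT (fun w => Y w * expR (t * Y w)) by exact: measurable_funM.
have YE0 w : 0 <= Y w * expR (t * Y w) by rewrite mulr_ge0 ?expR_ge0.
apply: (@le_trans _ _ (1 + 0 + t * r)%:E); last first.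
  by rewrite addr0 lee_fin expR_ge1Dx.
apply: (@signed_integral_le _ (cst 0) (fun w => t * (Y w * expR (t * Y w)))) => //.
- exact: measurable_funM.
- by move=> w; rewrite mulr_ge0 // ltW.
- exact: finite_measure_integrable_cst.
- by rewrite integral0.
- rewrite ge0_integral_scale ?(ltW t0) // EFinM.
  by apply: lee_wpmul2l; first by rewrite lee_fin ltW.
by move=> w; rewrite /= addr0 mulrA; exact: expR_le_1xexpR.
Qed.

Lemma integrable_of_square Y (c r : R) : measurable_fun setT Y -> 0 <= c ->
  (\int[P]_w (Y w ^+ 2 * expR (c * `|Y w|))%:E <= r%:E)%E ->
  P.-integrable setT (EFin \o Y).
Proof.
move=> mY c0 h; apply/integrableP; split; first exact/measurable_EFinP.
have mE : measurable_fun setT (fun w => Y w ^+ 2 * expR (c * `|Y w|)).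
  apply: measurable_funM; first exact: measurable_funX.
  by apply: measurableT_comp => //; apply: measurable_funM => //; exact: measurableT_comp.
apply: (@le_lt_trans _ _ (1 + 0 + r)%:E); last exact: ltry.
apply: (@signed_integral_le (fun w => `|Y w|) (cst 0) (fun w => Y w ^+ 2 * expR (c * `|Y w|))) => //.
- exact: measurableT_comp.
- by move=> w; rewrite mulr_ge0 ?sqr_ge0 ?expR_ge0.
- exact: finite_measure_integrable_cst.
- by rewrite integral0.
move=> w; rewrite /= addr0 -[Y w ^+ 2]real_normK ?num_real //.
have e1 : 1 <= expR (c * `|Y w|) by rewrite -expR0 ler_expR mulr_ge0.
have h1 := ler_wpM2l (sqr_ge0 `|Y w|) e1.
by have := sqr_ge0 (`|Y w| - 1); have := normr_ge0 (Y w); lra.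
Qed.

Lemma exp_moment_signed Y (t c y r : R) : measurable_fun setT Y -> 0 < t <= c ->
  (\int[P]_w (Y w)%:E = y%:E)%E ->
  (\int[P]_w (Y w ^+ 2 * expR (c * `|Y w|))%:E <= r%:E)%E ->
  (\int[P]_w (expR (t * Y w))%:E <= (expR (t * y + t ^+ 2 * r))%:E)%E.
Proof.
move=> mY /andP[t0 tc] Yy h; have c0 : 0 <= c by apply: le_trans tc; exact: ltW.
have intY := integrable_of_square mY c0 h.
have mE : measurable_fun setT (fun w => Y w ^+ 2 * expR (c * `|Y w|)).
  apply: measurable_funM; first exact: measurable_funX.
  by apply: measurableT_comp => //; apply: measurable_funM => //; exact: measurableT_comp.
apply: (@le_trans _ _ (1 + t * y + t ^+ 2 * r)%:E); last first.
  by rewrite lee_fin -addrA expR_ge1Dx.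
apply: (@signed_integral_le _ (fun w => t * Y w) (fun w => t ^+ 2 * (Y w ^+ 2 * expR (c * `|Y w|)))).
- by apply: measurableT_comp => //; exact: measurable_funM.
- exact: measurable_funM.
- by move=> w; exact: expR_ge0.
- by move=> w; rewrite mulr_ge0 ?sqr_ge0 // mulr_ge0 ?sqr_ge0 ?expR_ge0.
- exact: (integrableZl measurableT t intY).
- by rewrite (integralZl measurableT intY t) Yy.
- rewrite ge0_integral_scale; [|exact: mE|exact: sqr_ge0|
    by move=> w; rewrite mulr_ge0 ?sqr_ge0 ?expR_ge0].
  by rewrite [(t ^+ 2 * r)%:E]EFinM; apply: lee_wpmul2l => //; rewrite lee_fin sqr_ge0.
move=> w; apply: le_trans (expR_le_quadratic _) _; rewrite lerD2l exprMn -mulrA.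
rewrite ler_wpM2l ?sqr_ge0 // ler_wpM2l ?sqr_ge0 // ler_expR normrM (gtr0_norm t0).
by rewrite ler_wpM2r.
Qed.

End moment_generating_functions.

Section pointwise_domination.
Context (R : realType) (c : R).
Hypothesis c0 : 0 < c.
Implicit Types V U W : R.

Lemma expR_square_mono V x : 0 <= x -> expR (c * V ^+ 2) <= expR (c * (V ^+ 2 + x)).
Proof. by move=> x0; rewrite ler_expR ler_pM2l // lerDl. Qed.

Lemma expR_norm_le_square V : expR (2 * `|V|) <= expR (2 / c) * expR (c * V ^+ 2).
Proof.
apply: le_trans (expR_norm_le V c0) _; rewrite ler_wpM2l ?expR_ge0 // ler_expR.
by rewrite ler_wpM2r ?sqr_ge0 // ler_pdivrMr //; have := c0; lra.
Qed.

Lemma norm_domination V : `|V| <= expR (2 / c) * expR (c * V ^+ 2).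
Proof.
apply: le_trans (expR_norm_le_square V); apply: le_trans (le_expR _) _.
by rewrite ler_expR; have := normr_ge0 V; lra.
Qed.

Lemma square_exp_domination V :
  V ^+ 2 * expR (2 * `|V|) <= 2 / c * expR (2 / c) * expR (c * V ^+ 2).
Proof.
have c2 : 0 < c / 2 by rewrite divr_gt0.
have h1 := le_scaled_expR (V ^+ 2) c2; have h2 := expR_norm_le V c0.
apply: le_trans (ler_pM (sqr_ge0 V) (expR_ge0 _) h1 h2) _.
rewrite invf_div mulrACA -expRD le_eqVlt; apply/orP; left; apply/eqP.
by congr (_ * expR _); field.
Qed.

Lemma expR_product_le V U : expR (2 * (c * `|V * U|)) <= expR (c * (V ^+ 2 + U ^+ 2)).
Proof.
rewrite ler_expR mulrCA ler_pM2l // normrM.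
have := sqr_ge0 (`|V| - `|U|); rewrite -[V ^+ 2]real_normK ?num_real //.
by rewrite -[U ^+ 2]real_normK ?num_real //; lra.
Qed.

Lemma product_exp_domination V U :
  `|V * U| * expR (c * `|V * U|) <= c^-1 * expR (c * (V ^+ 2 + U ^+ 2)).
Proof.
have h1 := le_scaled_expR `|V * U| c0.
apply: le_trans (ler_wpM2r (expR_ge0 _) h1) _.
rewrite -[leLHS]mulrA -expRD -mulr2n -mulr_natl ler_wpM2l ?invr_ge0 ?(ltW c0) //.
exact: expR_product_le.
Qed.

Lemma product_square_domination V U :
  (V * U) ^+ 2 * expR (c * `|V * U|) <= 4 / c ^+ 2 * expR (c * (V ^+ 2 + U ^+ 2)).
Proof.
have h1 := sqr_le_scaled_expR c0 (normr_ge0 (V * U)).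
rewrite real_normK ?num_real // in h1.
apply: le_trans (ler_wpM2r (expR_ge0 _) h1) _.
rewrite -[leLHS]mulrA -expRD; apply: ler_wpM2l; first by rewrite divr_ge0 // sqr_ge0.
by rewrite -mulr2n -[_ *+ 2]mulr_natl; exact: expR_product_le.
Qed.

Lemma triple_domination V U W :
  `|V * U| * expR (c * `|V * U|) * W ^+ 2 <=
  c^-1 ^+ 2 * expR (c * (V ^+ 2 + U ^+ 2 + W ^+ 2)).
Proof.
have h1 := product_exp_domination V U; have h2 := le_scaled_expR (W ^+ 2) c0.
apply: le_trans (ler_pM _ (sqr_ge0 _) h1 h2) _; first by rewrite mulr_ge0 ?expR_ge0.
by rewrite mulrACA -expRD -mulrDr expr2.
Qed.

End pointwise_domination.

Section covariate_noise_bounds.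
Context d (T : measurableType d) (R : realType) (P : probability T R) (p : nat).
Context (X : {RV P >-> p.-tuple R}) (eps : {RV P >-> R}) (m : nat) (q Ceps csub L : R).
Hypotheses (csub0 : 0 < csub) (L0 : 0 < L) (q1 : 1 < q).
Hypotheses (sg : subgaussian csub X) (m23 : m = 2%N \/ m = 3%N).
Hypothesis moment : cond_moment_bound m q Ceps X eps.
Implicit Types (u v w : 'rV[R]_p).
Let c := moment_rate q csub L.
Let K := moment_scale q csub L.
Let C := moment_bound q Ceps csub L.
Let c0 : 0 < c. Proof. exact: moment_rate_gt0. Qed.

Let env0 r a b e (x : p.-tuple R) : 0 <= gaussian_envelope r a b e x.
Proof. exact: expR_ge0. Qed.

Let envelope_le (k1 : R) v u w x (y : R) : k1 <= K ->
  y <= k1 * expR (c * (dot x v ^+ 2 + dot x u ^+ 2)) ->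
  0 <= k1 -> y <= K * gaussian_envelope c v u w x.
Proof.
move=> k1K yk k10; apply: (le_trans yk).
apply: ler_pM => //.
by rewrite /gaussian_envelope ler_expR ler_pM2l // lerDl sqr_ge0.
Qed.

Lemma measurable_expR_norm (s : R) (f : p.-tuple R -> R) : measurable_fun setT f ->
  measurable_fun setT (fun x => expR (s * `|f x|)).
Proof.
move=> mf; apply: measurableT_comp => //; apply: measurable_funM => //.
exact: measurableT_comp.
Qed.

Lemma measurable_dot2 u v : measurable_fun setT (fun x : p.-tuple R => dot x v * dot x u).
Proof. by apply: measurable_funM; exact: measurable_dot. Qed.

Lemma noise_square_moment v : l2norm v <= L ->
  (\int[P]_w (eps w ^+ 2 * (dot (X w) v ^+ 2 * expR (2 * `|dot (X w) v|)))%:E <= C%:E)%E.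
Proof.
move=> vL; pose G x := dot x v ^+ 2 * expR (2 * `|dot x v|).
have [_ _ _ _ K5] := moment_scale_ge q1 csub0 L0.
apply: (@dominated_noise_moment _ _ _ _ _ X eps m q Ceps csub L csub0 L0 q1 sg m23 moment v v v G) => //.
- apply: measurable_funM; first by apply: measurable_funX; exact: measurable_dot.
  by apply: measurable_expR_norm; exact: measurable_dot.
- by move=> x; rewrite mulr_ge0 ?sqr_ge0 ?expR_ge0.
move=> x; have c2 : 0 <= 2 / c by rewrite divr_ge0 // ltW.
apply: (envelope_le (k1 := 2 / c * expR (2 / c))).
- by apply: le_trans K5; rewrite -/c [leRHS]mulrDl mul1r lerDl expR_ge0.
- apply: le_trans (square_exp_domination c0 _) _.
  apply: ler_wpM2l; first by rewrite mulr_ge0 // expR_ge0.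
  exact: (expR_square_mono c0 _ (sqr_ge0 _)).
by rewrite mulr_ge0 // expR_ge0.
Qed.

Lemma noise_abs_moment v : l2norm v <= L ->
  (\int[P]_w (eps w ^+ 2 * `|dot (X w) v|)%:E <= C%:E)%E.
Proof.
move=> vL.
have [_ _ _ _ K5] := moment_scale_ge q1 csub0 L0.
apply: (@dominated_noise_moment _ _ _ _ _ X eps m q Ceps csub L csub0 L0 q1 sg m23 moment v v v
  (fun x => `|dot x v|)) => //.
- by apply: measurableT_comp => //; exact: measurable_dot.
move=> x; have c2 : 0 <= 2 / c by rewrite divr_ge0 // ltW.
apply: (envelope_le (k1 := expR (2 / c))); last exact: expR_ge0.
- by apply: le_trans K5; rewrite -/c [leRHS]mulrDl mul1r lerDr mulr_ge0 ?expR_ge0.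
apply: le_trans (norm_domination c0 _) _.
apply: ler_wpM2l; first exact: expR_ge0.
exact: (expR_square_mono c0 _ (sqr_ge0 _)).
Qed.

Lemma noise_product_moment v u : l2norm v <= L -> l2norm u <= L ->
  (\int[P]_w (eps w ^+ 2 * (`|dot (X w) v * dot (X w) u| *
     expR (c * `|dot (X w) v * dot (X w) u|)))%:E <= C%:E)%E.
Proof.
move=> vL uL.
have [_ _ K3 _ _] := moment_scale_ge q1 csub0 L0.
apply: (@dominated_noise_moment _ _ _ _ _ X eps m q Ceps csub L csub0 L0 q1 sg m23 moment v u u
  (fun x => `|dot x v * dot x u| * expR (c * `|dot x v * dot x u|))) => //.
- apply: measurable_funM; last by apply: measurable_expR_norm; exact: measurable_dot2.
  by apply: measurableT_comp => //; exact: measurable_dot2.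
move=> x; apply: (envelope_le (k1 := c^-1)) => //; last by rewrite invr_ge0 ltW.
exact: product_exp_domination.
Qed.

Lemma product_square_moment v u : l2norm v <= L -> l2norm u <= L ->
  (\int[P]_w ((dot (X w) v * dot (X w) u) ^+ 2 *
     expR (c * `|dot (X w) v * dot (X w) u|))%:E <= C%:E)%E.
Proof.
move=> vL uL.
have [_ K2 _ _ _] := moment_scale_ge q1 csub0 L0.
apply: (@dominated_moment _ _ _ _ _ X q Ceps csub L csub0 L0 q1 sg v u u
  (fun x => (dot x v * dot x u) ^+ 2 * expR (c * `|dot x v * dot x u|))) => //.
- apply: measurable_funM; last by apply: measurable_expR_norm; exact: measurable_dot2.
  by apply: measurable_funX; exact: measurable_dot2.
- by move=> x; rewrite mulr_ge0 ?sqr_ge0 ?expR_ge0.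
move=> x; apply: (envelope_le (k1 := 4 / c ^+ 2)) => //; last by rewrite divr_ge0 ?sqr_ge0.
exact: product_square_domination.
Qed.

Lemma triple_moment v u w0 : l2norm v <= L -> l2norm u <= L -> l2norm w0 <= L ->
  (\int[P]_w (`|dot (X w) v * dot (X w) u| *
     expR (c * `|dot (X w) v * dot (X w) u|) * dot (X w) w0 ^+ 2)%:E <= C%:E)%E.
Proof.
move=> vL uL wL.
have [_ _ _ K4 _] := moment_scale_ge q1 csub0 L0.
apply: (@dominated_moment _ _ _ _ _ X q Ceps csub L csub0 L0 q1 sg v u w0
  (fun x => `|dot x v * dot x u| * expR (c * `|dot x v * dot x u|) * dot x w0 ^+ 2)) => //.
- apply: measurable_funM; last by apply: measurable_funX; exact: measurable_dot.
  apply: measurable_funM; last by apply: measurable_expR_norm; exact: measurable_dot2.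
  by apply: measurableT_comp => //; exact: measurable_dot2.
- by move=> x; rewrite mulr_ge0 ?sqr_ge0 // mulr_ge0 ?expR_ge0.
move=> x; apply: le_trans (triple_domination c0 _ _ _) _.
by rewrite ler_wpM2r ?env0.
Qed.

End covariate_noise_bounds.

Section exponential_moments.
Context d (T : measurableType d) (R : realType) (P : probability T R) (p : nat).
Context (X : {RV P >-> p.-tuple R}) (eps : {RV P >-> R}) (m : nat) (q Ceps csub L : R).
Hypotheses (csub0 : 0 < csub) (L1 : 1 <= L) (q1 : 1 < q).
Hypotheses (sg : subgaussian csub X) (m23 : m = 2%N \/ m = 3%N).
Hypothesis moment : cond_moment_bound m q Ceps X eps.
Hypothesis centered : is_cond_expectation P X eps (cst 0).
Implicit Types (u v : 'rV[R]_p).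
Let c := moment_rate q csub L.
Let C := moment_bound q Ceps csub L.
Let L0 : 0 < L. Proof. exact: lt_le_trans L1. Qed.
Let c0 : 0 < c. Proof. exact: moment_rate_gt0. Qed.
Let C0 : 0 < C. Proof. exact: moment_bound_gt0. Qed.

Let meps : measurable_fun setT eps. Proof. exact: measurable_funPT. Qed.

Let mdot v : measurable_fun setT (fun w => dot (X w) v).
Proof. exact: measurable_dot_RV. Qed.

Lemma measurable_huber_score (t : R) : measurable_fun setT (huber_score t).
Proof.
apply: continuous_measurable_fun => x.
apply: (@continuousM R R (fun y => 2 * y) (fun y => (huber_root t y)^-1)).
  by apply: (@continuousM R R (fun=> 2) id); [exact: cst_continuous|exact: cvg_id].
apply: (@continuousV R R (huber_root t)).
  by rewrite gt_eqF // (lt_le_trans ltr01) // huber_root_ge1.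
apply: (@continuous_comp R R R (fun y => 1 + t ^+ 2 * y ^+ 2) (@Num.sqrt R));
  last exact: sqrt_continuous.
apply: (@continuousD R R R (fun=> 1) (fun y => t ^+ 2 * y ^+ 2)); first exact: cst_continuous.
apply: (@continuousM R R (fun=> t ^+ 2) (fun y => y ^+ 2)); first exact: cst_continuous.
exact: exprn_continuous.
Qed.

Lemma noise_dot_integrable v : l2norm v <= L ->
  P.-integrable setT (EFin \o (fun w => eps w * dot (X w) v)).
Proof.
move=> vL; apply: (@integrable_of_square _ _ _ _ _ 0 C) => //; first exact: measurable_funM.
apply: le_trans (noise_square_moment csub0 L0 q1 sg m23 moment vL).
have msq : measurable_fun setT (fun w => dot (X w) v ^+ 2) by exact: measurable_funX.
apply: ge0_integral_le.
- apply: measurable_funM; first by apply: measurable_funX; exact: measurable_funM.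
  apply: measurableT_comp => //; apply: measurable_funM => //.
  by apply: measurableT_comp => //; exact: measurable_funM.
- apply: measurable_funM; first exact: measurable_funX.
  apply: measurable_funM => //; apply: measurableT_comp => //.
  by apply: measurable_funM => //; exact: measurableT_comp.
- by move=> w; rewrite mulr_ge0 ?sqr_ge0 ?expR_ge0.
move=> w; rewrite mul0r expR0 mulr1 exprMn ler_wpM2l ?sqr_ge0 //.
by rewrite ler_peMr ?sqr_ge0 // -expR0 ler_expR mulr_ge0.
Qed.

(** The clipping level [1 / t] of the score matches the parameter [t] of the
    exponential moment: then [t * huber_score t] is bounded, while the bias of
    the score is of the order of [t]. *)
Lemma huber_noise_mgf v (t : R) : l2norm v <= L -> 0 < t ->
  (\int[P]_w (expR (t * (huber_score t (eps w) * dot (X w) v)))%:E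
     <= (expR (t ^+ 2 * (6 * C)))%:E)%E.
Proof.
move=> vL t0.
have mpsi : measurable_fun setT (fun w => huber_score t (eps w)).
  exact: (measurableT_comp (measurable_huber_score t)).
have mabs : measurable_fun setT (fun w => `|dot (X w) v|) by exact: measurableT_comp.
have mZ1 : measurable_fun setT (fun w => eps w ^+ 2 * `|dot (X w) v|).
  by apply: measurable_funM => //; exact: measurable_funX.
have mZ2 : measurable_fun setT
    (fun w => eps w ^+ 2 * (dot (X w) v ^+ 2 * expR (2 * `|dot (X w) v|))).
  apply: measurable_funM; first exact: measurable_funX.
  apply: measurable_funM; first exact: measurable_funX.
  by apply: measurableT_comp => //; exact: measurable_funM.
pose Z w := 2 * t ^+ 2 * (eps w ^+ 2 * `|dot (X w) v|) +
  4 * t ^+ 2 * (eps w ^+ 2 * (dot (X w) v ^+ 2 * expR (2 * `|dot (X w) v|))).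
have Z10 w : 0 <= eps w ^+ 2 * `|dot (X w) v| by rewrite mulr_ge0 ?sqr_ge0.
have Z20 w : 0 <= eps w ^+ 2 * (dot (X w) v ^+ 2 * expR (2 * `|dot (X w) v|)).
  by rewrite mulr_ge0 ?sqr_ge0 // mulr_ge0 ?sqr_ge0 ?expR_ge0.
have k1 : 0 <= 2 * t ^+ 2 by rewrite mulr_ge0 ?sqr_ge0.
have k2 : 0 <= 4 * t ^+ 2 by rewrite mulr_ge0 ?sqr_ge0.
apply: (@le_trans _ _ (1 + 2 * t * 0 + (2 * t ^+ 2 * C + 4 * t ^+ 2 * C))%:E); last first.
  rewrite lee_fin mulr0 addr0 (_ : _ + _ * C = t ^+ 2 * (6 * C)); last by ring.
  exact: expR_ge1Dx.
have inteps := noise_dot_integrable vL.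
apply: (@signed_integral_le _ _ _ _ _ (fun w => 2 * t * (eps w * dot (X w) v)) Z).
- by apply: measurableT_comp => //; apply: measurable_funM => //; exact: measurable_funM.
- by apply: measurable_funD; exact: measurable_funM.
- by move=> w; exact: expR_ge0.
- by move=> w; rewrite addr_ge0 // mulr_ge0.
- exact: (integrableZl measurableT (2 * t) inteps).
- rewrite (integralZl measurableT inteps (2 * t)).
  have := @cond_mean_zero _ _ _ _ _ X eps (fun x => dot x v) centered (measurable_dot v) inteps.
  by move=> ->; rewrite mule0 mulr0.
- rewrite ge0_integral_add; [|exact: measurable_funM|exact: measurable_funM|
    by move=> w; rewrite mulr_ge0|by move=> w; rewrite mulr_ge0].
  rewrite !ge0_integral_scale //; rewrite EFinD; apply: leeD.
    rewrite [(2 * t ^+ 2 * C)%:E]EFinM; apply: lee_wpmul2l; first by rewrite lee_fin.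
    exact: (noise_abs_moment csub0 L0 q1 sg m23 moment vL).
  rewrite [(4 * t ^+ 2 * C)%:E]EFinM; apply: lee_wpmul2l; first by rewrite lee_fin.
  exact: (noise_square_moment csub0 L0 q1 sg m23 moment vL).
move=> w; set e := eps w; set V := dot (X w) v.
apply: le_trans (expR_le_quadratic _) _; rewrite -addrA -[leRHS]addrA lerD2l.
have hb := huber_score_bias e t0; have hs := huber_score_le t e; have hc := huber_score_bound e t0.
set s := huber_score t e in hb hs hc *.
have h1 : t * (s * V) <= 2 * t * (e * V) + 2 * t ^+ 2 * (e ^+ 2 * `|V|).
  have -> : t * (s * V) = 2 * t * (e * V) + t * ((s - 2 * e) * V) by ring.
  rewrite lerD2l (_ : 2 * t ^+ 2 * _ = t * (2 * t * e ^+ 2 * `|V|)); last by ring.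
  rewrite ler_pM2l //; apply: le_trans (ler_norm _) _; rewrite normrM.
  by rewrite ler_wpM2r.
have h2 : (t * (s * V)) ^+ 2 * expR `|t * (s * V)| <=
    4 * t ^+ 2 * (e ^+ 2 * (V ^+ 2 * expR (2 * `|V|))).
  have -> : 4 * t ^+ 2 * (e ^+ 2 * (V ^+ 2 * expR (2 * `|V|))) =
    (t ^+ 2 * V ^+ 2 * (4 * e ^+ 2)) * expR (2 * `|V|) by ring.
  apply: ler_pM; [exact: sqr_ge0|exact: expR_ge0| |].
    have -> : (t * (s * V)) ^+ 2 = t ^+ 2 * V ^+ 2 * s ^+ 2 by ring.
    apply: ler_wpM2l; first by apply: mulr_ge0; exact: sqr_ge0.
    have -> : 4 * e ^+ 2 = (2 * `|e|) ^+ 2.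
      by rewrite exprMn real_normK ?num_real //; ring.
    by rewrite -[s ^+ 2]real_normK ?num_real // ler_sqr ?nnegrE ?mulr_ge0.
  rewrite ler_expR mulrA normrM ler_wpM2r // normrM (gtr0_norm t0) //.
by rewrite /Z -/e -/V; lra.
Qed.

(** The parameter of the exponential is a constant here, so the truncated square
    enters the exponent with its full order [t ^ 2]; a parameter of order [t] would
    only give averages of order [t]. *)
Lemma truncated_product_mgf u v (xi : T -> R) (t : R) : measurable_fun setT xi ->
  (\int[P]_w (`|dot (X w) v * dot (X w) u| *
     expR (c * `|dot (X w) v * dot (X w) u|) * xi w ^+ 2)%:E <= C%:E)%E ->
  (\int[P]_w (expR (c * (`|dot (X w) v| * `|dot (X w) u| *
     Num.min 1 (t ^+ 2 * xi w ^+ 2))))%:E <= (expR (c * (t ^+ 2 * C)))%:E)%E.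
Proof.
move=> mxi h.
have mprod : measurable_fun setT (fun w => `|dot (X w) v * dot (X w) u|).
  by apply: measurableT_comp => //; exact: measurable_funM.
have mexp : measurable_fun setT (fun w => expR (c * `|dot (X w) v * dot (X w) u|)).
  by apply: measurableT_comp => //; exact: measurable_funM.
have mmin : measurable_fun setT (fun w => Num.min 1 (t ^+ 2 * xi w ^+ 2)).
  by apply: measurable_minr => //; apply: measurable_funM => //; exact: measurable_funX.
have min0 w : 0 <= Num.min 1 (t ^+ 2 * xi w ^+ 2).
  by rewrite le_min ler01 mulr_ge0 ?sqr_ge0.
pose Y w := `|dot (X w) v * dot (X w) u| * Num.min 1 (t ^+ 2 * xi w ^+ 2).
have mY : measurable_fun setT Y by exact: measurable_funM.
have -> : (\int[P]_w (expR (c * (`|dot (X w) v| * `|dot (X w) u| *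
     Num.min 1 (t ^+ 2 * xi w ^+ 2))))%:E = \int[P]_w (expR (c * Y w))%:E)%E.
  by apply: eq_integral => w _; rewrite /Y normrM.
apply: exp_moment_nonneg => //; first by move=> w; rewrite mulr_ge0.
apply: (@le_trans _ _ (\int[P]_w (t ^+ 2 * (`|dot (X w) v * dot (X w) u| *
     expR (c * `|dot (X w) v * dot (X w) u|) * xi w ^+ 2))%:E)%E).
  apply: ge0_integral_le.
  - apply: measurable_funM => //.
    by apply: measurableT_comp => //; exact: measurable_funM.
  - apply: measurable_funM => //; apply: measurable_funM; last exact: measurable_funX.
    exact: measurable_funM.
  - by move=> w; rewrite !mulr_ge0 ?expR_ge0.
  move=> w; rewrite /Y; set a := `|_ * _|; have a0 : 0 <= a by exact: normr_ge0.
  have -> : t ^+ 2 * (a * expR (c * a) * xi w ^+ 2) = a * (t ^+ 2 * xi w ^+ 2) * expR (c * a).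
    by ring.
  apply: ler_pM; rewrite ?expR_ge0 ?mulr_ge0 //.
    by rewrite ler_wpM2l // ge_min lexx orbT.
  by rewrite ler_expR ler_pM2l // ler_piMr // ge_min lexx.
rewrite ge0_integral_scale; [| |exact: sqr_ge0|]; last first.
- by move=> w; rewrite mulr_ge0 ?sqr_ge0 // mulr_ge0 ?expR_ge0.
- apply: measurable_funM; last exact: measurable_funX.
  exact: measurable_funM.
by rewrite [(t ^+ 2 * C)%:E]EFinM; apply: lee_wpmul2l => //; rewrite lee_fin sqr_ge0.
Qed.

Lemma coordinate_products_integrable k j :
  P.-integrable setT (EFin \o (fun w => tnth (X w) k * tnth (X w) j)).
Proof.
have := @product_square_moment _ _ _ _ _ X q Ceps csub L csub0 L0 q1 sg
  (delta_mx 0 k) (delta_mx 0 j).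
rewrite !l2norm_delta => /(_ L1 L1) h.
have -> : (fun w => tnth (X w) k * tnth (X w) j) =
    (fun w => dot (X w) (delta_mx 0 k) * dot (X w) (delta_mx 0 j)).
  by apply/funext => w; rewrite !dot_delta.
by apply: (integrable_of_square _ (ltW c0) h); exact: measurable_funM.
Qed.

Lemma second_momentE k j :
  (\int[P]_w (tnth (X w) k * tnth (X w) j)%:E = (second_moment X k j)%:E)%E.
Proof.
rewrite mxE unlock fineK //.
exact: (integrable_fin_num measurableT (coordinate_products_integrable k j)).
Qed.

Lemma covariance_integral v j :
  (\int[P]_w (dot (X w) v * tnth (X w) j)%:E = ((v *m second_moment X) 0 j)%:E)%E.
Proof.
have ik k : P.-integrable setT (EFin \o (fun w => v 0 k * (tnth (X w) k * tnth (X w) j))).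
  exact: (integrableZl measurableT (v 0 k) (coordinate_products_integrable k j)).
transitivity (\int[P]_w (\sum_(k < p) (v 0 k * (tnth (X w) k * tnth (X w) j))%:E))%E.
  apply: eq_integral => w _; rewrite sumEFin /dot mulr_suml; congr EFin.
  by apply: eq_bigr => k _; rewrite mulrCA mulrA.
rewrite (integral_sum measurableT ik).
rewrite mxE -sumEFin; apply: eq_bigr => k _.
rewrite (integralZl measurableT (coordinate_products_integrable k j) (v 0 k)).
by rewrite second_momentE EFinM.
Qed.

Lemma product_mgf v j (t : R) : l2norm v <= L -> 0 < t <= c ->
  (\int[P]_w (expR (t * (dot (X w) v * tnth (X w) j)))%:E <=
     (expR (t * (v *m second_moment X) 0 j + t ^+ 2 * C))%:E)%E.
Proof.
move=> vL tc; apply: (@exp_moment_signed _ _ _ _ _ _ c) => //.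
- apply: measurable_funM => //.
  by have := mdot (delta_mx 0 j); under eq_fun do rewrite dot_delta.
- exact: covariance_integral.
have := @product_square_moment _ _ _ _ _ X q Ceps csub L csub0 L0 q1 sg
  v (delta_mx 0 j) vL; rewrite l2norm_delta => /(_ L1).
by under eq_integral do rewrite dot_delta.
Qed.

Lemma second_moment_sym : (second_moment X)^T = second_moment X.
Proof.
apply/matrixP => k j; rewrite !mxE; congr (fine 'E_P[_]%E).
by apply/funext => w; rewrite mulrC.
Qed.

(** The radius [1] instead of [L], since [L] is chosen from this bound. *)
Lemma second_moment_diag_le k :
  second_moment X k k <= 4 * csub ^+ 2 * exp_square_bound R.
Proof.
rewrite -lee_fin -second_momentE.
have k0 : 0 < (4 * csub ^+ 2 * 1 ^+ 2)^-1.
  by rewrite invr_gt0 !mulr_gt0 // exprn_gt0.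
have h := @subgaussian_exp_square _ _ _ _ _ X csub 1 csub0 ltr01 sg (delta_mx 0 k).
rewrite l2norm_delta in h; have {h} := h (lexx _).
have mE : measurable_fun setT (fun w => expR ((4 * csub ^+ 2 * 1 ^+ 2)^-1 * dot (X w) (delta_mx 0 k) ^+ 2)).
  apply: measurableT_comp => //; apply: measurable_funM => //; exact: measurable_funX.
have c4 : 0 <= 4 * csub ^+ 2 by rewrite mulr_ge0 ?sqr_ge0.
move=> h; apply: (@le_trans _ _ (\int[P]_w (4 * csub ^+ 2 *
  expR ((4 * csub ^+ 2 * 1 ^+ 2)^-1 * dot (X w) (delta_mx 0 k) ^+ 2))%:E)%E).
  apply: ge0_integral_le.
  - by have := mdot (delta_mx 0 k) => mk; under eq_fun do rewrite -dot_delta; exact: measurable_funM.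
  - exact: measurable_funM.
  - by move=> w; rewrite -expr2 sqr_ge0.
  move=> w; rewrite dot_delta -expr2; apply: le_trans (le_scaled_expR _ k0) _.
  by rewrite invrK expr1n mulr1.
rewrite ge0_integral_scale //.
by rewrite [(_ * exp_square_bound R)%:E]EFinM; apply: lee_wpmul2l.
Qed.

End exponential_moments.

(** * Simultaneous concentration *)
Section union_bound.
Context d (T : measurableType d) (R : realType) (P : probability T R).

Lemma union_bound (I : finType) (B : I -> set T) (b : R) :
  (forall i, measurable (B i)) -> (forall i, (P (B i) <= b%:E)%E) ->
  measurable [set w | exists i, B i w] /\
  (P [set w | exists i, B i w] <= (#|I|%:R * b)%:E)%E.
Proof.
move=> mB Bb.
have h (s : seq I) : measurable (\big[setU/set0]_(i <- s) B i) /\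
    (P (\big[setU/set0]_(i <- s) B i) <= ((size s)%:R * b)%:E)%E.
  elim: s => [|i s [ms IH]]; first by rewrite big_nil measure0 mul0r.
  rewrite big_cons; split; first exact: measurableU.
  apply: le_trans (measureU2 _ (mB i) ms) _.
  by rewrite /= -natr1 mulrDl mul1r addrC EFinD; exact: leeD.
have -> : [set w | exists i, B i w] = \big[setU/set0]_(i <- enum I) B i.
  rewrite -bigcup_seq; apply/seteqP; split => w /= [i]; last by exists i.
  by exists i => //=; rewrite mem_enum.
by have := h (enum I); rewrite cardE.
Qed.

End union_bound.

Lemma rate_sqr (R : realType) (n p : nat) : (0 < n)%N -> (0 < p)%N ->
  n%:R * rate n p ^+ 2 = ln p%:R :> R.
Proof.
move=> n0 p0; rewrite /rate sqr_sqrtr; last first.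
  by rewrite divr_ge0 ?ler0n // ln_ge0 // ler1n.
by rewrite mulrCA divff ?mulr1 // pnatr_eq0 -lt0n.
Qed.

Lemma expR_ln_pow (R : realType) (k p : nat) : (0 < p)%N ->
  expR (- (k%:R * ln p%:R)) = p%:R ^- k :> R.
Proof. by move=> p0; rewrite expRN expRM_natl lnK // posrE ltr0n. Qed.

Section concentration.
Context d (T : measurableType d) (R : realType) (P : probability T R) (n p : nat).
Context (X : 'I_n -> {RV P >-> p.-tuple R}) (eps : 'I_n -> {RV P >-> R}).
Context (m : nat) (q Ceps csub L : R) (n0 : (0 < n)%N) (p0 : (0 < p)%N).
Let j1 := Ordinal n0.
Hypotheses (csub0 : 0 < csub) (L1 : 1 <= L) (q1 : 1 < q).
Hypothesis model : regression_model X eps.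
Hypotheses (sg : subgaussian csub (X j1)) (m23 : m = 2%N \/ m = 3%N).
Hypothesis moment : cond_moment_bound m q Ceps (X j1) (eps j1).
Context (v : 'I_p -> 'rV[R]_p).
Hypothesis vL : forall k, l2norm (v k) <= L.
Let c := moment_rate q csub L.
Let C := moment_bound q Ceps csub L.
Let t : R := rate n p.
Hypotheses (t0 : 0 < t) (tc : t <= c).
Let L0 : 0 < L. Proof. exact: lt_le_trans L1. Qed.
Let c0 : 0 < c. Proof. exact: moment_rate_gt0. Qed.
Let Sigma := second_moment (X j1).

Let Z j w := (X j w, eps j w).
Let mZ j : measurable_fun setT (Z j).
Proof. by apply: measurable_fun_pair; exact: measurable_funPT. Qed.

(** Every deviation below comes with probability [p ^- 5], small enough for a
    union bound over triples of coordinates. *)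
Lemma deviation_probability (h : p.-tuple R * R -> R) (s b x : R) :
  measurable_fun setT h -> 0 < s ->
  (\int[P]_w (expR (s * h (Z j1 w)))%:E <= (expR b)%:E)%E ->
  b - s * x = - (5 * t ^+ 2) ->
  measurable [set w | x < average (fun i => h (Z i w))] /\
  (P [set w | (x < average (fun i => h (Z i w)))%R] <= (p%:R ^- 5)%:E)%E.
Proof.
move=> mh s0 hb bx.
have nr0 : 0 < n%:R :> R by rewrite ltr0n.
have -> : [set w | (x < average (fun i => h (Z i w)))%R] =
    [set w | (n%:R * x < \sum_(i < n) h (Z i w))%R].
  by apply/seteqP; split => w /=; rewrite /average ltr_pdivlMl.
case: model => indep ident _; split.
  apply: measurable_gt_set; apply: measurable_sum => i.
  exact: measurableT_comp.
have ch := iid_chernoff mZ indep ident x mh s0 hb.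
apply: le_trans ch _.
by rewrite lee_fin bx mulrN mulrCA rate_sqr // (expR_ln_pow R 5).
Qed.

Let mfst (u : 'rV[R]_p) : measurable_fun setT (fun z : p.-tuple R * R => dot z.1 u).
Proof. exact: (measurableT_comp (measurable_dot u) measurable_fst). Qed.

Let mcoord (k : 'I_p) : measurable_fun setT (fun z : p.-tuple R * R => tnth z.1 k).
Proof. by have := mfst (delta_mx 0 k); under eq_fun do rewrite dot_delta. Qed.

Definition signed (b : bool) (u : 'rV[R]_p) : 'rV[R]_p := if b then u else - u.

Let signed_le b k : l2norm (signed b (v k)) <= L.
Proof. by rewrite /signed; case: b; rewrite ?l2normN. Qed.

Lemma signed_norm_le (f : 'rV[R]_p -> R) u x : f (- u) = - f u ->
  (forall b, f (signed b u) <= x) -> `|f u| <= x.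
Proof.
by move=> fN h; rewrite ler_norml lerNl -fN; apply/andP; split; [exact: (h false)|exact: (h true)].
Qed.

(** The four families feed [score_corr_linearization] and the noise bound. The two
    signs turn one-sided deviations into absolute values; there are
    [2 p + 2 p ^ 2 + p ^ 2 + p ^ 3] events, at most [6 p ^ 3]. *)
Lemma concentration : exists A, [/\ measurable A,
  ((1 - 6 / p%:R ^+ 2)%:E <= P A)%E & forall w, A w ->
  [/\ forall k, `|score_corr (fun j => X j w) (fun j => eps j w) t 0 (v k)| <= (6 * C + 5) * t,
     forall k j, `|average (fun i => dot (X i w) (v k) * tnth (X i w) j) - (v k *m Sigma) 0 j|
        <= (C + 5) * t,
     forall k j, average (fun i => `|dot (X i w) (v k)| * `|tnth (X i w) j| *
        Num.min 1 (t ^+ 2 * eps i w ^+ 2)) <= (C + 5 / c) * t ^+ 2 &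
     forall k j l, average (fun i => `|dot (X i w) (v k)| * `|tnth (X i w) j| *
        Num.min 1 (t ^+ 2 * tnth (X i w) l ^+ 2)) <= (C + 5 / c) * t ^+ 2]].
Proof.
case: (model) => _ _ cent; have centered := cent j1.
pose h1 (i : 'I_p * bool) (z : p.-tuple R * R) :=
  huber_score t z.2 * dot z.1 (signed i.2 (v i.1)).
pose B1 i := [set w | (6 * C + 5) * t < average (fun j => h1 i (Z j w))].
pose h2 (i : 'I_p * 'I_p * bool) (z : p.-tuple R * R) :=
  dot z.1 (signed i.2 (v i.1.1)) * tnth z.1 i.1.2.
pose B2 i := [set w | (signed i.2 (v i.1.1) *m Sigma) 0 i.1.2 + (C + 5) * t
   < average (fun j => h2 i (Z j w))].
pose h3 (i : 'I_p * 'I_p) (z : p.-tuple R * R) :=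
  `|dot z.1 (v i.1)| * `|tnth z.1 i.2| * Num.min 1 (t ^+ 2 * z.2 ^+ 2).
pose B3 i := [set w | (C + 5 / c) * t ^+ 2 < average (fun j => h3 i (Z j w))].
pose h4 (i : 'I_p * 'I_p * 'I_p) (z : p.-tuple R * R) :=
  `|dot z.1 (v i.1.1)| * `|tnth z.1 i.1.2| * Num.min 1 (t ^+ 2 * tnth z.1 i.2 ^+ 2).
pose B4 i := [set w | (C + 5 / c) * t ^+ 2 < average (fun j => h4 i (Z j w))].
have D1 i : measurable (B1 i) /\ (P (B1 i) <= (p%:R ^- 5)%:E)%E.
  apply: (deviation_probability (s := t) (b := t ^+ 2 * (6 * C))) => //.
  - apply: measurable_funM => //.
    exact: (measurableT_comp (measurable_huber_score t) measurable_snd).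
  - exact: (huber_noise_mgf csub0 L1 q1 sg m23 moment centered (signed_le i.2 i.1) t0).
  - by ring.
have D2 i : measurable (B2 i) /\ (P (B2 i) <= (p%:R ^- 5)%:E)%E.
  apply: (deviation_probability (s := t)
    (b := t * (signed i.2 (v i.1.1) *m Sigma) 0 i.1.2 + t ^+ 2 * C)) => //.
  - by apply: measurable_funM; [exact: mfst|exact: mcoord].
  - by apply: product_mgf => //; rewrite ?t0 //; exact: signed_le.
  - by ring.
have cn0 : c != 0 by rewrite gt_eqF.
have mmin (f : p.-tuple R * R -> R) : measurable_fun setT f ->
    measurable_fun setT (fun z => Num.min 1 (t ^+ 2 * f z ^+ 2)).
  by move=> mf; apply: measurable_minr => //; apply: measurable_funM => //; exact: measurable_funX.
have mabs k j : measurable_fun setT (fun z : p.-tuple R * R => `|dot z.1 (v k)| * `|tnth z.1 j|).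
  by apply: measurable_funM; exact: measurableT_comp.
have D3 i : measurable (B3 i) /\ (P (B3 i) <= (p%:R ^- 5)%:E)%E.
  apply: (deviation_probability (s := c) (b := c * (t ^+ 2 * C))) => //.
  - by apply: measurable_funM => //; apply: mmin; exact: measurable_snd.
  - have := @truncated_product_mgf _ _ _ P _ (X j1) q Ceps csub L csub0 L1 q1
      (delta_mx 0 i.2) (v i.1) (eps j1) t.
    under [X in _ -> _ -> (X <= _)%E]eq_integral do rewrite dot_delta.
    apply; first exact: measurable_funPT.
    have := @noise_product_moment _ _ _ P _ (X j1) (eps j1) m q Ceps csub L csub0 L0 q1 sg m23
      moment (v i.1) (delta_mx 0 i.2) (vL _); rewrite l2norm_delta => /(_ L1).
    by under eq_integral do rewrite mulrC.
  - by rewrite /C; field.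
have D4 i : measurable (B4 i) /\ (P (B4 i) <= (p%:R ^- 5)%:E)%E.
  apply: (deviation_probability (s := c) (b := c * (t ^+ 2 * C))) => //.
  - by apply: measurable_funM => //; apply: mmin.
  - have := @truncated_product_mgf _ _ _ P _ (X j1) q Ceps csub L csub0 L1 q1
      (delta_mx 0 i.1.2) (v i.1.1) (fun w => dot (X j1 w) (delta_mx 0 i.2)) t.
    under [X in _ -> _ -> (X <= _)%E]eq_integral do rewrite !dot_delta.
    apply; first exact: measurable_dot_RV.
    by apply: triple_moment => //; rewrite l2norm_delta.
  - by rewrite /C; field.
have [mU1 U1] := union_bound (fun i => (D1 i).1) (fun i => (D1 i).2).
have [mU2 U2] := union_bound (fun i => (D2 i).1) (fun i => (D2 i).2).
have [mU3 U3] := union_bound (fun i => (D3 i).1) (fun i => (D3 i).2).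
have [mU4 U4] := union_bound (fun i => (D4 i).1) (fun i => (D4 i).2).
pose U := ([set w | exists i, B1 i w] `|` [set w | exists i, B2 i w]) `|`
          ([set w | exists i, B3 i w] `|` [set w | exists i, B4 i w]).
have mU : measurable U by apply: measurableU; exact: measurableU.
have PU : (P U <= (6 / p%:R ^+ 2)%:E)%E.
  have m12 := measurableU _ _ mU1 mU2; have m34 := measurableU _ _ mU3 mU4.
  apply: le_trans (measureU2 _ m12 m34) _.
  apply: le_trans (leeD (measureU2 _ mU1 mU2) (measureU2 _ mU3 mU4)) _.
  apply: le_trans (leeD (leeD U1 U2) (leeD U3 U4)) _.
  rewrite -!EFinD lee_fin !card_prod card_bool !card_ord !natrM.
  have x1 : 1 <= p%:R :> R by rewrite ler1n.
  move: x1; set x : R := p%:R => x1; have x0 : 0 < x by lra.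
  rewrite -!mulrDl ler_pdivrMr ?exprn_gt0 //.
  have -> : 6 / x ^+ 2 * x ^+ 5 = 6 * x ^+ 3 by field; rewrite gt_eqF.
  have x2 : x <= x * x by rewrite ler_peMr // ltW.
  have x3 : x * x <= x * x * x by rewrite ler_peMr // mulr_ge0 // ltW.
  by rewrite !exprS expr0; lra.
exists (~` U); split; first exact: measurableC.
  by rewrite probability_setC // EFinB leeB.
move=> w nU; split.
- move=> k; apply: (@signed_norm_le (fun u => score_corr _ _ t 0 u)) => [|b]; first exact: score_corrN.
  rewrite score_corr0 leNgt; apply/negP => h; apply: nU.
  by left; left; exists (k, b).
- move=> k j; apply: (@signed_norm_le (fun u =>
    average (fun i => dot (X i w) u * tnth (X i w) j) - (u *m Sigma) 0 j)) => [|b].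
    rewrite /= mulNmx [X in _ - X = _]mxE; set y := (v k *m Sigma) 0 j.
    have -> : average (fun i => dot (X i w) (- v k) * tnth (X i w) j) =
        -1 * average (fun i => dot (X i w) (v k) * tnth (X i w) j).
      by rewrite -averageZ; congr average; apply/funext => i; rewrite dotN mulN1r mulNr.
    by ring.
  rewrite lerBlDl leNgt; apply/negP => h; apply: nU.
  by left; right; exists (k, j, b).
- move=> k j; rewrite leNgt; apply/negP => h; apply: nU.
  by right; left; exists (k, j).
- move=> k j l; rewrite leNgt; apply/negP => h; apply: nU.
  by right; right; exists (k, j, l).
Qed.

End concentration.

(** * The adaptive weights *)
Section adaptive_weights.
Context (R : realType) (n p : nat) (bstar init : 'rV[R]_p) (Cinit l K2 lam : R).
Let S := supp bstar.
Let s : R := #|S|%:R.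
Let rt : R := rate n p.
Let B := Sbar n Cinit init.
Hypotheses (Cinit1 : 1 <= Cinit) (l0 : 0 < l) (rt0 : 0 < rt) (s_gt0 : (0 < #|S|)%N).
Hypotheses (K2_ge : 2 * Cinit + 2 * l + 1 <= K2) (lsrt : 2 * l * (s * rt) <= 1).
Hypothesis initb : init_bounds n Cinit bstar init.
Hypothesis bmin : ((K2 * s * rt)%:E <= beta_min bstar)%E.
Hypothesis lamE : lam = l * Num.sqrt #|B|%:R * rt ^+ 2.

Lemma rate_ge0 : 0 <= rate n p :> R.
Proof. exact: sqrtr_ge0. Qed.

Let s1 : 1 <= s. Proof. by rewrite /s ler1n. Qed.
Let ss0 : 0 < Num.sqrt s. Proof. by rewrite sqrtr_gt0 ltr0n. Qed.
Let ss1 : 1 <= Num.sqrt s. Proof. by rewrite -[leLHS]sqrtr1 ler_wsqrtr. Qed.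
Let ssE : Num.sqrt s * Num.sqrt s = s. Proof. by rewrite -expr2 sqr_sqrtr ?ler0n. Qed.
Let sss : Num.sqrt s <= s. Proof. by rewrite -[leRHS]ssE ler_peMr // ltW. Qed.

Lemma beta_min_le k : k \in S -> K2 * s * rt <= `|bstar 0 k|.
Proof.
move=> kS; rewrite -lee_fin; apply: le_trans bmin _.
exact: bigmin_le_cond.
Qed.

Lemma init_coord_le k : `|init 0 k - bstar 0 k| <= Cinit * Num.sqrt s * rt.
Proof.
case: initb => h _; apply: le_trans h.
by have := coord_le_l2norm (init - bstar) k; rewrite !mxE.
Qed.

Lemma init_lower k : k \in S -> (K2 - Cinit) * s * rt <= `|init 0 k|.
Proof.
move=> kS; have h1 := beta_min_le kS; have h2 := init_coord_le k.
have h3 : Cinit * Num.sqrt s * rt <= Cinit * s * rt.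
  by rewrite ler_pM2r // ler_wpM2l //; have := Cinit1; lra.
have := ler_normB (init 0 k) (init 0 k - bstar 0 k); rewrite opprB addrC subrK; lra.
Qed.

Lemma init_upper k : k \notin S -> `|init 0 k| <= Cinit * Num.sqrt s * rt.
Proof.
move=> kS; have := init_coord_le k; move: kS; rewrite inE negbK => /eqP ->.
by rewrite subr0.
Qed.

Lemma supp_sub_Sbar : S \subset B.
Proof.
apply/fintype.subsetP => k kS; rewrite inE; apply: lt_le_trans (init_lower kS).
rewrite -subr_gt0 (_ : _ - _ = ((K2 - Cinit) * s - Cinit) * rt); last by rewrite /rt; ring.
rewrite mulr_gt0 // subr_gt0; have h1 := Cinit1; have h2 := K2_ge; have h3 := l0.
have h4 : K2 - Cinit <= (K2 - Cinit) * s by apply: ler_peMr; [lra|exact: s1].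
by lra.
Qed.

(** Every false inclusion costs more than [Cinit * rt] in the l1 error of the
    initial estimator, so there are at most [s] of them. *)
Lemma card_Sbar_bounds : s <= #|B|%:R <= 2 * s.
Proof.
rewrite ler_nat subset_leq_card ?supp_sub_Sbar //=.
have h : #|B :\: S|%:R <= s.
  have Cr : 0 < Cinit * rt by rewrite mulr_gt0 //; have := Cinit1; lra.
  rewrite -(ler_pM2r Cr); apply: (@le_trans _ _ (\sum_(k in B :\: S) `|(init - bstar) 0 k|)).
    rewrite mulr_natl -sumr_const; apply: ler_sum => k; rewrite !inE negbK => /andP[/eqP b0 /ltW].
    by rewrite !mxE b0 subr0.
  apply: le_trans (_ : l1norm (init - bstar) <= _).
    by rewrite /l1norm [leLHS]big_mkcond; apply: ler_sum => k _; case: ifP.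
  by case: initb => _; rewrite mulrCA mulrA.
have := cardsID S B; rewrite (finset.setIidPr supp_sub_Sbar) => <-.
by rewrite natrD -/s; lra.
Qed.

Let lam_le : lam <= 2 * l * Num.sqrt s * rt ^+ 2.
Proof.
rewrite lamE ler_pM2r ?exprn_gt0 // (_ : 2 * l * _ = l * (2 * Num.sqrt s)); last by ring.
rewrite ler_pM2l //.
have /andP[_ h] := card_Sbar_bounds.
apply: (@le_trans _ _ (Num.sqrt (2 ^+ 2 * s))).
  by apply: ler_wsqrtr; apply: le_trans h _; have := s1; lra.
by rewrite sqrtrM ?sqr_ge0 // sqrtr_sqr ger0_norm.
Qed.

Let lam_ge : l * Num.sqrt s * rt ^+ 2 <= lam.
Proof.
rewrite lamE ler_pM2r ?exprn_gt0 // ler_pM2l // ler_wsqrtr //.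
by have /andP[] := card_Sbar_bounds.
Qed.

Lemma penalty_level_ge0 : 0 <= lam.
Proof. by rewrite lamE !mulr_ge0 ?sqr_ge0 ?sqrtr_ge0 // ltW. Qed.

(** The signal makes [init] large on the support: the factor [K2 - Cinit >= 2 * l]
    cancels the penalty level, and the cap [1] in the weight is harmless by
    [lsrt]. *)
Lemma weight_on_support k : k \in S -> lam * al_weight init k <= rt / Num.sqrt s.
Proof.
move=> kS; rewrite ler_pdivlMr //.
have K2C : 2 * l <= K2 - Cinit by have h1 := Cinit1; have h2 := K2_ge; lra.
have srt : 0 < s * rt by rewrite mulr_gt0 //; have := s1; lra.
have lsr : 2 * l * (s * rt) <= `|init 0 k|.
  by apply: le_trans (init_lower kS); rewrite -[leRHS]mulrA ler_pM2r.
have i0 : 0 < `|init 0 k| by apply: lt_le_trans lsr; rewrite mulr_gt0 // mulr_gt0.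
have E : 2 * l * Num.sqrt s * rt ^+ 2 * Num.sqrt s = 2 * l * (s * rt) * rt.
  by transitivity (2 * l * rt ^+ 2 * (Num.sqrt s * Num.sqrt s)); [ring|rewrite ssE; ring].
have hl : lam * Num.sqrt s <= 2 * l * (s * rt) * rt.
  by rewrite -E ler_pM2r.
have h1 : lam * Num.sqrt s * 1 <= rt.
  by rewrite mulr1; apply: le_trans hl _; rewrite ler_piMl // ltW.
have h2 : lam * Num.sqrt s * `|init 0 k|^-1 <= rt.
  by rewrite ler_pdivrMr //; apply: le_trans hl _; rewrite mulrC ler_pM2l.
by rewrite mulrAC /al_weight /Num.max; case: ifP.
Qed.

(** Off the support [init] is pure error, at most [Cinit * sqrt s * rt], and the
    factor [sqrt #|Sbar|] in the penalty level compensates the [sqrt s]. *)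
Lemma weight_off_support k : k \notin S -> init 0 k != 0 ->
  l / Cinit * rt <= lam * al_weight init k.
Proof.
move=> kS i0; have ni : 0 < `|init 0 k| by rewrite normr_gt0.
apply: (@le_trans _ _ (lam / `|init 0 k|)); last first.
  by rewrite ler_wpM2l ?penalty_level_ge0 // le_max lexx.
have C0 : 0 < Cinit by have := Cinit1; lra.
rewrite ler_pdivlMr //; apply: le_trans lam_ge.
apply: (@le_trans _ _ (l / Cinit * rt * (Cinit * Num.sqrt s * rt))).
  by rewrite ler_wpM2l ?init_upper // mulr_ge0 ?divr_ge0 ?(ltW l0) ?(ltW C0) ?(ltW rt0).
rewrite le_eqVlt; apply/orP; left; apply/eqP.
by field; rewrite gt_eqF.
Qed.

Lemma init_neq0 k : k \in S -> init 0 k != 0.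
Proof.
move=> kS; rewrite -normr_gt0; apply: lt_le_trans (init_lower kS).
have h1 := Cinit1; have h2 := K2_ge; have h3 := l0; have h4 := s1.
by rewrite !mulr_gt0 //; lra.
Qed.

End adaptive_weights.

Lemma al_objective_shift (R : realType) (n p : nat) (X : 'I_n -> p.-tuple R)
    (e : 'I_n -> R) (bstar init b : 'rV[R]_p) (a lam : R) :
  al_objective a lam init X (fun i => dot (X i) bstar + e i) b =
  shifted_objective X e bstar a (fun k => lam * al_weight init k) (b - bstar).
Proof.
rewrite /al_objective /shifted_objective /empirical_loss /average; congr (_ * _ + _).
  by apply: eq_bigr => i _; congr pseudo_huber; rewrite dotB; ring.
rewrite /penalty mulr_sumr; apply: eq_bigr => k _.
by rewrite !mxE mulrA [_ + (_ - _)]addrC subrK.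
Qed.

Lemma sign_vec_eq (R : realType) (p : nat) (b bstar : 'rV[R]_p) :
  (forall k, bstar 0 k = 0 -> b 0 k = 0) ->
  (forall k, bstar 0 k != 0 -> `|b 0 k - bstar 0 k| < `|bstar 0 k|) ->
  sign_vec b = sign_vec bstar.
Proof.
move=> h0 h1; apply/rowP => k; rewrite !mxE.
have [b0|bn0] := eqVneq (bstar 0 k) 0; first by rewrite b0 h0.
have := h1 k bn0; have [bp|bp|b0] := ltgtP (bstar 0 k) 0; last by rewrite b0 eqxx in bn0.
  rewrite (ltr0_norm bp) ltr_norml => /andP[_ h].
  by rewrite (ltr0_sg bp) ltr0_sg //; lra.
rewrite (gtr0_norm bp) ltr_norml => /andP[h _].
by rewrite (gtr0_sg bp) gtr0_sg //; lra.
Qed.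

(** * Recovery on a fixed event *)
Section support_recovery.
Context (R : realType) (n p : nat) (X : 'I_n -> p.-tuple R) (e : 'I_n -> R).
Context (bstar init : 'rV[R]_p) (M : 'M[R]_p) (v : 'I_p -> 'rV[R]_p).
Context (cl CA CB CD CT Cinit l K2 Q lam : R).
Let S := supp bstar.
Let s : R := #|S|%:R.
Let rt : R := rate n p.
Let C1 := (2 + CA) / cl.
Let CE := 2 * CB + 12 * CD.
Hypotheses (rt0 : 0 < rt) (s_gt0 : (0 < #|S|)%N) (MT : M^T = M) (cl0 : 0 < cl).
Hypothesis form : forall u, cl * l2norm u ^+ 2 <= bilin M u u.
Hypotheses (CA0 : 0 <= CA) (CB0 : 0 <= CB) (CD0 : 0 <= CD) (CT0 : 0 <= CT).
Hypothesis vS : forall k, k \in S -> v k = delta_mx 0 k.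
Hypothesis vC : forall k, k \notin S -> exists theta,
  [/\ supported S theta, v k = delta_mx 0 k - theta,
      forall j, j \in S -> (v k *m M) 0 j = 0 & l2norm theta <= CT].
Hypothesis noise : forall k, `|score_corr X e rt 0 (v k)| <= CA * rt.
Hypothesis covariance : forall k j,
  `|average (fun i => dot (X i) (v k) * tnth (X i) j) - (v k *m M) 0 j| <= CB * rt.
Hypothesis large_noise : forall k j,
  average (fun i => `|dot (X i) (v k)| * `|tnth (X i) j| *
    Num.min 1 (rt ^+ 2 * e i ^+ 2)) <= CD * rt ^+ 2.
Hypothesis large_covariates : forall k j j',
  average (fun i => `|dot (X i) (v k)| * `|tnth (X i) j| *
    Num.min 1 (rt ^+ 2 * tnth (X i) j' ^+ 2)) <= CD * rt ^+ 2.
Hypotheses (Cinit1 : 1 <= Cinit) (lE : l = Cinit * (CA + 2 + CT)).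
Hypotheses (Q1 : 1 <= Q) (QC1 : C1 <= Q) (QCE : C1 * CE <= Q) (Ql : 2 * l <= Q).
Hypotheses (srt : s * rt * Q <= 1) (K2_ge : 2 * Cinit + 2 * l + 1 + C1 <= K2).
Hypothesis initb : init_bounds n Cinit bstar init.
Hypothesis bmin : ((K2 * s * rt)%:E <= beta_min bstar)%E.
Hypothesis lamE : lam = l * Num.sqrt #|Sbar n Cinit init|%:R * rt ^+ 2.

Let s1 : 1 <= s. Proof. by rewrite /s ler1n. Qed.
Let ssE : Num.sqrt s * Num.sqrt s = s. Proof. by rewrite -expr2 sqr_sqrtr ?ler0n. Qed.
Let ss1 : 1 <= Num.sqrt s. Proof. by rewrite -[leLHS]sqrtr1 ler_wsqrtr. Qed.
Let sss : Num.sqrt s <= s. Proof. by rewrite -[leRHS]ssE ler_peMr ?sqrtr_ge0. Qed.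
Let C10 : 0 < C1. Proof. by rewrite divr_gt0 //; have := CA0; lra. Qed.
Let CE0 : 0 <= CE. Proof. by rewrite /CE; have := CB0; have := CD0; lra. Qed.
Let x0 : 0 < s * rt. Proof. by rewrite mulr_gt0 //; have := s1; lra. Qed.

Let scaled_le (c : R) : c <= Q -> s * rt * c <= 1.
Proof. by move=> cQ; apply: le_trans srt; rewrite ler_pM2l. Qed.

Lemma radius_le1 : Num.sqrt s * rt * C1 <= 1.
Proof.
apply: le_trans (scaled_le QC1); rewrite ler_pM2r // ler_pM2r //.
Qed.

(** All errors of [score_corr_linearization] carry the factor [l1norm D], at most
    [s * rt * C1]; the sample size condition [s * rt * Q <= 1] absorbs the
    constants. *)
Lemma uniform_linearization k D : supported S D ->
  l2norm D <= Num.sqrt s * rt * C1 ->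
  `|score_corr X e rt 0 (v k) - score_corr X e rt D (v k) - 2 * bilin M (v k) D| <= rt.
Proof.
move=> DS Dr.
have D1 : l2norm D <= 1 := le_trans Dr radius_le1.
apply: le_trans (score_corr_linearization rt0 DS D1 (covariance k) (large_noise k)
  (large_covariates k)) _.
have l1 : l1norm D <= s * rt * C1.
  apply: le_trans (l1norm_le_l2norm DS) _.
  have -> : s * rt * C1 = Num.sqrt s * (Num.sqrt s * rt * C1).
    by rewrite !mulrA ssE.
  by rewrite ler_wpM2l ?sqrtr_ge0.
have srt1 : s * rt <= 1 by rewrite -[leLHS]mulr1; exact: scaled_le.
have rt1 : rt <= 1.
  by apply: le_trans srt1; rewrite ler_peMl // ltW.
have br : 2 * (CB * rt) + 6 * (CD * rt ^+ 2) + 6 * #|S|%:R * (CD * rt ^+ 2) <= CE * rt.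
  have h1 : CD * rt * rt <= CD * rt by rewrite ler_piMr // mulr_ge0 // ltW.
  have h2 : CD * rt * (s * rt) <= CD * rt by rewrite ler_piMr // mulr_ge0 // ltW.
  by rewrite /CE -/s expr2; lra.
apply: (@le_trans _ _ (s * rt * C1 * (CE * rt))).
  apply: ler_pM => //; first exact: l1norm_ge0.
  rewrite !addr_ge0 // !mulr_ge0 ?ler0n // ltW //.
have -> : s * rt * C1 * (CE * rt) = s * rt * (C1 * CE) * rt by ring.
by rewrite ler_piMl ?(ltW rt0) // scaled_le.
Qed.

Lemma support_recovery (b : 'rV[R]_p) :
  is_adaptive_lasso rt lam init X (fun i => dot (X i) bstar + e i) b ->
  [/\ sign_vec b = sign_vec bstar, supported S (b - bstar),
      l2norm (b - bstar) <= C1 * Num.sqrt s * rt &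
      forall k, k \in S -> `|((b - bstar) *m M) 0 k| <= (2 + CA) / 2 * rt].
Proof.
move=> [bfeas bmin_obj].
have l0 : 0 < l.
  by rewrite lE mulr_gt0 //; [have := Cinit1|have := CA0; have := CT0]; lra.
have K2' : 2 * Cinit + 2 * l + 1 <= K2 by have := K2_ge; have := C10; lra.
have lsrt : 2 * l * (s * rt) <= 1 by rewrite mulrC; exact: scaled_le.
pose mu k := lam * al_weight init k.
have lam0 : 0 <= lam := penalty_level_ge0 l0 lamE.
have mu0 k : 0 <= mu k.
  by rewrite mulr_ge0 // le_max ler01 orbT.
have muS k : k \in S -> mu k <= rt / Num.sqrt s.
  exact: (weight_on_support Cinit1 l0 rt0 s_gt0 K2' lsrt initb bmin lamE).
pose forb k := init 0 k == 0.
have Sforb k : k \in S -> ~~ forb k.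
  exact: (init_neq0 Cinit1 l0 rt0 s_gt0 K2' initb bmin).
have muC k : k \notin S -> ~~ forb k -> (CA + 1 + CT) * rt < mu k.
  move=> kS ik; apply: lt_le_trans (weight_off_support Cinit1 l0 rt0 s_gt0 K2' initb bmin lamE kS ik).
  have Ci0 : 0 < Cinit by have := Cinit1; lra.
  rewrite ltr_pM2r // lE (_ : Cinit * _ / Cinit = CA + 2 + CT); first by lra.
  by field; rewrite gt_eqF.
have bstar0 k : forb k -> bstar 0 k = 0.
  move=> fk; have [kS|] := boolP (k \in S); first by have := Sforb k kS; rewrite fk.
  by rewrite inE negbK => /eqP.
have [||suppD normD gradD] := @primal_dual_witness R n p X e bstar rt mu M v cl rt CA CT
  rt0 mu0 MT cl0 form rt0 s_gt0 CA0 vS vC noise uniform_linearization muS forb (b - bstar)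
  Sforb muC.
- by move=> k fk; rewrite !mxE bstar0 // bfeas ?subrr //; apply/eqP.
- move=> W Wf; have := bmin_obj (bstar + W); rewrite !al_objective_shift.
  rewrite [bstar + W - _]addrAC subrr add0r; apply => k ik.
  by rewrite mxE bstar0 ?Wf ?addr0 //; apply/eqP.
have ss0 : 0 < Num.sqrt s := lt_le_trans ltr01 ss1.
have r0 : 0 < Num.sqrt s * rt * C1 := mulr_gt0 (mulr_gt0 ss0 rt0) C10.
have normD' : l2norm (b - bstar) <= C1 * Num.sqrt s * rt.
  by apply: le_trans normD _; move: r0; rewrite -/C1 -/s; lra.
split=> //; apply: sign_vec_eq => k.
  move=> bk; have kS : k \notin S by rewrite inE bk eqxx.
  by have := suppD k kS; rewrite !mxE bk subr0.
move=> bk; have kS : k \in S by rewrite inE.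
apply: (@lt_le_trans _ _ (K2 * s * rt)); last exact: (beta_min_le bmin).
have := coord_le_l2norm (b - bstar) k; rewrite !mxE => /le_lt_trans; apply.
apply: le_lt_trans normD' _; rewrite ltr_pM2r //.
apply: (@le_lt_trans _ _ (C1 * s)); first by rewrite ler_pM2l.
by rewrite ltr_pM2r; have := K2_ge; have := Cinit1; have := s1; lra.
Qed.

End support_recovery.

(** * Recovery with high probability *)
Section almost_sure.
Context d (T : measurableType d) (R : realType) (P : probability T R).

Lemma with_probability_ae (r : R) (A E Q : set T) : measurable A ->
  (r%:E <= P A)%E -> {ae P, forall w, Q w} -> (forall w, A w -> Q w -> E w) ->
  with_probability_at_least P r E.
Proof.
move=> mA rA [N [mN PN0 QN]] AQE; exists (A `\` N); split.
- exact: measurableD.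
- move=> w [Aw nN]; apply: AQE => //; apply: contrapT => nQ; apply: nN; exact: QN.
apply: le_trans rA _.
have -> : P (A `\` N) = (P (A `\` N) + P N)%E by rewrite PN0 adde0.
apply: le_trans (measureU2 _ (measurableD mA mN) mN).
apply: le_measure; rewrite ?inE //; first by apply: measurableU => //; exact: measurableD.
by move=> w Aw; have [Nw|nN] := pselect (N w); [right|left].
Qed.

Lemma with_probability_weaken (r r' : R) (E E' : set T) : r' <= r -> E `<=` E' ->
  with_probability_at_least P r E -> with_probability_at_least P r' E'.
Proof.
move=> rr EE [A [mA AE rA]]; exists A; split => //; first exact: subset_trans AE EE.
by apply: le_trans rA; rewrite lee_fin.
Qed.

Lemma with_probability_nonpos (r : R) (E : set T) : r <= 0 ->
  with_probability_at_least P r E.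
Proof. by move=> r0; exists set0; split => //; rewrite measure0 lee_fin. Qed.

End almost_sure.

(** With an empty support the initial estimator is exactly [0], so every coordinate
    is constrained to vanish. *)
Lemma null_signal_recovery (R : realType) (n p : nat) (a lam Cinit : R)
    (bstar init b : 'rV[R]_p) X Y : #|supp bstar| = 0%N ->
  init_bounds n Cinit bstar init -> @is_adaptive_lasso R n p a lam init X Y b ->
  sign_vec b = sign_vec bstar /\ b - bstar = 0.
Proof.
move=> s0 [h _] [bf _].
have b0 : bstar = 0.
  apply/rowP => k; rewrite mxE; apply/eqP; apply: contraT => bk.
  have : k \in supp bstar by rewrite inE.
  by rewrite (card0_eq s0) inE.
move: h; rewrite s0 sqrtr0 mulr0 mul0r b0 subr0 => h.
have i0 : init = 0 by apply: l2norm_eq0; apply/eqP; rewrite eq_le h l2norm_ge0.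
have -> : b = 0 by apply/rowP => k; rewrite [RHS]mxE; apply: bf; rewrite i0 mxE.
by rewrite subrr.
Qed.

Section constants.
Context (R : realType) (q Ceps cl csub Cinit : R).

(** Bounds the coefficients of the linear predictors: [cl] times their squared norm
    is at most a diagonal entry of the second moment. *)
Definition projection_bound : R := Num.sqrt (4 * csub ^+ 2 * exp_square_bound R / cl).
Definition direction_bound : R := 1 + projection_bound.
Let C := moment_bound q Ceps csub direction_bound.
Let c := moment_rate q csub direction_bound.
Definition noise_level : R := 6 * C + 5.
Definition covariance_level : R := C + 5.
Definition truncation_level : R := C + 5 / c.
Definition error_level : R := (2 + noise_level) / cl.
(** Off the support, the penalty level divided by [Cinit] has to exceed the dual
    bound [noise_level + 1 + projection_bound]. *)
Definition penalty_constant : R := Cinit * (noise_level + 2 + projection_bound).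
(** [sample_constant] times [s * rate n p] is at most [1]. The summands serve, in
    this order: a rate below [1]; a rate below [c], which is needed for the
    exponential moments; the radius of the ball below [1]; the linearization error;
    the weights on the support. *)
Definition sample_constant : R := 1 + c^-1 + error_level +
  error_level * (2 * covariance_level + 12 * truncation_level) + 2 * penalty_constant.
(** [error_level] secures the signs, the other terms the weights on the support. *)
Definition signal_constant : R := 2 * Cinit + 2 * penalty_constant + 1 + error_level.

Hypotheses (q1 : 1 < q) (csub0 : 0 < csub) (cl0 : 0 < cl) (Cinit1 : 1 <= Cinit).

Lemma constants_positive :
  [/\ 0 <= projection_bound, 0 < C, 0 < c, 0 < penalty_constant &
   [/\ 0 < error_level, 1 <= sample_constant & 0 < signal_constant]] /\
  [/\ c^-1 <= sample_constant, error_level <= sample_constant,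
   error_level * (2 * covariance_level + 12 * truncation_level) <= sample_constant &
   2 * penalty_constant <= sample_constant].
Proof.
have p0 : 0 <= projection_bound by exact: sqrtr_ge0.
have L0 : 0 < direction_bound by rewrite /direction_bound; lra.
have C0 : 0 < C by exact: moment_bound_gt0.
have c0 : 0 < c by exact: moment_rate_gt0.
have i0 : 0 < c^-1 by rewrite invr_gt0.
have n0 : 0 < noise_level by rewrite /noise_level; lra.
have e0 : 0 < error_level by rewrite divr_gt0 //; lra.
have l0 : 0 < penalty_constant.
  by rewrite /penalty_constant mulr_gt0 //; have := Cinit1; lra.
have h0 : 0 <= error_level * (2 * covariance_level + 12 * truncation_level).
  rewrite mulr_ge0 ?(ltW e0) // /covariance_level /truncation_level.
  by rewrite addr_ge0 // mulr_ge0 //; lra.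
have Ci := Cinit1.
by rewrite /sample_constant /signal_constant; do !split => //; lra.
Qed.

End constants.

Section recovery_probability.
Context d (T : measurableType d) (R : realType) (P : probability T R) (n p : nat).
Context (X : 'I_n -> {RV P >-> p.-tuple R}) (eps : 'I_n -> {RV P >-> R}).
Context (m : nat) (q Ceps cl cu csub Cinit : R) (n0 : (0 < n)%N) (p2 : (1 < p)%N).
Context (bstar : 'rV[R]_p) (init : T -> 'rV[R]_p) (alpha : R) (lambda : T -> R)
  (bAL : T -> 'rV[R]_p).
Let j1 := Ordinal n0.
Let s : R := #|supp bstar|%:R.
Let rt : R := rate n p.
Let l := penalty_constant q Ceps cl csub Cinit.
Let Q := sample_constant q Ceps cl csub Cinit.
Let K2 := signal_constant q Ceps cl csub Cinit.
Let C1 := error_level q Ceps cl csub.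
Let CA := noise_level q Ceps cl csub.
Let L := direction_bound cl csub.
Let CT := projection_bound cl csub.
Let M := second_moment (X j1).
Hypothesis (Cinit1 : 1 <= Cinit).
Hypothesis model : regression_model X eps.
Hypothesis assumption : assumption_A m q Ceps cl cu csub (X j1) (eps j1).
Hypothesis s_gt0 : (0 < #|supp bstar|)%N.
Hypothesis alphaE : alpha = rt.
Hypothesis initb : {ae P, forall w, init_bounds n Cinit bstar (init w)}.
Hypothesis lamb : {ae P, forall w,
  lambda w = l * Num.sqrt #|Sbar n Cinit (init w)|%:R * rt ^+ 2}.
Hypothesis sample : Q ^+ 2 * s ^+ 2 * ln p%:R <= n%:R.
Hypothesis bmin : ((K2 * s * rt)%:E <= beta_min bstar)%E.
Hypothesis bALP : {ae P, forall w, is_adaptive_lasso alpha (lambda w) (init w)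
     (fun j => X j w) (response X eps bstar w) (bAL w)}.

Let p0 : (0 < p)%N. Proof. exact: ltnW. Qed.

Lemma second_moment_form : M^T = M /\ forall u, cl * l2norm u ^+ 2 <= bilin M u u.
Proof.
have MT : M^T = M by exact: second_moment_sym.
split=> // u; case: assumption => _ [cl0 clM _] _.
exact: lambda_min_le_form.
Qed.

(** The directions are fixed before the sample is seen, which is what makes the
    union bound of [concentration] applicable. *)
Lemma recovery_probability : with_probability_at_least P (1 - 6 / p%:R ^+ 2)
  [set w | [/\ sign_vec (bAL w) = sign_vec bstar, supported (supp bstar) (bAL w - bstar),
     l2norm (bAL w - bstar) <= C1 * Num.sqrt s * rt &
     forall k, k \in supp bstar -> `|((bAL w - bstar) *m M) 0 k| <= (2 + CA) / 2 * rt]].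
Proof.
have [MT form] := second_moment_form.
case: assumption => [[m23 q1 moment] [cl0 _ _] [csub0 sg]].
have [[CT0 C0 c0 l0 [C10 Q1 K20]] [cQ C1Q CEQ lQ]] :=
  constants_positive Ceps q1 csub0 cl0 Cinit1.
have lnp : 0 < ln (p%:R : R) by rewrite ln_gt0 // ltr1n.
have nr0 : 0 < n%:R :> R by rewrite ltr0n.
have rt0 : 0 < rt by rewrite sqrtr_gt0 divr_gt0.
have s1 : 1 <= s by rewrite ler1n.
have Q0 : 0 < Q := lt_le_trans ltr01 Q1.
have srt : s * rt * Q <= 1.
  have srtQ : 0 <= s * rt * Q.
    by rewrite mulr_ge0 ?(ltW Q0) // mulr_ge0 ?(ltW rt0) // ler0n.
  rewrite -(@expr_le1 _ 2) //.
  rewrite !exprMn /rt /rate sqr_sqrtr; last by rewrite divr_ge0 // ltW.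
  rewrite -(ler_pM2r nr0) mul1r; apply: le_trans sample.
  by rewrite le_eqVlt; apply/orP; left; apply/eqP; field; rewrite gt_eqF.
have rtc : rt <= moment_rate q csub L.
  rewrite -[leRHS]invrK -[leRHS]mul1r ler_pdivlMr ?invr_gt0 //.
  apply: le_trans srt; apply: ler_pM => //; first exact: ltW.
  - by rewrite invr_ge0 ltW.
  by rewrite ler_peMl // ltW.
have L1 : 1 <= L by rewrite /L /direction_bound; lra.
have dirs k : exists vk, [/\ l2norm vk <= L, k \in supp bstar -> vk = delta_mx 0 k &
   k \notin supp bstar -> exists theta, [/\ supported (supp bstar) theta,
     vk = delta_mx 0 k - theta, forall j, j \in supp bstar -> (vk *m M) 0 j = 0 &
     l2norm theta <= CT]].
  have [kS|kS] := boolP (k \in supp bstar).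
    by exists (delta_mx 0 k); split => //; rewrite l2norm_delta.
  have [th [thS orth thM]] := projection_coefficients (supp bstar) k MT cl0 form.
  have thCT : l2norm th <= CT.
    rewrite -[leLHS]ger0_norm ?l2norm_ge0 // -sqrtr_sqr ler_wsqrtr // ler_pdivlMr // mulrC.
    by apply: le_trans thM _; exact: (second_moment_diag_le Ceps csub0 L1 q1 sg).
  exists (delta_mx 0 k - th); split => //.
    by apply: le_trans (ler_l2normD _ _) _; rewrite l2normN l2norm_delta lerD2l.
  by move=> _; exists th.
have [v vP] := choice dirs.
have vL k : l2norm (v k) <= L by case: (vP k).
have [A [mA PA AE]] := concentration p0 csub0 L1 q1 model sg m23 moment vL rt0 rtc.
apply: (with_probability_ae mA PA (filterI initb (filterI lamb bALP))).
move=> w Aw [iw [lw bw]]; have [E1 E2 E3 E4] := AE w Aw.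
apply: (@support_recovery R n p (fun j => X j w) (fun j => eps j w) bstar (init w) M v
  cl CA (covariance_level q Ceps cl csub) (truncation_level q Ceps cl csub) CT Cinit l K2 Q (lambda w)) => //.
- by rewrite /CA /noise_level; lra.
- by rewrite /covariance_level; lra.
- by apply: addr_ge0; [exact: ltW|apply: divr_ge0 => //; exact: ltW].
- by move=> k; case: (vP k).
- by move=> k; case: (vP k).
- by move: bw; rewrite alphaE.
Qed.

End recovery_probability.

(** The two parts of the theorem differ only in the way the coordinates of the
    error are bounded, here the hypothesis on [bound]. *)
Lemma estimation_probability (R : realType) (m : nat) (q Ceps cl cu csub Cinit : R)
    (n p : nat) (n_gt0 : (0 < n)%N) (p_gt0 : (0 < p)%N) d (T : measurableType d)
    (P : probability T R) (X : 'I_n -> {RV P >-> p.-tuple R}) (eps : 'I_n -> {RV P >-> R})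
    (bstar : 'rV[R]_p) (init : T -> 'rV[R]_p) (alpha : R) (lambda : T -> R)
    (bAL : T -> 'rV[R]_p) (bound : R) :
  let l := penalty_constant q Ceps cl csub Cinit in
  let Q := sample_constant q Ceps cl csub Cinit in
  let K2 := signal_constant q Ceps cl csub Cinit in
  let C1 := error_level q Ceps cl csub in
  let CA := noise_level q Ceps cl csub in
  let s : R := #|supp bstar|%:R in
  let j1 : 'I_n := Ordinal n_gt0 in
  let M := second_moment (X j1) in
  1 <= Cinit -> regression_model X eps ->
  assumption_A m q Ceps cl cu csub (X j1) (eps j1) ->
  {ae P, forall w, init_bounds n Cinit bstar (init w)} ->
  1 * rate n p <= alpha <= 1 * rate n p ->
  {ae P, forall w,
     l * Num.sqrt #|Sbar n Cinit (init w)|%:R * ln p%:R / n%:R <= lambda w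
       <= l * Num.sqrt #|Sbar n Cinit (init w)|%:R * ln p%:R / n%:R} ->
  Q ^+ 2 * s ^+ 2 * ln p%:R <= n%:R ->
  ((K2 * s * rate n p)%:E <= beta_min bstar)%E ->
  {ae P, forall w, is_adaptive_lasso alpha (lambda w) (init w)
     (fun j => X j w) (response X eps bstar w) (bAL w)} ->
  0 <= bound ->
  (forall D : 'rV[R]_p, M^T = M -> (forall u, cl * l2norm u ^+ 2 <= bilin M u u) ->
     supported (supp bstar) D -> l2norm D <= C1 * Num.sqrt s * rate n p ->
     (forall k, k \in supp bstar -> `|(D *m M) 0 k| <= (2 + CA) / 2 * rate n p) ->
     forall k, `|D 0 k| <= bound) ->
  with_probability_at_least P
     (1 - 1 * expR (- (1 * n%:R)) - 6 / p%:R ^+ 2)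
     [set w | sign_vec (bAL w) = sign_vec bstar /\ linfnorm (bAL w - bstar) <= bound].
Proof.
move=> l Q K2 C1 CA s j1 M Cinit_ge1 model ass initb /andP[al1 al2] lamb sample bmin bALP bound0 boundP.
have e0 : 0 <= 1 * expR (- (1 * n%:R)) :> R by rewrite mul1r expR_ge0.
(* For [p = 1] the rate vanishes and the probability bound is not positive. *)
have [p1|p2] := leqP p 1.
  have pE : p%:R = 1 :> R.
    by have /eqP -> : p == 1%N by rewrite eqn_leq p1.
  by apply: with_probability_nonpos; rewrite pE expr1n; lra.
(* The sample size condition is void for an empty support. *)
have [s0|s_gt0] := posnP #|supp bstar|.
  apply: (@with_probability_ae _ _ _ P _ setT _ _ measurableT _ (filterI initb bALP)).
    rewrite probability_setT lee_fin.
    have : 0 <= 6 / p%:R ^+ 2 :> R by rewrite divr_ge0 ?exprn_ge0.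
    by lra.
  move=> w _ [iw bw] /=; have [sE ->] := null_signal_recovery s0 iw bw; split => //.
  by apply: linfnorm_le => // k; rewrite mxE normr0.
have alE : alpha = rate n p by apply/eqP; rewrite eq_le; move: al1 al2; rewrite mul1r => -> ->.
have lamE : {ae P, forall w, lambda w = l * Num.sqrt #|Sbar n Cinit (init w)|%:R * rate n p ^+ 2}.
  apply: filterS lamb => w; rewrite -eq_le => /eqP <-.
  rewrite /rate sqr_sqrtr; first by rewrite mulrA.
  by rewrite divr_ge0 ?ler0n // ln_ge0 // ler1n.
have rec := recovery_probability p2 Cinit_ge1 model ass s_gt0 alE initb lamE sample bmin bALP.
have [MT form] := second_moment_form ass.
apply: with_probability_weaken rec; first by lra.
move=> w [sE DS Dr Dg]; split => //; apply: linfnorm_le => // k.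
exact: (boundP _ MT form DS Dr Dg).
Qed.

Theorem theorem2 (R : realType) (m : nat)
    (q Ceps cl cu csub Cinit Cbeta : R) (Cinit_ge1 : 1 <= Cinit) :
  (forall CSX : R, 0 < CSX ->
   exists a1 a2 l1 l2 K1 K2 K3 c1 c2 c3 : R,
   [/\ 0 < a1 <= a2, 0 < l1 <= l2, [/\ 0 < K1, 0 < K2 & 0 < K3]
     & [/\ 0 < c1, 0 < c2 & 0 < c3]] /\
   forall (n p : nat) (n_gt0 : (0 < n)%N) (p_gt0 : (0 < p)%N)
     (d : measure_display) (T : measurableType d) (P : probability T R)
     (X : 'I_n -> {RV P >-> p.-tuple R}) (eps : 'I_n -> {RV P >-> R})
     (bstar : 'rV[R]_p) (init : T -> 'rV[R]_p)
     (alpha : R) (lambda : T -> R) (bAL : T -> 'rV[R]_p),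
   let s : R := #|supp bstar|%:R in
   let j1 : 'I_n := Ordinal n_gt0 in
   regression_model X eps ->
   assumption_A m q Ceps cl cu csub (X j1) (eps j1) ->
   Num.max 8^-1 (2 * l2norm bstar) <= Cbeta ->
   {ae P, forall w, init_bounds n Cinit bstar (init w)} ->
   norm_M_infty (invmx (principal_submx (supp bstar) (second_moment (X j1))))
     <= CSX ->
   a1 * rate n p <= alpha <= a2 * rate n p ->
   {ae P, forall w,
     l1 * Num.sqrt #|Sbar n Cinit (init w)|%:R * ln p%:R / n%:R <= lambda w
       <= l2 * Num.sqrt #|Sbar n Cinit (init w)|%:R * ln p%:R / n%:R} ->
   K1 * s ^+ 2 * ln p%:R <= n%:R ->
   ((K2 * s * rate n p)%:E <= beta_min bstar)%E ->
   {ae P, forall w, is_adaptive_lasso alpha (lambda w) (init w)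
     (fun j => X j w) (response X eps bstar w) (bAL w)} ->
   with_probability_at_least P
     (1 - c1 * expR (- (c2 * n%:R)) - c3 / p%:R ^+ 2)
     [set w | sign_vec (bAL w) = sign_vec bstar /\
              linfnorm (bAL w - bstar) <= K3 * rate n p])
  /\
  (exists a1 a2 l1 l2 K1 K2 K3 c1 c2 c3 : R,
   [/\ 0 < a1 <= a2, 0 < l1 <= l2, [/\ 0 < K1, 0 < K2 & 0 < K3]
     & [/\ 0 < c1, 0 < c2 & 0 < c3]] /\
   forall (n p : nat) (n_gt0 : (0 < n)%N) (p_gt0 : (0 < p)%N)
     (d : measure_display) (T : measurableType d) (P : probability T R)
     (X : 'I_n -> {RV P >-> p.-tuple R}) (eps : 'I_n -> {RV P >-> R})
     (bstar : 'rV[R]_p) (init : T -> 'rV[R]_p)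
     (alpha : R) (lambda : T -> R) (bAL : T -> 'rV[R]_p),
   let s : R := #|supp bstar|%:R in
   let j1 : 'I_n := Ordinal n_gt0 in
   regression_model X eps ->
   assumption_A m q Ceps cl cu csub (X j1) (eps j1) ->
   Num.max 8^-1 (2 * l2norm bstar) <= Cbeta ->
   {ae P, forall w, init_bounds n Cinit bstar (init w)} ->
   s <= ln p%:R ->
   a1 * rate n p <= alpha <= a2 * rate n p ->
   {ae P, forall w,
     l1 * Num.sqrt #|Sbar n Cinit (init w)|%:R * ln p%:R / n%:R <= lambda w
       <= l2 * Num.sqrt #|Sbar n Cinit (init w)|%:R * ln p%:R / n%:R} ->
   K1 * s ^+ 2 * ln p%:R <= n%:R ->
   ((K2 * s * rate n p)%:E <= beta_min bstar)%E ->
   {ae P, forall w, is_adaptive_lasso alpha (lambda w) (init w)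
     (fun j => X j w) (response X eps bstar w) (bAL w)} ->
   with_probability_at_least P
     (1 - c1 * expR (- (c2 * n%:R)) - c3 / p%:R ^+ 2)
     [set w | sign_vec (bAL w) = sign_vec bstar /\
              linfnorm (bAL w - bstar) <= K3 * Num.sqrt s * rate n p]).

Proof.
(* The constants must be produced before the assumptions on these parameters are
   known; outside their range the assumptions are contradictory. *)
have [/andP[/andP[q1 cl0] csub0]|bad] := boolP ((1 < q) && (0 < cl) && (0 < csub)); last first.
  have absurd (A : Prop) n (p : nat) (n_gt0 : (0 < n)%N) d (T : measurableType d)
      (P : probability T R) (X : 'I_n -> {RV P >-> p.-tuple R}) (eps : 'I_n -> {RV P >-> R}) :
      assumption_A m q Ceps cl cu csub (X (Ordinal n_gt0)) (eps (Ordinal n_gt0)) -> A.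
    by move=> [[_ q1 _] [cl0 _ _] [csub0 _]]; move: bad; rewrite q1 cl0 csub0.
  split=> [CSX _|]; (exists 1, 1, 1, 1, 1, 1, 1, 1, 1, 1; split; first by rewrite ltr01 lexx);
    move=> n p n_gt0 p_gt0 d T P X eps bstar init alpha lambda bAL s j1 model ass *;
    exact: (absurd _ n p n_gt0 d T P X eps ass).
have [[CT0 C0 c0 l0 [C10 Q1 K20]] _] := constants_positive Ceps q1 csub0 cl0 Cinit_ge1.
set l := penalty_constant q Ceps cl csub Cinit in l0.
set Q := sample_constant q Ceps cl csub Cinit in Q1.
set K2 := signal_constant q Ceps cl csub Cinit in K20.
set C1 := error_level q Ceps cl csub in C10.
set CA := noise_level q Ceps cl csub.
have CA0 : 0 < 2 + CA by rewrite /CA /noise_level; lra.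
have Q0 : 0 < Q ^+ 2 by rewrite exprn_gt0 // (lt_le_trans ltr01).
split=> [CSX CSX0|].
  exists 1, 1, l, l, (Q ^+ 2), K2, (CSX * ((2 + CA) / 2)), 1, 1, 6; split.
    by rewrite ltr01 l0 !lexx Q0 K20; split => //; split => //; rewrite mulr_gt0 // divr_gt0.
  move=> n p n_gt0 p_gt0 d T P X eps bstar init alpha lambda bAL s j1 model ass _ initb
    inv alb lamb sample bmin bALP.
  have r0 := rate_ge0 R n p.
  apply: (estimation_probability p_gt0 Cinit_ge1 model ass initb alb lamb sample bmin bALP).
    apply: mulr_ge0 => //; apply: mulr_ge0; first exact: ltW.
    by apply: divr_ge0 => //; exact: ltW.
  move=> D MT form DS _ Dg k; rewrite -mulrA.
  apply: (linf_le_inverse_norm MT cl0 _ form inv DS Dg).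
  by apply: mulr_ge0 => //; apply: divr_ge0 => //; exact: ltW.
exists 1, 1, l, l, (Q ^+ 2), K2, C1, 1, 1, 6; split.
  by rewrite ltr01 l0 !lexx Q0 K20 C10; split => //; split.
move=> n p n_gt0 p_gt0 d T P X eps bstar init alpha lambda bAL s j1 model ass _ initb
  _ alb lamb sample bmin bALP.
have r0 := rate_ge0 R n p.
apply: (estimation_probability p_gt0 Cinit_ge1 model ass initb alb lamb sample bmin bALP).
  by apply: mulr_ge0 => //; apply: mulr_ge0; [exact: ltW|exact: sqrtr_ge0].
move=> D _ _ _ Dr _ k; exact: le_trans (coord_le_l2norm D k) Dr.
Qed.
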